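(* Let $\Omega\subset\mathbb{R}^n$ be a bounded $C^2$ domain, $\lambda>0$, $\chi>0$, and let $u_0\in L^1(\Omega)$ satisfy $0\le u_0\le a$ a.e. in $\Omega$ for some constant $0<a<1$. Let $u$ be a global solution of $(P_\lambda)$. Then $$\int_{t_0}^T\int_{\Omega}u_t^2\,dx\,dt+\frac12\int_{\Omega}|\nabla u(x,T)|^2\,dx\le\frac12\int_{\Omega}|\nabla u(x,t_0)|^2\,dx+\frac{\lambda}{\chi(1+\chi|\Omega|)}$$ for any $T>t_0>0$. If $u_0\equiv0$ on $\Omega$, then $$\int_0^T\int_{\Omega}u_t^2\,dx\,dt+\frac12\int_{\Omega}|\nabla u(x,T)|^2\,dx\le\frac{\lambda}{\chi(1+\chi|\Omega|)}\quad\text{for all }T>0.$$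
   Context: For $0<T\le\infty$, $(P_\lambda)$ is the problem $$\frac{\partial u}{\partial t}=\Delta u+\frac{\lambda}{(1-u)^2\left(1+\chi\int_\Omega\frac{dy}{1-u(y,t)}\right)^2}\ \text{ in }\Omega\times(0,T),\quad u=0\ \text{ on }\partial\Omega\times(0,T),\quad u(x,0)=u_0\ \text{ in }\Omega.$$ A solution in $\Omega\times(0,T)$ is a function $u\in C^{2,1}(\Omega\times(0,T))\cap C(\overline\Omega\times(0,T))$, $0\le u<1$, satisfying the equation classically with $u=0$ on $\partial\Omega\times(0,T)$, such that $\sup_{\overline\Omega\times(0,T']}u<1$ for all $0<T'<T$ and $\|u(\cdot,t)-u_0\|_{L^1(\Omega)}\to0$ as $t\to0$. A global solution is a solution in $\Omega\times(0,\infty)$. *)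

(* Defs.v *)
From HB Require Import structures.
From mathcomp Require Import all_boot all_order all_algebra.
From mathcomp Require Import all_classical all_reals all_analysis.
Import Order.TTheory GRing.Theory Num.Theory.
Import numFieldNormedType.Exports.

Set Implicit Arguments.
Unset Strict Implicit.
Unset Printing Implicit Defensive.

Local Open Scope classical_set_scope.
Local Open Scope ring_scope.

(* Points of R^n are row vectors. 'rV[R]_n carries the sigma-algebra generated
   by its coordinates, which is the Borel one. *)

Definition rV_display : measure_display -> measure_display.
Proof. exact. Qed.

Section measurable_rV.
Context {R : realType} (n : nat).

Definition rV_coord (i : 'I_n) (x : 'rV[R]_n) : measurableTypeR R := x ord0 i.

Let rV_set0 : g_sigma_preimage rV_coord set0.
Proof. exact: sigma_algebra0. Qed.

Let rV_setC A : g_sigma_preimage rV_coord A -> g_sigma_preimage rV_coord (~` A).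
Proof. exact: sigma_algebraC. Qed.

Let rV_bigcup (F : (set 'rV[R]_n)^nat) :
  (forall i, g_sigma_preimage rV_coord (F i)) ->
  g_sigma_preimage rV_coord (\bigcup_i F i).
Proof. exact: sigma_algebra_bigcup. Qed.

HB.instance Definition _ :=
  @isMeasurable.Build (rV_display R.-ocitv.-measurable.-sigma)
    'rV[R]_n (g_sigma_preimage rV_coord) rV_set0 rV_setC rV_bigcup.

Lemma measurable_rV_coord (i : 'I_n) : measurable_fun setT (rV_coord i).
Proof.
move=> _ Y mY; rewrite setTI; apply: sub_sigma_algebra => /=.
rewrite -bigcup_seq/=; exists i => /=; first by rewrite mem_index_enum.
by exists Y => //; rewrite setTI.
Qed.

Lemma measurable_rV_box (A : 'I_n -> set (measurableTypeR R)) :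
  (forall i, measurable (A i)) ->
  measurable [set x : 'rV[R]_n | forall i, A i (x ord0 i)].
Proof.
move=> mA; rewrite (_ : mkset _ = \bigcap_i (rV_coord i @^-1` A i)).
  apply: fin_bigcap_measurable; first exact: finite_finset.
  by move=> i _; rewrite -[X in measurable X]setTI; apply: measurable_rV_coord.
by apply/seteqP; split=> [x Ax i _|x Ax i]; apply: Ax.
Qed.

Lemma measurable_rV_open (U : set 'rV[R]_n) : open U -> measurable U.
Proof.
move=> oU.
pose F (p : 'rV[rat]_n * nat) : set 'rV[R]_n := [set x | forall i,
  ball (ratr (p.1 ord0 i) : R) p.2.+1%:R^-1 (x ord0 i)].
pose G p := if `[< F p `<=` U >] then F p else set0.
rewrite (_ : U = \bigcup_p G p).
  apply: countable_bigcupT_measurable => // p.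
  rewrite /G; case: ifPn => // _.
  apply: (measurable_rV_box (A := fun i =>
    ball (ratr (p.1 ord0 i) : R) p.2.+1%:R^-1)) => i.
  by rewrite ball_itv; exact: measurable_itv.
apply/seteqP; split=> [x Ux|x [p _]]; last first.
  by rewrite /G; case: asboolP => // FU /FU.
have /nbhs_ballP[e /= e0 xeU] := open_nbhs_nbhs (conj oU Ux).
have [k ke] : exists k : nat, k.+1%:R^-1 < e / 2 :> R.
  have e20 : 0 < e / 2 by rewrite divr_gt0.
  have [k _ /(_ k (leqnn k)) ke] := near_infty_natSinv_lt (PosNum e20).
  by exists k.
have k0 : 0 < k.+1%:R^-1 :> R by rewrite invr_gt0.
have /choice[q qx] (i : 'I_n) : exists q : rat,
    ball (ratr q : R) k.+1%:R^-1 (x ord0 i).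
  have [q] := rat_in_itvoo (ltr_pwDr k0 (lexx (x ord0 i))).
  rewrite in_itv/= => /andP[xq qx]; exists q.
  by rewrite /ball/= ger0_norm ?subr_ge0 ?ltW// ltrBlDl.
exists (\row_i q i, k) => //; rewrite /G asboolT => [|y Fy].
  by move=> i /=; rewrite mxE.
apply: xeU; split => // i j; rewrite !ord1.
have := Fy j; have := qx j; rewrite /= mxE => qjx qjy.
apply: (@le_ball _ _ _ (k.+1%:R^-1 + k.+1%:R^-1)).
  by rewrite [leRHS]splitr lerD// ltW.
exact: ball_triangle (ball_sym qjx) qjy.
Qed.

Lemma measurable_fun_rVP d (T : measurableType d) (f : T -> 'rV[R]_n) :
  measurable_fun setT f <-> forall i, measurable_fun setT (rV_coord i \o f).
Proof.
split=> [mf i|mf]; first exact: measurableT_comp (measurable_rV_coord i) mf.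
suff prefS : g_sigma_preimage (fun i => rV_coord i \o f) `<=` measurable.
  move=> _ A mA; apply: prefS; rewrite g_sigma_preimage_comp.
  by exists A.
apply: smallest_sub; first exact: sigma_algebra_measurable.
by rewrite -bigcup_seq; apply: bigcup_sub => i _ A [B mB <-]; exact: mf.
Qed.

End measurable_rV.

Section lebesgue_rV.
Context {R : realType}.

Definition rV_cons n (p : measurableTypeR R * 'rV[R]_n) : 'rV[R]_n.+1 :=
  row_mx (p.1%:M : 'rV[R]_1) p.2.

Definition rV_uncons n (x : 'rV[R]_n.+1) : measurableTypeR R * 'rV[R]_n :=
  (x ord0 ord0, rsubmx (x : 'rV[R]_(1 + n))).

Lemma rV_cons0 n p : @rV_cons n p ord0 ord0 = p.1.
Proof.
rewrite /rV_cons (_ : ord0 = lshift n (ord0 : 'I_1)); last exact/val_inj.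
by rewrite (row_mxEl (p.1%:M : 'rV[R]_1)) mxE eqxx.
Qed.

Lemma rV_consS n p (i : 'I_n) : rV_cons p ord0 (lift ord0 i) = p.2 ord0 i.
Proof.
rewrite /rV_cons (_ : lift ord0 i = rshift 1 i); last exact/val_inj.
by rewrite (row_mxEr (p.1%:M : 'rV[R]_1)).
Qed.

Lemma rV_consK n : cancel (@rV_cons n) (@rV_uncons n).
Proof.
move=> p; rewrite /rV_uncons rV_cons0 /rV_cons row_mxKr.
by case: p.
Qed.

Lemma measurable_rV_cons n : measurable_fun setT (@rV_cons n).
Proof.
apply/measurable_fun_rVP => i; have [j ->|->] := unliftP ord0 i.
  rewrite (_ : _ \o _ = rV_coord j \o snd); last first.
    by apply/funext => p; rewrite /= /rV_coord rV_consS.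
  exact: measurableT_comp (measurable_rV_coord j) measurable_snd.
rewrite (_ : _ \o _ = fst); first exact: measurable_fst.
by apply/funext => p; rewrite /= /rV_coord rV_cons0.
Qed.

Lemma measurable_rV_uncons n : measurable_fun setT (@rV_uncons n).
Proof.
apply: measurable_fun_pair; first exact: (measurable_rV_coord ord0).
apply/measurable_fun_rVP => i.
rewrite (_ : _ \o _ = rV_coord (lift ord0 i)).
  exact: measurable_rV_coord.
apply/funext => x; rewrite /= /rV_coord mxE; congr (x _ _).
exact/val_inj.
Qed.

Section lebesgue_rVS.
Context n (mu : {sigma_finite_measure set 'rV[R]_n -> \bar R}).

Definition lebesgue_rVS : set 'rV[R]_n.+1 -> \bar R :=
  pushforward (lebesgue_measure \x mu)%E (@rV_cons n).

Let mcons := @measurable_rV_cons n.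

Let lebesgue_rVS0 : lebesgue_rVS set0 = 0%E.
Proof. exact: (@measure0 _ _ _ (pushforward _ _)). Qed.

Let lebesgue_rVS_ge0 A : (0 <= lebesgue_rVS A)%E.
Proof. exact: (@measure_ge0 _ _ _ (pushforward _ _)). Qed.

Let lebesgue_rVS_sigma_additive : semi_sigma_additive lebesgue_rVS.
Proof. exact: (@measure_semi_sigma_additive _ _ _ (pushforward _ _)). Qed.

HB.instance Definition _ := isMeasure.Build _ _ _ lebesgue_rVS
  lebesgue_rVS0 lebesgue_rVS_ge0 lebesgue_rVS_sigma_additive.

Let lebesgue_rVS_sigma_finite : sigma_finite setT lebesgue_rVS.
Proof.
have /sigma_finiteP[F [FT ndF Foo]] := @sigma_finiteT _ _ R lebesgue_measure.
have /sigma_finiteP[G [GT ndG Goo]] := sigma_finiteT mu.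
exists (fun k => @rV_uncons n @^-1` (F k `*` G k)).
  rewrite -preimage_bigcup (_ : \bigcup_k _ = setT) ?preimage_setT//.
  apply/seteqP; split=> // -[x y] _.
  have [i _ Fix] : (\bigcup_k F k) x by rewrite -FT.
  have [j _ Gjy] : (\bigcup_k G k) y by rewrite -GT.
  exists (maxn i j) => //; split=> /=.
  - by move: x Fix; exact/subsetPset/ndF/leq_maxl.
  - by move: y Gjy; exact/subsetPset/ndG/leq_maxr.
move=> k; have [mF Fk] := Foo k; have [mG Gk] := Goo k; split.
  by rewrite -[X in measurable X]setTI; apply: measurable_rV_uncons => //;
    exact: measurableX.
rewrite /lebesgue_rVS /pushforward -comp_preimage.
rewrite (_ : _ \o _ = id) ?preimage_id; last first.
  by apply/funext => p; exact: rV_consK.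
by rewrite product_measure1E// lte_mul_pinfty// ge0_fin_numE.
Qed.

HB.instance Definition _ := @Measure_isSigmaFinite.Build _ _ _
  lebesgue_rVS lebesgue_rVS_sigma_finite.

End lebesgue_rVS.

Fixpoint lebesgue_rV n : {sigma_finite_measure set 'rV[R]_n -> \bar R} :=
  match n with
  | 0 => \d_(0 : 'rV[R]_0)
  | m.+1 => lebesgue_rVS (lebesgue_rV m)
  end.

End lebesgue_rV.

Lemma lebesgue_rV_box (R : realType) n (A : 'I_n -> set (measurableTypeR R)) :
  (forall i, measurable (A i)) ->
  lebesgue_rV n [set x : 'rV[R]_n | forall i, A i (x ord0 i)] =
  (\prod_(i < n) lebesgue_measure (A i))%E.
Proof.
elim: n A => [|n IHn] A mA.
  by rewrite big_ord0 /= diracE mem_set// => -[].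
rewrite big_ord_recl -(IHn (fun i => A (lift ord0 i)))//=.
rewrite /lebesgue_rVS /pushforward.
rewrite (_ : _ @^-1` _ =
  A ord0 `*` [set x : 'rV[R]_n | forall i, A (lift ord0 i) (x ord0 i)]).
  rewrite product_measure1E//.
  exact: (measurable_rV_box (A := fun i => A (lift ord0 i))).
apply/seteqP; split=> -[x y] /=.
  move=> Axy; split; first by have := Axy ord0; rewrite rV_cons0.
  by move=> i; have := Axy (lift ord0 i); rewrite rV_consS.
move=> [Ax Ay] i; have [j ->|->] := unliftP ord0 i.
  by rewrite rV_consS; exact: Ay.
by rewrite rV_cons0.
Qed.

Section domains.
Context {R : realType} {n : nat}.

Definition has_continuous_partials (f : 'rV[R]_n -> R) : Prop :=
  forall i : 'I_n, (forall x, derivable f x (delta_mx ord0 i)) /\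
    continuous ('D_(delta_mx ord0 i) f).

Definition C2 (f : 'rV[R]_n -> R) : Prop :=
  [/\ continuous f, has_continuous_partials f &
    forall i : 'I_n, has_continuous_partials ('D_(delta_mx ord0 i) f)].

End domains.

(* Near each boundary point, after choosing a coordinate axis i and its
   orientation (-1)^b, Omega is the region lying above the graph of a C^2
   function g of the n - 1 remaining coordinates, which are given by col' i.
   Balls are those of the sup norm, which makes no difference here. *)
Definition C2_boundary (R : realType) (n : nat) (Omega : set 'rV[R]_n) : Prop :=
  forall x0, (closure Omega `\` interior Omega) x0 ->
  exists (r : R) (i : 'I_n) (b : bool) (g : 'rV[R]_n.-1 -> R),
    [/\ 0 < r, C2 g & forall x, ball x0 r x ->
      (Omega x <-> g (col' i x) < (-1) ^+ b * x ord0 i)].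

Definition bounded_C2_domain (R : realType) (n : nat) (Omega : set 'rV[R]_n) :
    Prop :=
  [/\ open Omega, connected Omega, Omega !=set0, bounded_set Omega &
    C2_boundary Omega].

Section parabolic.
Context {R : realType} {n : nat}.
Implicit Types (Omega : set 'rV[R]_n) (I : set R) (u : 'rV[R]_n -> R -> R).

Definition partial_x (i : 'I_n) u : 'rV[R]_n -> R -> R :=
  fun x t => 'D_(delta_mx ord0 i) (u ^~ t) x.

Definition partial_t u : 'rV[R]_n -> R -> R := fun x t => derive1 (u x) t.

Definition laplacian u (x : 'rV[R]_n) (t : R) : R :=
  \sum_(i < n) partial_x i (partial_x i u) x t.

(* squared Euclidean norm of the spatial gradient *)
Definition sqr_grad u (x : 'rV[R]_n) (t : R) : R :=
  \sum_(i < n) partial_x i u x t ^+ 2.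

Definition continuous_on (A : set 'rV[R]_n) I u : Prop :=
  {within A `*` I, continuous (fun p : 'rV[R]_n * R => u p.1 p.2)}.

Definition C1_x Omega I u : Prop := forall i : 'I_n,
  (forall x t, Omega x -> I t -> derivable (u ^~ t) x (delta_mx ord0 i)) /\
  continuous_on Omega I (partial_x i u).

Definition C1_t Omega I u : Prop :=
  (forall x t, Omega x -> I t -> derivable (u x) t 1) /\
  continuous_on Omega I (partial_t u).

(* C^{2,1}(Omega x I), for Omega and I open *)
Definition C21 Omega I u : Prop :=
  [/\ continuous_on Omega I u, C1_x Omega I u,
      (forall i : 'I_n, C1_x Omega I (partial_x i u)) & C1_t Omega I u].

(* the interval (0, T), where T may be +oo *)
Definition time_interval (T : \bar R) : set R :=
  [set t | (0 < t%:E)%E /\ (t%:E < T)%E].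

Definition source Omega (lambda chi : R) u (x : 'rV[R]_n) (t : R) : R :=
  lambda / ((1 - u x t) ^+ 2 *
    (1 + chi * \int[lebesgue_rV n]_(y in Omega) (1 - u y t)^-1) ^+ 2).

Record is_solution Omega (lambda chi : R) (u0 : 'rV[R]_n -> R) (T : \bar R) u :
    Prop := {
  solution_C21 : C21 Omega (time_interval T) u ;
  solution_continuous : continuous_on (closure Omega) (time_interval T) u ;
  solution_range : forall x t, closure Omega x -> time_interval T t ->
    0 <= u x t < 1 ;
  solution_equation : forall x t, Omega x -> time_interval T t ->
    partial_t u x t = laplacian u x t + source Omega lambda chi u x t ;
  solution_boundary : forall x t, (closure Omega `\` interior Omega) x ->
    time_interval T t -> u x t = 0 ;
  solution_sup : forall T', time_interval T T' ->
    sup [set u p.1 p.2 | p in closure Omega `*` `]0, T']] < 1 ;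
  solution_initial :
    (\int[lebesgue_rV n]_(x in Omega) `|u x t - u0 x|%:E)%E
      @[t --> 0^'+] --> 0%E
}.

Definition global_solution Omega (lambda chi : R) (u0 : 'rV[R]_n -> R) u :
  Prop := is_solution Omega lambda chi u0 +oo%E u.

End parabolic.

(* Main.v *)
(* No regularity of u up to the boundary is assumed, so the equation cannot be
   tested with u_t directly; one works with the Steklov averages
   U_h(t) = 1/h \int_t^{t+h} u.  They solve U' = Lap U + F, where U, U' and F are
   continuous up to the boundary, so that Lap U is bounded, and a cut-off in the
   value of u gives Green's formula for them.  Convexity of
   Phi = 1/2 \int |grad|^2 then makes Phi(U_h) differentiable in time, with
   derivative \int (F - U') U'.  As K(s) = 1/(1 - s) satisfies
   K(b) - K(a) = (b - a) K(a) K(b), the integral of U' times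
   lambda r(t) r(t+h), r = K(u) / (1 + chi \int K(u)), is exactly minus
   lambda/chi times the difference quotient of 1 / (1 + chi \int K(u)), and F is
   uniformly close to lambda r(t) r(t+h) for small h; Fatou's lemma removes h.
   It remains to control Phi(U_h(t0)).  By convexity it is at most
   Phi(u(t0)) + o(1) - \int (U_h - u)(t0) U_h'(t0), and the last integral, the
   derivative of h |-> 1/2 \int (\int_0^h (u(t0+s) - u(t0)) ds)^2 divided by h^2,
   is nonnegative for arbitrarily small h.  When u0 = 0, Phi(U_h(s)) is at most
   C sup \int u + 1/h \int u(s), which is small for s << h << 1. *)
Require Import Defs.
From HB Require Import structures.
From mathcomp Require Import all_boot all_order all_algebra.
From mathcomp Require Import all_classical all_reals all_analysis.
From mathcomp Require Import measurable_realfun ring lra.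
Import Order.TTheory GRing.Theory Num.Theory.
Import numFieldNormedType.Exports.

Set Implicit Arguments.
Unset Strict Implicit.
Unset Printing Implicit Defensive.

Local Open Scope classical_set_scope.
Local Open Scope ring_scope.

(** * Calculus on the real line *)

(** The product r(t) r(t+h) stands in for r^2 because \int K(u) is not known to be differentiable in
    time, so an identity between difference quotients does the work of the chain rule. The error F -
    lambda r(t) r(t+h) is paired with U', for which no bound uniform in h is at hand; it is absorbed
    through e|U'| <= e U'^2 + e, where e may tend to 0 with h. The energy of u itself might be
    infinite. That of U_h is finite because Lap U_h is bounded, and u(t0) serves as a competitor
    only when its gradient is square integrable; otherwise the claim is trivial. The cut-off in the
    value of a function w works because w extends continuously by zero: the set where w >= e > 0 is
    compact inside Omega, so cut-off integrands are continuous with compact support in R^n, and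
    Green's formula reduces to the vanishing of integrals of partial derivatives. *)

Section real_line.
Context {R : realType}.
Implicit Types (g F : R -> R) (a b h s t : R).
Local Notation leb := (@lebesgue_measure R).

Lemma is_derive_continuous g t d :
  is_derive t 1 g d -> {for t, continuous g}.
Proof.
by move=> [gd _]; apply: differentiable_continuous; apply/derivable1_diffP.
Qed.

Lemma continuous_itv_integrable g a b :
  (forall t, a <= t <= b -> {for t, continuous g}) ->
  leb.-integrable `[a, b] (EFin \o g).
Proof.
move=> cg; apply: continuous_compact_integrable; first exact: segment_compact.
apply: continuous_in_subspaceT => t; rewrite inE/= in_itv/=; exact: cg.
Qed.

Lemma is_derive_primitive g a b t : a < t < b ->
  (forall s, a <= s <= b -> {for s, continuous g}) ->
  is_derive t 1 (fun y => \int[leb]_(s in `[a, y]) g s) (g t).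
Proof.
move=> /andP[at_ tb] cg.
have [||dF FE] := @continuous_FTC1_closed R g a t b tb _ at_.
- exact: continuous_itv_integrable.
- by apply: cg; rewrite !ltW.
by split; [exact: dF|rewrite -derive1E].
Qed.

Lemma integral_derivative F g a b : a <= b ->
  (forall t, a <= t <= b -> is_derive t 1 F (g t)) ->
  (forall t, a <= t <= b -> {for t, continuous g}) ->
  \int[leb]_(t in `[a, b]) g t = F b - F a.
Proof.
rewrite le_eqVlt => /predU1P[<- _ _|ab dF cg].
  by rewrite set_itv1 Rintegral_set1 subrr.
have abi t : t \in `]a, b[ -> a <= t <= b.
  by rewrite in_itv/= => /andP[/ltW -> /ltW ->].
rewrite /Rintegral (@continuous_FTC2 R g F a b)//.
- by apply: continuous_in_subspaceT => t; rewrite inE/= in_itv/=; exact: cg.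
- have cF t : a <= t <= b -> {for t, continuous F}.
    by move=> /dF; exact: is_derive_continuous.
  split.
  + by move=> t /abi /dF [].
  + by apply/cvg_at_right_filter/cF; rewrite lexx ltW.
  + by apply/cvg_at_left_filter/cF; rewrite lexx ltW.
- by move=> t /abi/dF [_]; rewrite derive1E.
Qed.

Lemma itv_mvt F g a b : a <= b ->
  (forall t, a <= t <= b -> is_derive t 1 F (g t)) ->
  exists2 c, a <= c <= b & F b - F a = g c * (b - a).
Proof.
move=> ab dF.
have [| |c] := @MVT_segment R F g a b ab.
- by move=> x; rewrite in_itv/= => /andP[ax xb]; apply: dF; rewrite !ltW.
- apply: continuous_in_subspaceT => t; rewrite inE/= in_itv/= => /dF.
  exact: is_derive_continuous.
- by rewrite in_itv/=; exists c.
Qed.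

Lemma integral_itv_cat g a b t : a <= t -> t <= b ->
  (forall s, a <= s <= b -> {for s, continuous g}) ->
  \int[leb]_(s in `[a, b]) g s =
  \int[leb]_(s in `[a, t]) g s + \int[leb]_(s in `[t, b]) g s.
Proof.
move=> at_ tb cg; have ig := continuous_itv_integrable cg.
apply/eqP; rewrite addrC -subr_eq; apply/eqP.
rewrite Rintegral_itvB ?bnd_simp//.
rewrite -(@Rintegral_itv_obnd_cbnd _ t)//.
apply: integrableS ig => //; apply: subset_itvr.
by rewrite bnd_simp.
Qed.

End real_line.
(** * Functions of space and positive time *)

Section joint_continuity.
Context {R : realType} {n : nat}.
Implicit Types (O K : set 'rV[R]_n) (G : 'rV[R]_n -> R -> R) (x y : 'rV[R]_n)
  (s t a b c d e h M : R).

(** Continuity refers to a full neighbourhood of [(x, t)] even when [O] is not open. Thus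
    [jcont setT] includes continuity across the boundary of the domain, whereas [jcont O] for open
    [O] is interior regularity only. *)
Definition jcont O G := forall x t, O x -> 0 < t ->
  {for (x, t), continuous (fun p : 'rV[R]_n * R => G p.1 p.2)}.

Lemma jcont_x O G x t : jcont O G -> O x -> 0 < t ->
  {for x, continuous (G ^~ t)}.
Proof.
move=> cG Ox t0; exact: (@cvg_comp2 _ _ _ _ (nbhs x) (nbhs x) (nbhs t) _
  _ _ _ id (cst t) G cvg_id (cvg_cst t) (cG x t Ox t0)).
Qed.

Lemma jcont_t O G x t : jcont O G -> O x -> 0 < t ->
  {for t, continuous (G x)}.
Proof.
move=> cG Ox t0; exact: (@cvg_comp2 _ _ _ _ (nbhs t) (nbhs x) (nbhs t) _
  _ _ _ (cst x) id G (cvg_cst x) cvg_id (cG x t Ox t0)).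
Qed.

Lemma jcontW O1 O2 G : O1 `<=` O2 -> jcont O2 G -> jcont O1 G.
Proof. by move=> sO cG x t /sO; exact: cG. Qed.

Lemma jcont_time O (g : R -> R) :
  (forall t, 0 < t -> {for t, continuous g}) -> jcont O (fun _ => g).
Proof.
move=> cg x t _ t0; apply: (@continuous_comp _ _ _ snd g); last exact: cg.
exact: cvg_snd.
Qed.

Lemma jcontD O G1 G2 : jcont O G1 -> jcont O G2 ->
  jcont O (fun x t => G1 x t + G2 x t).
Proof. by move=> c1 c2 x t Ox t0; apply: cvgD; [exact: c1|exact: c2]. Qed.

Lemma jcontB O G1 G2 : jcont O G1 -> jcont O G2 ->
  jcont O (fun x t => G1 x t - G2 x t).
Proof. by move=> c1 c2 x t Ox t0; apply: cvgB; [exact: c1|exact: c2]. Qed.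

Lemma jcontM O G1 G2 : jcont O G1 -> jcont O G2 ->
  jcont O (fun x t => G1 x t * G2 x t).
Proof. by move=> c1 c2 x t Ox t0; apply: cvgM; [exact: c1|exact: c2]. Qed.

Lemma jcontV O G : (forall x t, O x -> 0 < t -> G x t != 0) ->
  jcont O G -> jcont O (fun x t => (G x t)^-1).
Proof. by move=> G0 cG x t Ox t0; apply: cvgV; [exact: G0|exact: cG]. Qed.

Lemma jcont_cst O c : jcont O (fun _ _ => c).
Proof. by move=> x t _ _; exact: cvg_cst. Qed.

Lemma jcont_shift O G h : 0 <= h -> jcont O G ->
  jcont O (fun x t => G x (t + h)).
Proof.
move=> h0 cG x t Ox t0.
have cth : p.2 + h @[p --> nbhs (x, t)] --> t + h.
  by apply: cvgD; [exact: cvg_snd|exact: cvg_cst].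
exact: (@cvg_comp2 _ _ _ _ (nbhs (x, t)) (nbhs x) (nbhs (t + h)) _
  _ _ _ fst _ G cvg_fst cth (cG x _ Ox (ltr_wpDr h0 t0))).
Qed.

Lemma jcont_near O G x t e : jcont O G -> O x -> 0 < t -> 0 < e ->
  \forall y \near x & s \near t, `|G x t - G y s| < e.
Proof. by move=> cG Ox t0 e0; exact: ((iffLR (cvgrPdist_lt _ _) (cG x t Ox t0)) e e0). Qed.

(** Tube lemma: around each time of the compact interval closeness holds for all [y] near [x], and
    the near-covering form of compactness merges these neighbourhoods into a single one of [x]. *)
Lemma near_uniform_itv O G x a b e : jcont O G -> O x -> 0 < a -> 0 < e ->
  \forall y \near x, forall t, a <= t <= b -> `|G y t - G x t| < e.
Proof.
move=> cG Ox a0 e0.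
have /compact_near_coveringP := @segment_compact R a b.
move=> /(_ _ (nbhs x) (fun y t => `|G y t - G x t| < e) _) H.
have : \forall y \near x, `[a, b]%classic `<=` (fun t => `|G y t - G x t| < e).
  apply: H => t; rewrite /= in_itv/= => /andP[at_ tb].
  have t0 : 0 < t by exact: lt_le_trans a0 at_.
  have e20 : 0 < e / 2 by rewrite divr_gt0.
  have c1 := jcont_near cG Ox t0 e20.
  have c0 := iffLR (cvgrPdist_lt _ _) (jcont_t cG Ox t0) _ e20.
  case: c1 => -[A B] [/= xA tB] AB.
  exists (B `&` [set s | `|G x t - G x s| < e / 2], A).
    by split => //=; apply: filterI => //; exact: c0.
  move=> [s y] [/= [Bs h2] Ay]; have h1 := AB (y, s) (conj Ay Bs).
  rewrite (_ : G y s - G x s = (G x t - G x s) - (G x t - G y s)); last by ring.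
  by rewrite (le_lt_trans (ler_normB _ _))// (splitr e) ltrD.
apply: filterS => y yP t tab; apply: yP => /=.
by rewrite in_itv.
Qed.

Lemma jcont_bounded K G a b : compact K -> jcont K G -> 0 < a ->
  exists2 M, 0 < M & forall x t, K x -> a <= t <= b -> `|G x t| <= M.
Proof.
move=> cK cG a0.
have /compact_near_coveringP := compact_setX cK (@segment_compact R a b).
(* The bound [M] is the near-covering parameter, along the filter at [+oo]: local bounds hold for
   all large [M], so one [M] serves the whole compact set. *)
move=> /(_ _ (pinfty_nbhs R) (fun M p => `|G p.1 p.2| <= M) _) H.
have /H : forall p, (K `*` `[a, b]%classic) p ->
    \forall p' \near p & M \near +oo, `|G p'.1 p'.2| <= M.
  move=> [x t] [/= Kx]; rewrite in_itv/= => /andP[at_ tb].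
  have t0 : 0 < t by exact: lt_le_trans a0 at_.
  have c1 := iffLR (cvgrPdist_lt _ _) (cG x t Kx t0) _ ltr01.
  exists ([set p | `|G x t - G p.1 p.2| < 1], [set M | `|G x t| + 1 <= M]).
    by split; [exact: c1|exact: nbhs_pinfty_ge].
  move=> [p M] /= [h2 h1].
  rewrite (_ : G p.1 p.2 = G x t - (G x t - G p.1 p.2)); last by ring.
  rewrite (le_trans (ler_normB _ _))// (le_trans _ h1)//.
  by rewrite lerD2l ltW.
move=> nM; near (pinfty_nbhs R) => M.
exists M; first by near: M; exact: nbhs_pinfty_gt.
move=> x t Kx tab.
have : (K `*` `[a, b]%classic) `<=` (fun p => `|G p.1 p.2| <= M) by near: M.
by move=> /(_ (x, t)); apply; split => //=; rewrite in_itv.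
Unshelve. all: by end_near.
Qed.

(** Here the near-covering parameter is a time shift tending to 0. Only [s] is confined to [[a, b]],
    so the interval may be a single point and [t] may leave it. *)
Lemma jcont_uniform K G a b e : compact K -> jcont K G -> 0 < a -> 0 < e ->
  exists2 d, 0 < d & forall x s t, K x -> a <= s <= b -> `|s - t| < d ->
    `|G x s - G x t| < e.
Proof.
move=> cK cG a0 e0.
have /compact_near_coveringP := compact_setX cK (@segment_compact R a b).
move=> /(_ _ (nbhs (0 : R)) (fun d p => `|G p.1 p.2 - G p.1 (p.2 + d)| < e) _) H.
have /H : forall p, (K `*` `[a, b]%classic) p ->
    \forall p' \near p & d \near (0 : R), `|G p'.1 p'.2 - G p'.1 (p'.2 + d)| < e.
  move=> [x t] [/= Kx]; rewrite in_itv/= => /andP[at_ tb].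
  have t0 : 0 < t by exact: lt_le_trans a0 at_.
  have e20 : 0 < e / 2 by rewrite divr_gt0.
  have c0 := iffLR (cvgrPdist_lt _ _) (cG x t Kx t0) _ e20.
  have c3 : p.1.1 @[p --> nbhs ((x, t), (0 : R))] --> x.
    exact: (@cvg_comp _ _ _ fst fst _ (nbhs (x, t)) _ cvg_fst cvg_fst).
  have c4 : p.1.2 + p.2 @[p --> nbhs ((x, t), (0 : R))] --> t.
    have -> : nbhs t = nbhs (t + 0) by rewrite addr0.
    apply: cvgD; last exact: cvg_snd.
    exact: (@cvg_comp _ _ _ fst snd _ (nbhs (x, t)) _ cvg_fst cvg_snd).
  have c2 : G p.1.1 (p.1.2 + p.2) @[p --> nbhs ((x, t), (0 : R))] --> G x t.
    exact: (@cvg_comp2 _ _ _ _ _ (nbhs x) (nbhs t) _ _ _ _ _ _ G c3 c4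
      (cG x t Kx t0)).
  have {}c2 := iffLR (cvgrPdist_lt _ _) c2 _ e20.
  case: c2 => -[A B] [/= xA tB] AB.
  exists (A `&` [set p | `|G x t - G p.1 p.2| < e / 2], B).
    by split => //=; apply: filterI => //; exact: c0.
  move=> [p d] [/= [Ap h1] Bd]; have h2 := AB (p, d) (conj Ap Bd).
  rewrite (_ : _ - _ = (G x t - G p.1 (p.2 + d)) - (G x t - G p.1 p.2)); last by ring.
  by rewrite (le_lt_trans (ler_normB _ _))// (splitr e) ltrD.
case=> d /= d0 dP; exists d => // x s t Kx sab std.
have := dP (t - s); rewrite /= sub0r normrN distrC => /(_ std (x, s)) /=.
by rewrite subrKC; apply; split => //=; rewrite in_itv.
Qed.

End joint_continuity.
(** Meant for time primitives of a function with values in [0, 1]: these are 1-Lipschitz in time,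
    uniformly in space. *)
Lemma jcont_lipschitz (R : realType) n (G : 'rV[R]_n -> R -> R) :
  (forall x t, 0 < t -> {for x, continuous (G ^~ t)}) ->
  (forall x s t, 0 < s -> 0 < t -> `|G x s - G x t| <= `|s - t|) ->
  jcont setT G.
Proof.
move=> cG lG x t _ t0.
have E e : 0 < e -> \forall p \near (x, t), `|G x t - G p.1 p.2| < e.
  move=> e0; have e20 : 0 < e / 2 by rewrite divr_gt0.
  have N1 := iffLR (cvgrPdist_lt _ _) (cG x t t0) (e / 2) e20.
  exists ([set y | `|G x t - G y t| < e / 2], [set s | `|t - s| < e / 2 /\ 0 < s]).
    split; first exact: N1.
    near=> s; split; last by near: s; exact: lt_nbhsr.
    by near: s; exact: (iffLR (cvgrPdist_lt _ _) (@cvg_id _ (nbhs t)) (e / 2) e20).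
  move=> [y s] [/= H1 [H2 s0]].
  rewrite (_ : _ - _ = (G x t - G y t) + (G y t - G y s)); last by ring.
  rewrite (le_lt_trans (ler_normD _ _))// (splitr e) ltr_leD//.
  by rewrite (le_trans (lG y t s t0 s0))// ltW.
by apply/cvgrPdist_lt => e e0; exact: E.
Unshelve. all: by end_near. Qed.

(** * Integration on R^n *)

Section integration_rV.
Context {R : realType}.
Local Notation leb := (@lebesgue_measure R).
Implicit Types (n : nat) (M C : R).

(** A directional derivative only sees the function along a line, so it can be carried between
    functions on different spaces: slices of R^(n+1), lines parametrised by a real number,
    compositions. *)
Lemma is_derive_line (V W : normedModType R) (f : V -> R) (g : W -> R)
    (a v : V) (b w : W) (d : R) :
  (forall h : R, f (h *: v + a) = g (h *: w + b)) ->
  is_derive a v f d -> is_derive b w g d.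
Proof.
move=> fg [df Df].
have E : (fun h : R => h^-1 *: ((g \o shift b) (h *: w) - g b)) =
         (fun h : R => h^-1 *: ((f \o shift a) (h *: v) - f a)).
  apply/funext => h /=; rewrite -fg; congr (_ *: (_ - _)).
  by have := fg 0; rewrite !scale0r !add0r.
split; first by rewrite /derivable E.
by rewrite -Df /derive E.
Qed.

Lemma open_continuous_measurable_rV n (O : set 'rV[R]_n) (f : 'rV[R]_n -> R) :
  open O -> (forall x, O x -> {for x, continuous f}) -> measurable_fun O f.
Proof.
move=> oO cf mO; apply: (measurability _ (RGenOpens.measurableE R)) => //.
move=> _ [_ [a [b ->] <-]]; apply: measurable_rV_open.
rewrite openE => x [Ox fx]; rewrite /interior.
apply: filterI; first exact: open_nbhs_nbhs.
by apply: (cf x Ox); apply: open_nbhs_nbhs; split => //; exact: interval_open.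
Qed.

Lemma bounded_cont_integrable n (O : set 'rV[R]_n) (f : 'rV[R]_n -> R) C :
  open O -> (lebesgue_rV n O < +oo)%E ->
  (forall x, O x -> {for x, continuous f}) ->
  (forall x, O x -> `|f x| <= C) ->
  (lebesgue_rV n).-integrable O (EFin \o f).
Proof.
move=> oO fO cf bf; apply: measurable_bounded_integrable => //.
- exact: measurable_rV_open.
- exact: open_continuous_measurable_rV.
- exists C; split; first exact: num_real.
  by move=> M CM x /= Ox; rewrite (le_trans (bf x Ox))// ltW.
Qed.

Lemma lebesgue_rV_bounded n (A : set 'rV[R]_n) : measurable A ->
  bounded_set A -> (lebesgue_rV n A < +oo)%E.
Proof.
move=> mA [M [_ /(_ (M + 1)) MA]].
pose B := [set x : 'rV[R]_n | forall i, `[(- (M + 1)), M + 1]%classic (x ord0 i)].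
have mB : measurable B.
  apply: (measurable_rV_box (A := fun=> `[(- (M + 1)), (M + 1)]%classic)) => _.
  exact: measurable_itv.
apply: (@le_lt_trans _ _ (lebesgue_rV n B)).
  apply: le_measure; rewrite ?inE// => x Ax i; rewrite /= in_itv/= -ler_norml.
  apply: le_trans (MA _ x Ax); last by rewrite ltrDl.
  rewrite [leRHS]/Num.norm /= mx_normrE.
  by apply/bigmax_geP; right => /=; exists (ord0, i).
rewrite /B (@lebesgue_rV_box R n (fun=> `[(- (M + 1)), M + 1]%classic))//.
suff : (\prod_(i < n) leb `[(- (M + 1))%R, (M + 1)%R])%E \is a fin_num.
  by rewrite ltey_eq => ->.
elim/big_ind : _ => //; first by move=> x y; exact: fin_numM.
by move=> i _; rewrite lebesgue_measure_itv/=; case: ifP.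
Qed.

Lemma rV_cons_continuous n (s : R) : continuous (fun y : 'rV[R]_n => rV_cons (s, y)).
Proof.
move=> y A /nbhs_ballP[e /= e0 eA]; apply/nbhs_ballP; exists e => //= z [_ yz].
apply: eA; split => // i j; rewrite !ord1.
have [k ->|->] := unliftP ord0 j; first by rewrite !rV_consS; exact: yz.
by rewrite !rV_cons0; exact: ballxx.
Qed.

Lemma rV_cons_continuousl n (y : 'rV[R]_n) :
  continuous (fun s : R => rV_cons (s, y)).
Proof.
move=> s A /nbhs_ballP[e /= e0 eA]; apply/nbhs_ballP; exists e => //= z sz.
apply: eA; split => // i j; rewrite !ord1.
have [k ->|->] := unliftP ord0 j; first by rewrite !rV_consS; exact: ballxx.
by rewrite !rV_cons0.
Qed.

Lemma rV_consD n h (p q : R * 'rV[R]_n) :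
  rV_cons (h * p.1 + q.1, h *: p.2 + q.2) = h *: rV_cons p + rV_cons q.
Proof.
apply/rowP => j.
have E m (A B : 'rV[R]_m) k : (h *: A + B) ord0 k = h * A ord0 k + B ord0 k.
  by rewrite !mxE.
by rewrite E; have [k ->|->] := unliftP ord0 j; rewrite ?rV_consS ?rV_cons0 ?E.
Qed.

Lemma rV_cons_delta0 n : rV_cons (1, 0) = delta_mx ord0 ord0 :> 'rV[R]_n.+1.
Proof.
apply/rowP => j; rewrite [RHS]mxE eqxx/=.
have [k ->|->] := unliftP ord0 j; first by rewrite rV_consS mxE.
by rewrite rV_cons0.
Qed.

Lemma rV_cons_deltaS n (i : 'I_n) :
  rV_cons (0, delta_mx ord0 i) = delta_mx ord0 (lift ord0 i) :> 'rV[R]_n.+1.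
Proof.
apply/rowP => j; rewrite [RHS]mxE eqxx/=.
have [k ->|->] := unliftP ord0 j.
  by rewrite rV_consS mxE eqxx /= (inj_eq lift_inj).
by rewrite rV_cons0.
Qed.

Lemma cont_supp_integrable n (g : 'rV[R]_n -> R) M : continuous g ->
  (forall (x : 'rV[R]_n) i, M < `|x ord0 i| -> g x = 0) ->
  (lebesgue_rV n).-integrable setT (EFin \o g).
Proof.
move=> cg g0.
pose B := [set x : 'rV[R]_n | forall i, `[(- M), M]%classic (x ord0 i)].
have cB : compact B.
  by apply: (@rV_compact _ _ (fun=> `[(- M), M]%classic)) => _; exact: segment_compact.
have mB : measurable B.
  apply: (measurable_rV_box (A := fun=> `[(- M), M]%classic)) => _.
  exact: measurable_itv.
have mg : measurable_fun setT g.
  by apply: open_continuous_measurable_rV => [|x _]; [exact: openT|exact: cg].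
have gE : EFin \o g = (EFin \o g) \_ B.
  apply/funext => x; rewrite patchE; case: ifPn => // /negP xB.
  congr EFin; apply/eqP/negPn/negP => gx0; apply: xB; rewrite inE => i.
  rewrite /= in_itv/= -ler_norml leNgt; apply/negP => /g0 /eqP.
  exact/negP.
rewrite gE -integrable_mkcond//.
apply: measurable_bounded_integrable => //.
- by apply: lebesgue_rV_bounded => //; exact: compact_bounded.
- exact: measurable_funTS.
- have : compact (g @` B).
    by apply: continuous_compact => //; exact: continuous_subspaceT.
  move=> /compact_bounded [C [Cr CP]]; exists C; split => // N CN x /= Bx.
  by apply: (CP _ CN); exists x.
Qed.

Lemma integral_derive_line (g g' : R -> R) M : 0 <= M ->
  (forall s : R, is_derive s 1 g (g' s)) -> continuous g' ->
  (forall s, M < `|s| -> g s = 0 /\ g' s = 0) ->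
  (\int[leb]_s (g' s)%:E = 0)%E.
Proof.
move=> M0 dg cg' g0.
(* The interval ends at [M + 1] because vanishing is only known for [|s| > M], which excludes the
   points [M] and [- M]. *)
have gE : (fun s => (g' s)%:E) = (EFin \o g') \_ `[- (M + 1), M + 1].
  apply/funext => s; rewrite patchE; case: ifPn => //.
  rewrite mem_setE in_itv/= -ler_norml -ltNge => Ms.
  by rewrite (g0 s _).2// (lt_trans _ Ms)// ltrDl.
have M1 : 0 < M + 1 by rewrite ltr_wpDl.
rewrite gE -integral_mkcond -[LHS]fineK; last first.
  by apply: integrable_fin_num => //; apply: continuous_itv_integrable => s _; exact: cg'.
rewrite [X in X%:E](_ : _ = g (M + 1) - g (- (M + 1))); last first.
  apply: integral_derivative => [|s _]; last exact: cg'.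
  by rewrite (le_trans _ (ltW M1))// oppr_le0 ltW.
by rewrite (g0 (M + 1) _).1 1?(g0 (- (M + 1)) _).1 ?subrr// ?normrN gtr0_norm ?ltrDl.
Qed.

(** Induction on the dimension, splitting off the first coordinate by Fubini. A derivative in
    another coordinate integrates to zero over each slice by induction; a derivative in the first
    one is integrated along lines first, by the fundamental theorem of calculus. *)
Lemma integral_partial_eq0 n (i : 'I_n) (g g' : 'rV[R]_n -> R) M : 0 <= M ->
  (forall x, is_derive x (delta_mx ord0 i) g (g' x)) -> continuous g' ->
  (forall (x : 'rV[R]_n) j, M < `|x ord0 j| -> g x = 0 /\ g' x = 0) ->
  (\int[lebesgue_rV n]_x (g' x)%:E = 0)%E.
Proof.
elim: n i g g' => [[]//|n IHn] i g g' M0 dg cg' g0.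
have ig' : (lebesgue_rV n.+1).-integrable setT (EFin \o g').
  by apply: (@cont_supp_integrable _ _ M) => // x j /g0 [].
have mg' : measurable_fun setT g'.
  by case/integrableP : ig' => /measurable_EFinP.
have mc := @measurable_rV_cons R n.
have mg'c : measurable_fun setT (g' \o @rV_cons R n) by exact: measurableT_comp.
have ig'c : (leb \x lebesgue_rV n)%E.-integrable setT (EFin \o g' \o @rV_cons R n).
  apply/integrableP; split; first exact/measurable_EFinP.
  case/integrableP : ig' => _.
  rewrite (@ge0_integral_pushforward _ _ _ _ R (@rV_cons R n) mc
    (leb \x lebesgue_rV n)%E setT (fun x => `|(EFin \o g') x|%E))//.
  by apply: measurableT_comp => //; exact/measurable_EFinP.
rewrite (@integral_pushforward _ _ _ _ R (@rV_cons R n) mc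
    (leb \x lebesgue_rV n)%E setT (EFin \o g')) ?preimage_setT//; last first.
  exact/measurable_EFinP.
have [j ij|i0] := unliftP ord0 i.
  rewrite -integral12_prod_meas1// integral0_eq// => s _.
  rewrite /fubini_F /= .
  apply: (IHn j (fun y => g (rV_cons (s, y))) (fun y => g' (rV_cons (s, y)))) => //.
  - move=> y; apply: is_derive_line (dg (rV_cons (s, y))) => h.
    by rewrite ij -rV_cons_deltaS -rV_consD/= mulr0 add0r.
  - by move=> y; apply: continuous_comp; [exact: rV_cons_continuous|exact: cg'].
  - move=> y k Mk; apply: (g0 _ (lift ord0 k)).
    by rewrite (rV_consS (s, y)).
rewrite -integral21_prod_meas1// integral0_eq// => y _.
rewrite /fubini_G /= .
apply: (@integral_derive_line (fun s => g (rV_cons (s, y)))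
  (fun s => g' (rV_cons (s, y))) M) => //.
- move=> s; apply: is_derive_line (dg (rV_cons (s, y))) => h.
  by rewrite i0 -rV_cons_delta0 -rV_consD/= scaler0 add0r.
- by move=> s; apply: continuous_comp; [exact: rV_cons_continuousl|exact: cg'].
- move=> s Ms; apply: (g0 _ ord0).
  by rewrite (rV_cons0 (s, y)).
Qed.

End integration_rV.
(** * Green's formula with a cut-off *)

Section cutoff.
Context {R : realType}.
Implicit Types e s : R.

(** The first-order remainder is at most [h ^+ 2] in each of the four sign cases, so the corner of
    the maximum at [s = e] is no exception. *)
Lemma is_derive_sqr_max e s :
  is_derive s 1 (fun s => Num.max (s - e) 0 ^+ 2) (2 * Num.max (s - e) 0).
Proof.
pose m := fun s : R => Num.max (s - e) 0.
have E h : `|m (s + h) ^+ 2 - m s ^+ 2 - 2 * m s * h| <= h ^+ 2.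
  rewrite /m ler_norml; have [h1|h1] := leP (s + h - e) 0; have [h2|h2] := leP (s - e) 0;
  by apply/andP; split; nra.
have H : h^-1 *: (((fun s => m s ^+ 2) \o shift s) (h *: (1 : R)) - m s ^+ 2) @[h --> 0^']
    --> 2 * m s.
  apply/cvgrPdist_le => r r0; near=> h.
  have h0 : h != 0 by near: h; exact: nbhs_dnbhs_neq.
  have hr : `|h| <= r.
    near: h; apply: dnbhs0_le; exact: r0.
  have -> : 2 * m s - h^-1 *: (((fun s => m s ^+ 2) \o shift s) (h *: (1 : R)) - m s ^+ 2) =
      - h^-1 * (m (s + h) ^+ 2 - m s ^+ 2 - 2 * m s * h).
    by rewrite /= /GRing.scale/= mulr1 (addrC h s); field.
  rewrite normrM normrN normfV -ler_pdivlMl ?invr_gt0 ?normr_gt0// invrK.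
  rewrite (le_trans (E h))// -(@real_normK _ h) ?num_real// expr2 ler_wpM2l//.
split; first by apply/cvg_ex; exists (2 * m s).
exact: (cvg_lim _ H).
Unshelve. all: by end_near. Qed.

(* C^1 on s >= 0, zero for s <= e, with derivative 1 - 4 e^2/(s + e)^2 beyond. *)
Definition cutoff e s := Num.max (s - e) 0 ^+ 2 * (s + e)^-1.
Definition dcutoff e s :=
  Num.max (s - e) 0 * (2 * (s + e) - Num.max (s - e) 0) * (s + e) ^- 2.

Lemma is_derive_cutoff e s : 0 < e -> 0 <= s ->
  is_derive s 1 (cutoff e) (dcutoff e s).
Proof.
move=> e0 s0; have se : s + e != 0 by rewrite gt_eqF// ltr_wpDl.
have d1 : is_derive s 1 (fun s : R => s + e) 1.
  have := is_deriveD (is_derive_id s (1 : R)) (is_derive_cst e s (1 : R)).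
  by rewrite addr0.
apply: (is_derive_eq (is_deriveM (is_derive_sqr_max e s)
  (@is_deriveV _ (fun s => s + e) s _ _ se d1))).
rewrite /GRing.scale/= /dcutoff; field; exact: se.
Qed.

Lemma cutoff_eq0 e s : s <= e -> cutoff e s = 0.
Proof.
move=> se; rewrite /cutoff max_r ?subr_le0// expr0n mul0r//.
Qed.

Lemma dcutoff_eq0 e s : s <= e -> dcutoff e s = 0.
Proof. by move=> se; rewrite /dcutoff max_r ?subr_le0// !mul0r. Qed.

Lemma cutoff_itv e s : 0 < e -> 0 <= s -> 0 <= cutoff e s <= s.
Proof.
move=> e0 s0; have [se|es] := leP s e; first by rewrite cutoff_eq0// lexx.
rewrite /cutoff max_l ?subr_ge0; last exact: ltW.
have p : 0 < s + e by rewrite ltr_wpDl.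
apply/andP; split; first by rewrite mulr_ge0 ?sqr_ge0// invr_ge0 ltW.
by rewrite ler_pdivrMr//; nra.
Qed.

Lemma dcutoffE e s : 0 < e -> e < s -> dcutoff e s = 1 - 4 * e ^+ 2 * (s + e) ^- 2.
Proof.
move=> e0 es; rewrite /dcutoff max_l ?subr_ge0; last exact: ltW.
by field; rewrite gt_eqF// addr_gt0// (lt_trans e0).
Qed.

Lemma dcutoff_itv e s : 0 < e -> 0 <= s -> 0 <= dcutoff e s <= 1.
Proof.
move=> e0 s0; have [se|es] := leP s e; first by rewrite dcutoff_eq0// lexx ler01.
have p : 0 < (s + e) ^+ 2 by rewrite exprn_gt0// ltr_wpDl.
rewrite dcutoffE// subr_ge0 gerBl; apply/andP; split.
  by rewrite ler_pdivrMr// mul1r; nra.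
by rewrite mulr_ge0 ?invr_ge0 ?(ltW p)// mulr_ge0// sqr_ge0.
Qed.

Lemma continuous_dcutoff e s : 0 < e -> 0 <= s ->
  {for s, continuous (dcutoff e)}.
Proof.
move=> e0 s0; have se : 0 < s + e by rewrite ltr_wpDl.
have c1 : Num.max (y - e) 0 @[y --> s] --> Num.max (s - e) 0.
  apply: (@continuous_max R R (fun y => y - e) (cst 0)) => //.
    by apply: cvgB; [exact: cvg_id|exact: cvg_cst].
  exact: cvg_cst.
have c2 : y + e @[y --> s] --> s + e.
  by apply: cvgD; [exact: cvg_id|exact: cvg_cst].
apply: cvgM; first (apply: cvgM => //; apply: cvgB => //; apply: cvgM => //; exact: cvg_cst).
apply: cvgV; first by rewrite gt_eqF// exprn_gt0.
exact: (cvgM c2 c2).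
Qed.

(** For [s > e] the difference equals (3es - e^2)/(s + e); for [s <= e] it is [s] itself. *)
Lemma cutoff_dist e s : 0 < e -> 0 <= s -> `|s - cutoff e s| <= 3 * e.
Proof.
move=> e0 s0; rewrite ger0_norm; last first.
  by rewrite subr_ge0; case/andP : (cutoff_itv e0 s0).
have [se|es] := leP s e; first by rewrite cutoff_eq0// subr0; lra.
rewrite /cutoff max_l ?subr_ge0; last exact: ltW.
have p : 0 < s + e by rewrite ltr_wpDl.
rewrite lerBlDr -lerBlDl ler_pdivlMr//; nra.
Qed.

(** The difference is 4e^2/(s + e)^2. The bound degenerates as [s] tends to 0, as it must, since
    [dcutoff e 0 = 0] for every positive [e]. *)
Lemma dcutoff_dist e s : 0 < e -> e < s -> `|1 - dcutoff e s| <= 4 * e / s.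
Proof.
move=> e0 es; rewrite dcutoffE// opprB addrC subrK.
have s0 : 0 < s by exact: lt_trans es.
have p : 0 < s + e by rewrite addr_gt0.
rewrite ger0_norm; last by rewrite mulr_ge0 ?invr_ge0 ?sqr_ge0// mulr_ge0// sqr_ge0.
by rewrite ler_pdivrMr ?exprn_gt0// mulrAC ler_pdivlMr//; nra.
Qed.

Lemma cvg_cutoff s : 0 <= s -> cutoff k.+1%:R^-1 s @[k --> \oo] --> s.
Proof.
move=> s0; apply/cvgrPdist_le => r r0; near=> k.
have k0 : (0 : R) < k.+1%:R^-1 by rewrite invr_gt0.
rewrite (le_trans (cutoff_dist k0 s0))// -ler_pdivlMl//.
apply/ltW; near: k; apply: (near_infty_natSinv_lt (PosNum _)).
by rewrite mulr_gt0.
Unshelve. all: by end_near. Qed.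

Lemma cvg_dcutoff s : 0 < s -> dcutoff k.+1%:R^-1 s @[k --> \oo] --> (1 : R).
Proof.
move=> s0; apply/cvgrPdist_le => r r0; near=> k.
have k0 : (0 : R) < k.+1%:R^-1 by rewrite invr_gt0.
have ks : k.+1%:R^-1 < s by near: k; exact: (near_infty_natSinv_lt (PosNum s0)).
rewrite (le_trans (dcutoff_dist k0 ks))// ler_pdivrMr// -ler_pdivlMl//.
apply/ltW; near: k.
have p : 0 < 4^-1 * (r * s) by rewrite !mulr_gt0.
exact: (near_infty_natSinv_lt (PosNum p)).
Unshelve. all: by end_near. Qed.

End cutoff.

(** * Integration by parts against a cut-off *)

Section green.
Context {R : realType} {n : nat}.
Variable O : set 'rV[R]_n.
Hypotheses (oO : open O) (bO : bounded_set O).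
Local Notation mu := (lebesgue_rV n).
Implicit Types (w f : 'rV[R]_n -> R) (wi Vi Vii : 'I_n -> 'rV[R]_n -> R)
  (x : 'rV[R]_n) (i : 'I_n) (e C : R).

Definition grad_on w wi := forall i x, O x ->
  is_derive x (delta_mx ord0 i) w (wi i x) /\ {for x, continuous (wi i)}.

(** Zero boundary values without mention of the boundary: as [O] is bounded, each set where
    [w >= e > 0] is compact and contained in [O]. *)
Definition vanishing w :=
  [/\ continuous w, (forall x, 0 <= w x) & forall x, ~ O x -> w x = 0].

Let mO : measurable O. Proof. exact: measurable_rV_open. Qed.
Let fO : (mu O < +oo)%E. Proof. exact: lebesgue_rV_bounded. Qed.

Lemma is_derive_comp_line (psi : R -> R) w x (v : 'rV[R]_n) (p d : R) :
  is_derive (w x) 1 psi p -> is_derive x v w d ->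
  is_derive x v (psi \o w) (p * d).
Proof.
move=> dpsi dw; pose g (s : R) := w (s *: v + x).
have dg : is_derive (0 : R) (1 : R) g d.
  apply: is_derive_line dw => h; rewrite /g; congr w.
  by rewrite addr0 /GRing.scale/= mulr1.
have g0 : g 0 = w x by rewrite /g scale0r add0r.
have := @is_derive1_comp R psi g 0 p d; rewrite g0.
move=> /(_ dpsi dg); apply: is_derive_line => h.
by rewrite /g /=; congr (psi (w _)); rewrite addr0 /GRing.scale/= mulr1.
Qed.

Lemma near_cutoff w x e : vanishing w -> ~ O x -> 0 < e ->
  \forall y \near x, w y <= e.
Proof.
move=> [cw w0 wO] Ox e0.
have : \forall y \near x, `|w x - w y| < e.
  exact: (iffLR (cvgrPdist_lt _ _) (cw x) _ e0).
apply: filterS => y; rewrite wO// sub0r normrN => /ltW.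
by apply: le_trans; rewrite ler_norm.
Qed.

(** [f] is controlled only inside [O]. Around a point outside, [w] stays below [e], so the product
    is identically zero there. *)
Lemma cutoff_continuous w (theta : R -> R) f e : vanishing w -> 0 < e ->
  (forall s, s <= e -> theta s = 0) ->
  (forall s, 0 <= s -> {for s, continuous theta}) ->
  (forall x, O x -> {for x, continuous f}) ->
  continuous (fun x => theta (w x) * f x).
Proof.
move=> vw e0 th0 cth cf x; have [cw w0 wO] := vw.
have [Ox|nOx] := pselect (O x).
  have c1 : {for x, continuous (theta \o w)}.
    by apply: continuous_comp; [exact: cw|exact: cth].
  exact: (cvgM c1 (cf x Ox)).
rewrite /continuous_at wO// th0 ?ltW// mul0r.
apply: (@cvg_near_cst _ _ _ _ (nbhs x)).
have : \forall y \near x, w y <= e by exact: near_cutoff.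
by apply: filterS => y ye; rewrite th0 ?mul0r.
Qed.

Lemma integral_supp f : (forall x, ~ O x -> f x = 0) ->
  (\int[mu]_(x in O) (f x)%:E = \int[mu]_x (f x)%:E)%E.
Proof.
move=> f0; rewrite integral_mkcond; apply: eq_integral => x _.
by rewrite patchE; case: ifPn => // /negP; rewrite inE => /f0 ->.
Qed.

Lemma supp_integrable f : continuous f -> (forall x, ~ O x -> f x = 0) ->
  mu.-integrable setT (EFin \o f).
Proof.
move=> cf f0; have [M [_ /(_ (M + 1))]] := bO.
rewrite ltrDl ltr01 => /(_ isT) MO.
apply: (@cont_supp_integrable _ _ _ (M + 1)) => // x i Mx.
apply: f0 => Ox; have := MO x Ox; apply/negP; rewrite -ltNge (lt_le_trans Mx)//.
rewrite [leRHS]/Num.norm /= mx_normrE.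
by apply/bigmax_geP; right => /=; exists (ord0, i).
Qed.

(** The product of [cutoff e (w x)] and [Vi i x] has compact support in [O], so its i-th partial
    derivative has integral zero over R^n; the product rule splits this derivative into the two
    integrands. *)
Lemma green_cutoff_partial w wi Vi Vii e i : vanishing w -> grad_on w wi ->
  (forall x, O x -> is_derive x (delta_mx ord0 i) (Vi i) (Vii i x)) ->
  (forall x, O x -> {for x, continuous (Vi i)}) ->
  (forall x, O x -> {for x, continuous (Vii i)}) -> 0 < e ->
  [/\ mu.-integrable O (EFin \o (fun x => dcutoff e (w x) * (wi i x * Vi i x))),
      mu.-integrable O (EFin \o (fun x => cutoff e (w x) * Vii i x)) &
  \int[mu]_(x in O) (dcutoff e (w x) * (wi i x * Vi i x)) =
  - \int[mu]_(x in O) (cutoff e (w x) * Vii i x)].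
Proof.
move=> vw gw dV cV cVii e0; have [cw w0 wO] := vw.
pose A x := dcutoff e (w x) * (wi i x * Vi i x).
pose B x := cutoff e (w x) * Vii i x.
have cA : continuous A.
  apply: (cutoff_continuous vw e0); first exact: dcutoff_eq0.
    by move=> s; exact: continuous_dcutoff.
  by move=> x Ox; exact: (cvgM (gw i x Ox).2 (cV x Ox)).
have cB : continuous B.
  apply: (cutoff_continuous vw e0); first exact: cutoff_eq0.
    by move=> s s0; apply: is_derive_continuous; exact: is_derive_cutoff.
  exact: cVii.
have A0 x : ~ O x -> A x = 0.
  by move=> /wO wx; rewrite /A wx dcutoff_eq0 ?mul0r// ltW.
have B0 x : ~ O x -> B x = 0.
  by move=> /wO wx; rewrite /B wx cutoff_eq0 ?mul0r// ltW.
have iA := supp_integrable cA A0.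
have iB := supp_integrable cB B0.
have [M [_ /(_ (`|M| + 1))]] := bO.
rewrite (le_lt_trans (ler_norm M)) ?ltrDl// => /(_ isT) MO.
have M0 : 0 <= `|M| + 1 by rewrite addr_ge0.
have dX x : is_derive x (delta_mx ord0 i) (fun x => cutoff e (w x) * Vi i x)
    (A x + B x).
  have [Ox|nOx] := pselect (O x).
    have d1 := is_derive_comp_line (is_derive_cutoff e0 (w0 x)) (gw i x Ox).1.
    apply: (is_derive_eq (is_deriveM d1 (dV x Ox))).
    by rewrite /A /B /GRing.scale/=; ring.
  rewrite A0// B0// addr0.
  apply: (@near_eq_is_derive _ _ _ (cst 0)) => //.
    near=> y; rewrite cutoff_eq0 ?mul0r//; near: y; exact: near_cutoff.
have Z : (\int[mu]_x (A x + B x)%:E = 0)%E.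
  apply: (integral_partial_eq0 M0 dX); first by move=> x; exact: (cvgD (cA x) (cB x)).
  move=> x j Mx.
  have nO : ~ O x.
    move=> Ox; have := MO x Ox; apply/negP; rewrite -ltNge (lt_le_trans Mx)//.
    rewrite [leRHS]/Num.norm /= mx_normrE.
    by apply/bigmax_geP; right => /=; exists (ord0, j).
  by rewrite A0// B0// addr0 wO// cutoff_eq0 ?mul0r// ltW.
split.
- exact: integrableS iA.
- exact: integrableS iB.
apply/eqP; rewrite -addr_eq0; apply/eqP.
rewrite /Rintegral integral_supp// (integral_supp (f := B))//.
by rewrite -fineD ?integrable_fin_num// -integralD_EFin// Z.
Unshelve. all: by end_near. Qed.

End green.
Lemma Rintegral_bigsum d (T : measurableType d) (R : realType)
    (mu : {measure set T -> \bar R}) (D : set T) (I : Type) (r : seq I)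
    (f : I -> T -> R) : measurable D ->
  (forall i, mu.-integrable D (EFin \o f i)) ->
  mu.-integrable D (EFin \o (fun x => \sum_(i <- r) f i x)) /\
  \int[mu]_(x in D) (\sum_(i <- r) f i x) =
  \sum_(i <- r) \int[mu]_(x in D) f i x.
Proof.
move=> mD fi; elim: r => [|i r [IH1 IH2]].
  have E0 : (fun x => \sum_(j <- [::]) f j x) = cst 0.
    by apply/funext => x; rewrite big_nil.
  rewrite E0 big_nil; split; first exact: integrable0.
  by rewrite Rintegral_cst// mul0r.
have E : (fun x => \sum_(j <- i :: r) f j x) =
    (fun x => f i x + \sum_(j <- r) f j x).
  by apply/funext => x; rewrite big_cons.
rewrite E big_cons -IH2; split; last exact: RintegralD.
exact: integrableD (fi i) IH1.
Qed.

Lemma integrable_le d (T : measurableType d) (R : realType)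
    (mu : {measure set T -> \bar R}) (D : set T) (f g : T -> R) :
  measurable D -> measurable_fun D f ->
  (forall x, D x -> `|f x| <= g x) ->
  mu.-integrable D (EFin \o g) -> mu.-integrable D (EFin \o f).
Proof.
move=> mD mf fg; apply: le_integrable => //; first exact/measurable_EFinP.
by move=> x Dx /=; rewrite lee_fin (le_trans (fg x Dx))// ler_norm.
Qed.

(** Difference quotients at a zero of a nonnegative function have the sign of [h]. A nonzero limit
    is refuted by the step [r / 2] or [- (r / 2)] whose quotient has the wrong sign. *)
Lemma derive_min_eq0 (R : realType) (V : normedModType R) (w : V -> R) (x v : V)
    (d : R) : (forall y, 0 <= w y) -> w x = 0 -> is_derive x v w d -> d = 0.
Proof.
move=> w0 wx [/cvg_ex[l /= Hl] D].
have dl : d = l by rewrite -D; exact: (cvg_lim _ Hl).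
apply/eqP; rewrite dl; apply/negPn/negP => l0.
have := iffLR (cvgrPdist_lt _ _) Hl `|l|; rewrite normr_gt0 => /(_ _ l0) [r /= r0 rP].
have P h : h != 0 -> `|h| < r -> `|l - h^-1 * w (h *: v + x)| < `|l|.
  by move=> h0 hr; have := rP h; rewrite /= wx subr0 sub0r normrN; apply.
have r2 : 0 < r / 2 by rewrite divr_gt0.
have r2r : r / 2 < r by rewrite gtr_pMr// invf_lt1// ltr1n.
have [l1|l1] := ltP l 0.
  have := P (r / 2); rewrite gt_eqF// gtr0_norm// => /(_ isT r2r).
  have W : 0 <= (r / 2)^-1 * w ((r / 2) *: v + x) by rewrite mulr_ge0// invr_ge0 ltW.
  rewrite (ltr0_norm l1) ler0_norm; last by lra.
  by move=> ?; lra.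
have l2 : 0 < l by rewrite lt_neqAle eq_sym l0.
have := P (- (r / 2)); rewrite lt_eqF ?oppr_lt0// normrN gtr0_norm// => /(_ isT r2r).
have W : (- (r / 2))^-1 * w ((- (r / 2)) *: v + x) <= 0.
  by rewrite mulr_le0_ge0// invr_le0 oppr_le0 ltW.
rewrite (gtr0_norm l2) ger0_norm; last by lra.
by move=> ?; lra.
Qed.

(** * Fatou's lemma and dominated convergence along sequences *)

Section fatou_corollaries.
Context d (T : measurableType d) (R : realType).
Variable mu : {measure set T -> \bar R}.
Local Open Scope ereal_scope.

Lemma limn_einf_le (u : (\bar R)^nat) c : (forall k, u k <= c) -> limn_einf u <= c.
Proof.
move=> uc; rewrite limn_einf_lim; apply: lime_le; first exact: is_cvg_einfs.
apply: nearW => k; rewrite (le_trans _ (uc k))//.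
by apply: ereal_inf_lbound; exists k => /=.
Qed.

(** Lets two separate applications of Fatou's lemma be added; nonnegativity excludes sums of
    opposite infinities. *)
Lemma limn_einf_leD (u v : (\bar R)^nat) : (forall k, 0 <= u k) ->
  (forall k, 0 <= v k) ->
  limn_einf u + limn_einf v <= limn_einf (fun k => u k + v k).
Proof.
move=> u0 v0.
have e0 w k : (forall k, 0 <= w k) -> 0 <= einfs w k.
  by move=> w0; apply: le_ereal_inf_tmp => _ [m _ <-].
have l0 w : (forall k, 0 <= w k) -> 0 <= limn (einfs w).
  move=> w0; apply: lime_ge; first exact: is_cvg_einfs.
  by apply: nearW => k; exact: e0.
rewrite !limn_einf_lim -limeD; [|exact: is_cvg_einfs..|].
  apply: lee_lim.
  - apply: is_cvgeD; [|exact: is_cvg_einfs..].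
    by apply: ge0_adde_def; rewrite inE l0.
  - exact: is_cvg_einfs.
  - apply: nearW => k; apply: le_ereal_inf_tmp => _ [m /= km <-].
    by apply: leeD; apply: ereal_inf_lbound; exists m.
by apply: ge0_adde_def; rewrite inE l0.
Qed.

Lemma fatou_cvg (D : set T) (f : nat -> T -> R) (g : T -> R) :
  measurable D -> (forall k, measurable_fun D (f k)) ->
  (forall k x, D x -> (0 <= f k x)%R) ->
  (forall x, D x -> f k x @[k --> \oo] --> g x) ->
  \int[mu]_(x in D) (g x)%:E <=
  limn_einf (fun k => \int[mu]_(x in D) (f k x)%:E).
Proof.
move=> mD mf f0 fg.
have := @fatou _ _ _ mu D mD (fun k x => (f k x)%:E).
move=> /(_ (fun k => (iffRL (measurable_EFinP _ _) (mf k))) _).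
have H k x : D x -> 0 <= (f k x)%:E by move=> Dx; rewrite lee_fin f0.
move=> /(_ H); apply: le_trans; rewrite le_eqVlt; apply/orP; left; apply/eqP.
apply: eq_integral => x; rewrite inE => Dx; apply/esym.
have H2 : (f k x)%:E @[k --> \oo] --> (g x)%:E.
  by apply: cvg_EFin; [exact: nearW|exact: fg].
exact: (cvg_limn_einf_sup H2).1.
Qed.

End fatou_corollaries.

Lemma Rdominated_cvg d (T : measurableType d) (R : realType)
    (mu : {measure set T -> \bar R}) (D : set T) (f : nat -> T -> R)
    (l g : T -> R) : measurable D ->
  (forall k, measurable_fun D (f k)) -> mu.-integrable D (EFin \o l) ->
  (forall x, D x -> f k x @[k --> \oo] --> l x) ->
  mu.-integrable D (EFin \o g) ->
  (forall k x, D x -> `|f k x| <= g x) ->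
  \int[mu]_(x in D) f k x @[k --> \oo] --> \int[mu]_(x in D) l x.
Proof.
move=> mD mf il fl ig fg; apply: fine_cvg.
rewrite fineK; last exact: integrable_fin_num.
apply: (@dominated_cvg _ _ _ mu D mD (fun k x => (f k x)%:E) _ (EFin \o g)) => //.
- by move=> k; apply/measurable_EFinP.
- by move=> x Dx; apply: cvg_EFin; [exact: nearW|exact: fl].
Qed.
(** The integral of a nonnegative function is a supremum over simple functions below it, so
    monotonicity holds without measurability. It is applied to the time integral of the spatial
    integral of u_t^2, whose measurability in time is not established. *)
Lemma ge0_le_integralT d (T : measurableType d) (R : realType)
    (mu : {measure set T -> \bar R}) (D : set T) (f g : T -> \bar R) :
  (forall y, D y -> (0 <= f y)%E) -> (forall y, D y -> (f y <= g y)%E) ->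
  (\int[mu]_(y in D) f y <= \int[mu]_(y in D) g y)%E.
Proof.
move=> f0 fg; have g0 y : D y -> (0 <= g y)%E.
  by move=> Dy; exact: le_trans (f0 y Dy) (fg y Dy).
rewrite !ge0_integralE//; apply: le_ereal_sup => _ [h /= hf <-]; exists h => //= y.
apply: le_trans (hf y) _; rewrite !patchE; case: ifPn => //.
by rewrite inE => /fg.
Qed.

Lemma le_limn_einf (R : realType) (u w : (\bar R)^nat) :
  (forall k, (u k <= w k)%E) -> (limn_einf u <= limn_einf w)%E.
Proof.
move=> uw; rewrite !limn_einf_lim; apply: lee_lim; [exact: is_cvg_einfs..|].
apply: nearW => k; apply: le_ereal_inf_tmp => _ [l /= kl <-].
by apply: le_trans (uw l); apply: ereal_inf_lbound; exists l.
Qed.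

(** * Green's formula and convexity of the Dirichlet energy *)

Section green_formula.
Context {R : realType} {n : nat}.
Variable O : set 'rV[R]_n.
Hypotheses (oO : open O) (bO : bounded_set O).
Local Notation mu := (lebesgue_rV n).
Implicit Types (w f V : 'rV[R]_n -> R) (wi Vi Vii : 'I_n -> 'rV[R]_n -> R)
  (x : 'rV[R]_n) (i : 'I_n) (e B C : R).

(** [Vi] is a vector field; only its diagonal derivatives are recorded, because only the divergence
    [\sum_i Vii i x] enters Green's formula. *)
Definition field_on Vi Vii := forall i x, O x ->
  [/\ is_derive x (delta_mx ord0 i) (Vi i) (Vii i x),
    {for x, continuous (Vi i)} & {for x, continuous (Vii i)}].

Let mO : measurable O. Proof. exact: measurable_rV_open. Qed.
Let fO : (mu O < +oo)%E. Proof. exact: lebesgue_rV_bounded. Qed.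

Lemma sum_continuous (fi : 'I_n -> 'rV[R]_n -> R) x :
  (forall i, {for x, continuous (fi i)}) ->
  {for x, continuous (fun y => \sum_i fi i y)}.
Proof.
move=> cf; elim: (index_enum 'I_n) => [|i r IHr].
  have -> : (fun y => \sum_(j <- [::]) fi j y) = cst 0.
    by apply/funext => y; rewrite big_nil.
  exact: cst_continuous.
have -> : (fun y => \sum_(j <- i :: r) fi j y) =
    (fun y => fi i y + \sum_(j <- r) fi j y).
  by apply/funext => y; rewrite big_cons.
exact: (cvgD (cf i) IHr).
Qed.

Let icst C : mu.-integrable O (EFin \o cst C).
Proof.
by apply: (bounded_cont_integrable (C := `|C|)) => // x _; exact: cst_continuous.
Qed.

Lemma Rintegral_bound f C : mu.-integrable O (EFin \o f) ->
  (forall x, O x -> `|f x| <= C) ->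
  `|\int[mu]_(x in O) f x| <= C * fine (mu O).
Proof.
move=> fi fC; rewrite -(Rintegral_cst mu mO).
rewrite (le_trans (le_normr_Rintegral _ _))// le_Rintegral//.
  exact: integrable_norm fi.
exact: (icst C).
Qed.

Lemma dot_measurable wi Vi :
  (forall i x, O x -> {for x, continuous (wi i)}) ->
  (forall i x, O x -> {for x, continuous (Vi i)}) ->
  measurable_fun O (fun x => \sum_i wi i x * Vi i x).
Proof.
move=> cw cV; apply: open_continuous_measurable_rV => // x Ox.
apply: sum_continuous => i; exact: (cvgM (cw i x Ox) (cV i x Ox)).
Qed.

Lemma green_cutoff w wi Vi Vii e : vanishing O w -> grad_on O w wi ->
  field_on Vi Vii -> 0 < e ->
  [/\ mu.-integrable O (EFin \o (fun x => dcutoff e (w x) * \sum_i wi i x * Vi i x)),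
      mu.-integrable O (EFin \o (fun x => cutoff e (w x) * \sum_i Vii i x)) &
  \int[mu]_(x in O) (dcutoff e (w x) * \sum_i wi i x * Vi i x) =
  - \int[mu]_(x in O) (cutoff e (w x) * \sum_i Vii i x)].
Proof.
move=> vw gw fV e0.
have H i := @green_cutoff_partial _ _ _ oO bO w wi Vi Vii e i vw gw
  (fun x Ox => let: And3 d _ _ := fV i x Ox in d)
  (fun x Ox => let: And3 _ d _ := fV i x Ox in d)
  (fun x Ox => let: And3 _ _ d := fV i x Ox in d) e0.
have [HA HB HE] := all_and3 H.
have [A1 A2] := Rintegral_bigsum
  (f := fun i x => dcutoff e (w x) * (wi i x * Vi i x)) (index_enum 'I_n) mO HA.
have [B1 B2] := Rintegral_bigsum
  (f := fun i x => cutoff e (w x) * Vii i x) (index_enum 'I_n) mO HB.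
have EA : (fun x => dcutoff e (w x) * \sum_i wi i x * Vi i x) =
  (fun x => \sum_i dcutoff e (w x) * (wi i x * Vi i x)).
  by apply/funext => x; rewrite mulr_sumr.
have EB : (fun x => cutoff e (w x) * \sum_i Vii i x) =
  (fun x => \sum_i cutoff e (w x) * Vii i x).
  by apply/funext => x; rewrite mulr_sumr.
split; [by rewrite EA|by rewrite EB|].
by rewrite EA EB A2 B2 -sumrN; apply: eq_bigr => i _; exact: HE.
Qed.

(* On {w = 0}, where the derivative of the cut-off does not tend to 1, the
   gradient of w vanishes because w >= 0. *)
Lemma green w wi Vi Vii B C : vanishing O w -> grad_on O w wi ->
  field_on Vi Vii -> (forall x, w x <= B) ->
  (forall x, O x -> `|\sum_i Vii i x| <= C) ->
  mu.-integrable O (EFin \o (fun x => \sum_i wi i x * Vi i x)) ->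
  \int[mu]_(x in O) (\sum_i wi i x * Vi i x) =
  - \int[mu]_(x in O) (w x * \sum_i Vii i x).
Proof.
move=> vw gw fV wB LC iD; have [cw w0 wO] := vw.
have e0 k : (0 : R) < k.+1%:R^-1 by rewrite invr_gt0.
have K k := green_cutoff vw gw fV (e0 k).
have mL : measurable_fun O (fun x => \sum_i Vii i x).
  apply: open_continuous_measurable_rV => // x Ox.
  by apply: sum_continuous => i; case: (fV i x Ox).
have mw : measurable_fun O w.
  by apply: open_continuous_measurable_rV => // x Ox; exact: cw.
have cA : \int[mu]_(x in O) (dcutoff k.+1%:R^-1 (w x) * \sum_i wi i x * Vi i x)
    @[k --> \oo] --> \int[mu]_(x in O) (\sum_i wi i x * Vi i x).
  apply: (Rdominated_cvg (g := fun x => `|\sum_i wi i x * Vi i x|)) => //.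
  - by move=> k; case: (K k) => /integrableP[] /measurable_EFinP.
  - move=> x Ox.
    have [wx0|wx0] := eqVneq (w x) 0.
      have -> : \sum_i wi i x * Vi i x = 0.
        apply: big1 => i _; case: (gw i x Ox) => d _.
        by rewrite (derive_min_eq0 w0 wx0 d) mul0r.
      by under eq_fun do rewrite mulr0; exact: cvg_cst.
    have wx : 0 < w x by rewrite lt_neqAle eq_sym wx0 w0.
    rewrite -[X in _ --> X]mul1r; apply: cvgM; last exact: cvg_cst.
    exact: cvg_dcutoff.
  - exact: integrable_norm iD.
  - move=> k x Ox; rewrite normrM ler_piMl//.
    by have /andP[p q] := dcutoff_itv (e0 k) (w0 x); rewrite ger0_norm.
have cB : \int[mu]_(x in O) (cutoff k.+1%:R^-1 (w x) * \sum_i Vii i x)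
    @[k --> \oo] --> \int[mu]_(x in O) (w x * \sum_i Vii i x).
  have iw : mu.-integrable O (EFin \o (fun x => w x * \sum_i Vii i x)).
    apply: (integrable_le mO (g := cst (B * C))).
    - exact: measurable_funM.
    - move=> x Ox; rewrite normrM ger0_norm//.
      by apply: ler_pM => //; exact: LC.
    - exact: (icst (B * C)).
  apply: (Rdominated_cvg (g := cst (B * C))) => //.
  - by move=> k; case: (K k) => _ /integrableP[] /measurable_EFinP.
  - by move=> x Ox; apply: cvgM; [exact: cvg_cutoff|exact: cvg_cst].
  - move=> k x Ox; rewrite normrM.
    have /andP[p q] := cutoff_itv (e0 k) (w0 x).
    by rewrite ler_pM// ?LC// ger0_norm// (le_trans q).
have cB' : (- \int[mu]_(x in O) (cutoff k.+1%:R^-1 (w x) * \sum_i Vii i x))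
    @[k --> \oo] --> - \int[mu]_(x in O) (w x * \sum_i Vii i x).
  exact: (cvgN cB).
rewrite -(cvg_lim (@Rhausdorff R) cA) -(cvg_lim (@Rhausdorff R) cB').
by congr (lim (_ @ \oo)); apply/funext => k; case: (K k).
Qed.

(** [V] is tested against its own gradient field: the cut-off Green formula bounds the cut-off
    energy by [B * C] times the measure of [O], uniformly in the cut-off, and Fatou's lemma removes
    it. At zeros of [V] its gradient vanishes. *)
Lemma vanishing_grad_integrable V Vi Vii B C : vanishing O V -> grad_on O V Vi ->
  field_on Vi Vii -> (forall x, V x <= B) ->
  (forall x, O x -> `|\sum_i Vii i x| <= C) ->
  mu.-integrable O (EFin \o (fun x => \sum_i Vi i x ^+ 2)).
Proof.
move=> vw gw fV wB LC; have [cw w0 wO] := vw.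
have e0 k : (0 : R) < k.+1%:R^-1 by rewrite invr_gt0.
have K k := green_cutoff vw gw fV (e0 k).
have mV : measurable_fun O (fun x => \sum_i Vi i x ^+ 2).
  apply: open_continuous_measurable_rV => // x Ox; apply: sum_continuous => i.
  by case: (fV i x Ox) => _ c _; exact: (cvgM c c).
have S0 x : 0 <= \sum_i Vi i x ^+ 2 by apply: sumr_ge0 => i _; exact: sqr_ge0.
apply/integrableP; split; first exact/measurable_EFinP.
under eq_integral do rewrite /= ger0_norm//.
apply: (@le_lt_trans _ _ (B * C * fine (mu O))%:E); last exact: ltry.
apply: le_trans.
  apply: (@fatou_cvg _ _ _ mu O
    (fun k x => dcutoff k.+1%:R^-1 (V x) * \sum_i Vi i x ^+ 2)) => //.
  - by move=> k; case: (K k) => /integrableP[] /measurable_EFinP.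
  - move=> k x Ox; rewrite mulr_ge0//.
    by case/andP : (dcutoff_itv (e0 k) (w0 x)).
  - move=> x Ox.
    have [wx0|wx0] := eqVneq (V x) 0.
      have -> : \sum_i Vi i x ^+ 2 = 0.
        apply: big1 => i _; case: (gw i x Ox) => d _.
        by rewrite (derive_min_eq0 w0 wx0 d) expr0n.
      by under eq_fun do rewrite mulr0; exact: cvg_cst.
    have wx : 0 < V x by rewrite lt_neqAle eq_sym wx0 w0.
    rewrite -[X in _ --> X]mul1r; apply: cvgM; last exact: cvg_cst.
    exact: cvg_dcutoff.
apply: limn_einf_le => k.
have [iA iB AB] := K k.
have -> : (\int[mu]_(x in O) (dcutoff k.+1%:R^-1 (V x) * \sum_i Vi i x ^+ 2)%:E =
    (\int[mu]_(x in O) (dcutoff k.+1%:R^-1 (V x) * \sum_i Vi i x ^+ 2))%:E)%E.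
  by rewrite [RHS]fineK//; exact: (integrable_fin_num _ iA).
rewrite lee_fin [leLHS]AB (le_trans (ler_norm _))// normrN.
apply: Rintegral_bound => // x Ox; rewrite normrM.
have /andP[p q] := cutoff_itv (e0 k) (w0 x).
by rewrite ler_pM// ?LC// ger0_norm// (le_trans q).
Qed.

(** Green's formula, applied to [V] and to [w] with the gradient field of [V], turns the right-hand
    side into the integral of |grad V|^2 - grad w . grad V, and a^2/2 - b^2/2 <= a^2 - ab. No second
    derivative of [w] occurs, so [w] can be any competitor of finite energy. *)
Lemma energy_convex V Vi Vii w wi B C : vanishing O V -> grad_on O V Vi ->
  field_on Vi Vii -> (forall x, V x <= B) ->
  (forall x, O x -> `|\sum_i Vii i x| <= C) ->
  vanishing O w -> grad_on O w wi -> (forall x, w x <= B) ->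
  mu.-integrable O (EFin \o (fun x => \sum_i wi i x ^+ 2)) ->
  2^-1 * \int[mu]_(x in O) (\sum_i Vi i x ^+ 2) -
  2^-1 * \int[mu]_(x in O) (\sum_i wi i x ^+ 2) <=
  \int[mu]_(x in O) ((w x - V x) * \sum_i Vii i x).
Proof.
move=> vV gV fV VB LC vw gw wB iw.
have iV := vanishing_grad_integrable vV gV fV VB LC.
have mL : measurable_fun O (fun x => \sum_i Vii i x).
  apply: open_continuous_measurable_rV => // x Ox.
  by apply: sum_continuous => i; case: (fV i x Ox).
have iwL f : vanishing O f -> (forall x, f x <= B) ->
    mu.-integrable O (EFin \o (fun x => f x * \sum_i Vii i x)).
  move=> [cf f0 _] fB; apply: (integrable_le mO (g := cst (B * C))).
  - apply: measurable_funM => //.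
    by apply: open_continuous_measurable_rV => // x Ox; exact: cf.
  - by move=> x Ox; rewrite normrM ger0_norm// ler_pM// LC.
  - exact: (icst (B * C)).
have iVw : mu.-integrable O (EFin \o (fun x => \sum_i wi i x * Vi i x)).
  apply: (integrable_le mO (g := fun x => \sum_i wi i x ^+ 2 + \sum_i Vi i x ^+ 2)).
  - apply: dot_measurable => i x Ox; first by case: (gw i x Ox).
    by case: (fV i x Ox).
  - move=> x Ox; rewrite -big_split/= (le_trans (ler_norm_sum _ _ _))//.
    apply: ler_sum => i _; rewrite ler_norml; apply/andP; split; nra.
  - exact: integrableD iw iV.
have G1 := green vV gV fV VB LC iV.
have G2 := green vw gw fV wB LC iVw.
have -> : \int[mu]_(x in O) ((w x - V x) * \sum_i Vii i x) =
    \int[mu]_(x in O) (\sum_i Vi i x ^+ 2) -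
    \int[mu]_(x in O) (\sum_i wi i x * Vi i x).
  rewrite [X in X - _]G1 G2 opprK addrC -RintegralB; [|exact: mO|exact: iwL..].
  by apply: eq_Rintegral => x _; rewrite mulrBl.
have iV2 : mu.-integrable O (EFin \o (fun x => 2^-1 * \sum_i Vi i x ^+ 2)).
  exact: (integrableZl mO 2^-1 iV).
have iw2 : mu.-integrable O (EFin \o (fun x => 2^-1 * \sum_i wi i x ^+ 2)).
  exact: (integrableZl mO 2^-1 iw).
rewrite -!RintegralZl// -!RintegralB//.
apply: le_Rintegral => //.
- exact: (integrableB mO iV2 iw2).
- exact: (integrableB mO iV iVw).
move=> x Ox; rewrite !mulr_sumr -!sumrB; apply: ler_sum => i _.
have := sqr_ge0 (Vi i x - wi i x); rewrite sqrrB; set a := Vi i x; set b := wi i x.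
by move=> ?; nra.
Qed.

End green_formula.
(** * Steklov averages *)

Section steklov.
Context {R : realType} {n : nat}.
Local Notation leb := (@lebesgue_measure R).
Implicit Types (g : R -> R) (G : 'rV[R]_n -> R -> R) (O : set 'rV[R]_n)
  (x y v : 'rV[R]_n) (s t h c e C : R).

Definition avg h g t := h^-1 * \int[leb]_(s in `[t, t + h]) g s.

Lemma itv_cont_gt0 g t h s : (forall t, 0 < t -> {for t, continuous g}) ->
  0 < t -> t <= s <= t + h -> {for s, continuous g}.
Proof. by move=> cg t0 /andP[ts _]; apply: cg; exact: lt_le_trans ts. Qed.

Lemma avg_cst c h t : 0 < h -> avg h (cst c) t = c.
Proof.
move=> h0; rewrite /avg Rintegral_cst//= lebesgue_measure_itv/= lte_fin ltrDl h0.
by rewrite -EFinD addrC addKr/= mulrCA mulVf ?mulr1// gt_eqF.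
Qed.

Lemma avgB g1 g2 h t : 0 < t -> (forall t, 0 < t -> {for t, continuous g1}) ->
  (forall t, 0 < t -> {for t, continuous g2}) ->
  avg h (fun s => g1 s - g2 s) t = avg h g1 t - avg h g2 t.
Proof.
move=> t0 c1 c2; rewrite /avg RintegralB ?mulrBr//.
  by apply: continuous_itv_integrable => s; exact: itv_cont_gt0.
by apply: continuous_itv_integrable => s; exact: itv_cont_gt0.
Qed.

Lemma le_avg g1 g2 h t : 0 < h -> 0 < t ->
  (forall t, 0 < t -> {for t, continuous g1}) ->
  (forall t, 0 < t -> {for t, continuous g2}) ->
  (forall s, t <= s <= t + h -> g1 s <= g2 s) ->
  avg h g1 t <= avg h g2 t.
Proof.
move=> h0 t0 c1 c2 g12; rewrite /avg ler_wpM2l ?invr_ge0 ?(ltW h0)// le_Rintegral//.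
- by apply: continuous_itv_integrable => s; exact: itv_cont_gt0.
- by apply: continuous_itv_integrable => s; exact: itv_cont_gt0.
Qed.

Lemma avg_itv g h t a b : 0 < h -> 0 < t ->
  (forall t, 0 < t -> {for t, continuous g}) ->
  (forall s, t <= s <= t + h -> a <= g s <= b) -> a <= avg h g t <= b.
Proof.
move=> h0 t0 cg gab; apply/andP; split.
  rewrite -[leLHS](avg_cst a t h0); apply: le_avg => // [r _|s /gab/andP[]//].
  exact: cst_continuous.
rewrite -[leRHS](avg_cst b t h0); apply: le_avg => // [r _|s /gab/andP[]//].
exact: cst_continuous.
Qed.

Lemma avg_dist g h t c e : 0 < h -> 0 < t ->
  (forall t, 0 < t -> {for t, continuous g}) ->
  (forall s, t <= s <= t + h -> `|g s - c| <= e) -> `|avg h g t - c| <= e.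
Proof.
move=> h0 t0 cg gc; rewrite ler_distl; apply: avg_itv => // s /gc.
by rewrite ler_distl.
Qed.

Lemma is_derive_avg g h t : 0 < h -> 0 < t ->
  (forall t, 0 < t -> {for t, continuous g}) ->
  is_derive t 1 (avg h g) (h^-1 * (g (t + h) - g t)).
Proof.
(* [g] is continuous only at positive times, so the primitive starts at [t / 2]; near [t] the
   average is a difference quotient of [P]. *)
move=> h0 t0 cg; pose P (y : R) := \int[leb]_(s in `[t / 2, y]) g s.
have t20 : 0 < t / 2 by rewrite divr_gt0.
have t2t : t / 2 < t by rewrite gtr_pMr// invf_lt1// ltr1n.
have cg' s b : t / 2 <= s <= b -> {for s, continuous g}.
  by move=> /andP[ts _]; apply: cg; exact: lt_le_trans ts.
have dP s : t / 2 < s -> is_derive s 1 P (g s).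
  move=> ts; apply: (@is_derive_primitive _ _ _ (s + 1)).
    by rewrite ts ltrDl ltr01.
  by move=> r; exact: cg'.
have d1 : is_derive t 1 (fun s => P (s + h)) (g (t + h)).
  have d2 : is_derive t (1 : R) (fun s : R => s + h) 1.
    have := is_deriveD (is_derive_id t (1 : R)) (is_derive_cst h t (1 : R)).
    by rewrite addr0.
  have d3 : is_derive (t + h) 1 P (g (t + h)) by apply: dP; rewrite ltr_wpDr// ltW.
  by have := @is_derive1_comp _ P (fun s => s + h) t _ _ d3 d2; rewrite mulr1.
have d4 : is_derive t 1 (fun s => h^-1 * (P (s + h) - P s)) (h^-1 * (g (t + h) - g t)).
  exact: (is_deriveZ (h^-1) (is_deriveB d1 (dP t t2t))).
apply: near_eq_is_derive d4; near=> s.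
have ts : t / 2 < s by near: s; exact: lt_nbhsr.
rewrite /avg /P (@integral_itv_cat _ _ _ (s + h) s) ?ltW//.
- by rewrite addrC addKr.
- by rewrite ltrDl.
- by move=> r; exact: cg'.
Unshelve. all: by end_near. Qed.

Lemma avg_derivative F g h t : 0 < h -> 0 < t ->
  (forall t, 0 < t -> {for t, continuous g}) ->
  (forall t, 0 < t -> is_derive t 1 F (g t)) ->
  avg h g t = h^-1 * (F (t + h) - F t).
Proof.
move=> h0 t0 cg dF; rewrite /avg; congr (_ * _).
have dF' s : t <= s <= t + h -> is_derive s 1 F (g s).
  by move=> /andP[ts _]; apply: dF; exact: lt_le_trans ts.
apply: (integral_derivative _ dF'); first by rewrite lerDl ltW.
by move=> s; exact: itv_cont_gt0.
Qed.

Lemma avg_cvg g t : 0 < t -> (forall t, 0 < t -> {for t, continuous g}) ->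
  forall e, 0 < e -> exists2 d, 0 < d & forall h, 0 < h < d -> `|avg h g t - g t| <= e.
Proof.
move=> t0 cg e e0.
have := iffLR (cvgrPdist_lt _ _) (cg t t0) e => /(_ _ e0) [d /= d0 dP].
exists d => // h /andP[h0 hd]; apply: avg_dist => // s /andP[ts sh].
rewrite distrC ltW//; apply: dP; rewrite /= distrC ger0_norm ?subr_ge0//.
by rewrite ltrBlDl (le_lt_trans sh)// ltrD2l.
Qed.

Lemma avg_dist2 g1 g2 h t e : 0 < h -> 0 < t ->
  (forall t, 0 < t -> {for t, continuous g1}) ->
  (forall t, 0 < t -> {for t, continuous g2}) ->
  (forall s, t <= s <= t + h -> `|g1 s - g2 s| <= e) ->
  `|avg h g1 t - avg h g2 t| <= e.
Proof.
move=> h0 t0 c1 c2 g12; rewrite -avgB// -[X in `|X|]subr0.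
apply: avg_dist => // [s s0|s /g12]; last by rewrite subr0.
exact: (cvgB (c1 s s0) (c2 s s0)).
Qed.

(** With the point of space fixed, the average is differentiable in time; its dependence on the
    point is uniform over the averaging windows by [near_uniform_itv]. *)
Lemma jcont_avg O G h : open O -> 0 < h -> jcont O G ->
  jcont O (fun x => avg h (G x)).
Proof.
move=> oO h0 cG x t Ox t0.
have cx y : O y -> forall t, 0 < t -> {for t, continuous (G y)}.
  by move=> Oy s s0; exact: jcont_t cG Oy s0.
have E e : 0 < e -> \forall p \near (x, t),
    `|avg h (G x) t - avg h (G p.1) p.2| < e.
  move=> e0; have e20 : 0 < e / 2 by rewrite divr_gt0.
  have t20 : 0 < t / 2 by rewrite divr_gt0.
  have t2t : t / 2 < t by rewrite gtr_pMr// invf_lt1// ltr1n.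
  (* The interval from [t / 2] to [t + 1 + h] contains the window [[s, s + h]] for every [s]
     strictly between [t / 2] and [t + 1]. *)
  have N1 := near_uniform_itv (t + 1 + h) cG Ox t20 e20.
  have N2 := iffLR (cvgrPdist_lt _ _)
    (is_derive_continuous (is_derive_avg h0 t0 (cx x Ox))) (e / 2) e20.
  exists ([set y | forall s, t / 2 <= s <= t + 1 + h -> `|G y s - G x s| < e / 2] `&` O,
    [set s | `|avg h (G x) t - avg h (G x) s| < e / 2] `&` `]t / 2, t + 1[%classic).
    split; first by apply: filterI; [exact: N1|exact: open_nbhs_nbhs].
    apply: filterI; first exact: N2.
    by apply: near_in_itvoo; rewrite in_itv/= t2t ltrDl ltr01.
  move=> [y s] [/= [H1 Oy] [H2]]; rewrite in_itv/= => /andP[ts st1].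
  have s0 : 0 < s by exact: lt_trans ts.
  rewrite (_ : _ - _ = (avg h (G x) t - avg h (G x) s) -
    (avg h (G y) s - avg h (G x) s)); last by ring.
  rewrite (le_lt_trans (ler_normB _ _))// (splitr e) ltr_leD//.
  apply: avg_dist2 => //; [exact: cx|exact: cx|move=> r /andP[sr rs]].
  rewrite ltW// H1// (le_trans (ltW ts))//=.
  by rewrite (le_trans rs)// lerD2r ltW.
by apply/cvgrPdist_lt => e e0; exact: E.
Qed.

(** Differentiation under the integral in the single real variable that parametrises the line
    through [x] in direction [v]. The dominating constant [M + 1] bounds [G'] over the time window
    for all nearby points of the line. *)
Lemma is_derive_avg_space O G G' h x v t : open O -> 0 < h -> 0 < t -> O x ->
  jcont O G -> jcont O G' ->
  (forall y t, O y -> 0 < t -> is_derive y v (G ^~ t) (G' y t)) ->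
  is_derive x v (fun y => avg h (G y) t) (avg h (G' x) t).
Proof.
move=> oO h0 t0 Ox cG cG' dG.
have cx y : O y -> forall t, 0 < t -> {for t, continuous (G y)}.
  by move=> Oy s s0; exact: jcont_t cG Oy s0.
have cx' y : O y -> forall t, 0 < t -> {for t, continuous (G' y)}.
  by move=> Oy s s0; exact: jcont_t cG' Oy s0.
have [M M0 GM] : exists2 M, 0 < M & forall s, t <= s <= t + h -> `|G' x s| <= M.
  have c1 : jcont [set x] G' by apply: jcontW cG' => _ ->.
  have cpt : compact [set x] by exact: compact_set1.
  have [M M0 MP] := jcont_bounded (t + h) cpt c1 t0.
  by exists M => // s; exact: MP.
have N1 := near_uniform_itv (t + h) cG' Ox t0 ltr01.
have cl : {for (0 : R), continuous (fun s : R => s *: v + x)}.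
  apply: cvgD; last exact: cvg_cst.
  exact: scalel_continuous.
have : \forall s \near (0 : R), O (s *: v + x) /\
    forall r, t <= r <= t + h -> `|G' (s *: v + x) r - G' x r| < 1.
  have H : nbhs (0 *: v + x) (O `&` [set y | forall r, t <= r <= t + h ->
      `|G' y r - G' x r| < 1]).
    rewrite scale0r add0r; apply: filterI; last exact: N1.
    exact: open_nbhs_nbhs.
  by apply: (@filterS _ (nbhs (0 : R)) _ _ _ _ (cl _ H)) => s [].
case=> rho /= rho0 rhoP.
have I0 : `]- rho, rho[%classic (0 : R) by rewrite /= in_itv/= oppr_lt0 rho0.
have IP s : `]- rho, rho[%classic s -> O (s *: v + x) /\
    forall r, t <= r <= t + h -> `|G' (s *: v + x) r - G' x r| < 1.
  by rewrite /= in_itv/= => srho; apply: rhoP; rewrite /= sub0r normrN ltr_norml.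
pose B : set (measurableTypeR R) := `[t, t + h]%classic.
pose f (s : R) (r : measurableTypeR R) := G (s *: v + x) r.
have dline s r : `]- rho, rho[%classic s -> B r ->
    is_derive s (1 : R) (f ^~ r) (G' (s *: v + x) r).
  move=> /IP[Os _]; rewrite /B/= in_itv/= => /andP[tr _].
  apply: is_derive_line (dG _ r Os (lt_le_trans t0 tr)) => q.
  by rewrite /f scalerDl [q *: 1]mulr1 addrA.
have df s r : `]- rho, rho[%classic s -> B r -> partial1of2 f s r = G' (s *: v + x) r.
  move=> Is Br; rewrite partial1of2E.
  by have [_ ->] := dline s r Is Br.
have Bt r : B r -> t <= r <= t + h by rewrite /B/= in_itv.
have intf s : `]- rho, rho[%classic s -> leb.-integrable B (EFin \o f s).
  move=> /IP[Os _]; apply: continuous_itv_integrable => r /andP[tr _].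
  by apply: cx => //; exact: lt_le_trans tr.
have derf s r : `]- rho, rho[%classic s -> B r -> derivable (f ^~ r) s 1.
  by move=> Is Br; have [] := dline s r Is Br.
have intG : leb.-integrable B (EFin \o cst (M + 1)).
  by apply: continuous_itv_integrable => r _; exact: cst_continuous.
have M10 (r : measurableTypeR R) : 0 <= cst (M + 1) r by rewrite /= addr_ge0 ?ltW.
have ub s r : `]- rho, rho[%classic s -> B r -> `|partial1of2 f s r| <= cst (M + 1) r.
  move=> Is Br; rewrite df//=; have [_ /(_ r (Bt r Br)) H] := IP s Is.
  rewrite (_ : G' _ r = G' x r + (G' (s *: v + x) r - G' x r)); last by ring.
  by rewrite (le_trans (ler_normD _ _))// lerD ?GM ?Bt// ltW.
have mB : measurable B by exact: measurable_itv.
have D1 := derivable_under_integral mB I0 intf derf M10 intG ub.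
have D2 := differentiation_under_integral mB I0 intf derf M10 intG ub.
rewrite derive1E in D2.
have D3 : is_derive (0 : R) (1 : R) (fun s => \int[leb]_(r in B) f s r)
    (\int[leb]_(r in B) G' x r).
  split; first exact: D1.
  rewrite D2; apply: eq_Rintegral => r; rewrite inE => Br.
  by rewrite /= df// scale0r add0r.
have D4 := is_deriveZ (h^-1) D3.
apply: is_derive_line D4 => s.
by rewrite /avg /f /GRing.scale/= addr0 mulr1.
Qed.

End steklov.

(** * Derivatives from first-order estimates *)

Section calculus.
Context {R : realType}.
Implicit Types (F g : R -> R) (s t p : R).

Lemma is_derive_dist F t p :
  (forall e, 0 < e -> exists2 d, 0 < d & forall s, `|s - t| < d ->
    `|F s - F t - (s - t) * p| <= e * `|s - t|) -> is_derive t 1 F p.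
Proof.
move=> H.
have L : h^-1 *: ((F \o shift t) (h *: (1 : R)) - F t) @[h --> 0^'] --> p.
  apply/cvgrPdist_le => e e0; have [d d0 dP] := H e e0.
  near=> h.
  have h0 : h != 0 by near: h; exact: nbhs_dnbhs_neq.
  have hd : `|h| < d by near: h; exact: dnbhs0_lt.
  have := dP (t + h); rewrite addrAC subrr add0r => /(_ hd) Fh.
  have -> : p - h^-1 *: ((F \o shift t) (h *: (1 : R)) - F t) =
      - h^-1 * (F (t + h) - F t - h * p).
    by rewrite /= /GRing.scale/= mulr1 (addrC h t); field.
  by rewrite normrM normrN normfV -ler_pdivlMl ?invr_gt0 ?normr_gt0// invrK [leRHS]mulrC.
split; first by apply/cvg_ex; exists p.
exact: (cvg_lim _ L).
Unshelve. all: by end_near. Qed.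

(** The remainder depends only on the oscillation of [g]; for a family with uniformly continuous
    derivatives the estimate is uniform in the parameter and can be integrated over the domain. *)
Lemma derivative_estimate F g t d e : 0 < d ->
  (forall s, `|s - t| < d -> is_derive s 1 F (g s)) ->
  (forall s, `|s - t| < d -> `|g s - g t| <= e) ->
  forall s, `|s - t| < d -> `|F s - F t - (s - t) * g t| <= e * `|s - t|.
Proof.
move=> d0 dF ge s sd.
have E c : `|c - t| < d -> F s - F t = g c * (s - t) ->
    `|F s - F t - (s - t) * g t| <= e * `|s - t|.
  move=> cd ->; rewrite mulrC -mulrBr normrM mulrC ler_wpM2r//.
  exact: ge.
have [st|ts] := leP s t.
  have [|c /andP[sc ct] Fc] := itv_mvt st (g := g) (F := F).
    move=> r /andP[sr rt]; apply: dF; apply: le_lt_trans sd.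
    by rewrite !ler0_norm ?subr_le0//; lra.
  apply: (E c); last by lra.
  by apply: le_lt_trans sd; rewrite !ler0_norm ?subr_le0//; lra.
have [|c /andP[sc ct] Fc] := itv_mvt (ltW ts) (g := g) (F := F).
  move=> r /andP[sr rt]; apply: dF; apply: le_lt_trans sd.
  by rewrite !ger0_norm ?subr_ge0//; lra.
apply: (E c); last by lra.
by apply: le_lt_trans sd; rewrite !ger0_norm ?subr_ge0//; lra.
Qed.

Lemma derive_le0_le F g a b : a <= b ->
  (forall t, a <= t <= b -> is_derive t 1 F (g t)) ->
  (forall t, a <= t <= b -> g t <= 0) -> F b <= F a.
Proof.
move=> ab dF g0; have [c cab E] := itv_mvt ab dF.
have := g0 c cab => gc; rewrite -subr_le0 E mulr_le0_ge0// subr_ge0//.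
Qed.

End calculus.

(** * Spatial integrals depending on time *)

Section parametric.
Context {R : realType} {n : nat}.
Variable O : set 'rV[R]_n.
Hypotheses (oO : open O) (bO : bounded_set O).
Local Notation mu := (lebesgue_rV n).
Implicit Types (f : 'rV[R]_n -> R) (G : 'rV[R]_n -> R -> R) (t a b C e : R).

Lemma bounded_closure_compact : compact (closure O).
Proof.
apply: bounded_closed_compact; last exact: closed_closure.
have [M [Mr MP]] := bO; exists M; split => // N MN x Ox.
have cl : closed [set y : 'rV[R]_n | `|y| <= N].
  apply: (@closed_comp _ _ (fun y : 'rV[R]_n => `|y|) [set r | r <= N]).
    by move=> y _; exact: norm_continuous.
  exact: closed_le.
have := closure_subset (MP N MN : O `<=` [set y : 'rV[R]_n | `|y| <= N]) Ox.
by rewrite -(closure_id _).1.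
Qed.

Lemma jcont_boundedO G a b : jcont setT G -> 0 < a ->
  exists2 M, 0 < M & forall x t, O x -> a <= t <= b -> `|G x t| <= M.
Proof.
move=> cG a0; have cK : jcont (closure O) G by exact: jcontW cG.
have [M M0 MP] := jcont_bounded b bounded_closure_compact cK a0.
by exists M => // x t Ox; apply: MP; exact: subset_closure.
Qed.

Lemma jcont_uniformO G a b e : jcont setT G -> 0 < a -> 0 < e ->
  exists2 d, 0 < d & forall x s t, O x -> a <= s <= b -> `|s - t| < d ->
    `|G x s - G x t| < e.
Proof.
move=> cG a0 e0; have cK : jcont (closure O) G by exact: jcontW cG.
have [d d0 dP] := jcont_uniform b bounded_closure_compact cK a0 e0.
by exists d => // x s t Ox; apply: dP; exact: subset_closure.
Qed.

Lemma jcont_integrable G t : jcont setT G -> 0 < t ->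
  mu.-integrable O (EFin \o (G ^~ t)).
Proof.
move=> cG t0; have [M M0 MP] := jcont_boundedO t cG t0.
apply: (bounded_cont_integrable (C := M)) => //.
- by apply: lebesgue_rV_bounded => //; exact: measurable_rV_open.
- by move=> x Ox; exact: jcont_x cG _ t0.
- by move=> x Ox; apply: MP => //; rewrite lexx.
Qed.

Lemma integral_dist_le f1 f2 e : mu.-integrable O (EFin \o f1) ->
  mu.-integrable O (EFin \o f2) -> (forall x, O x -> `|f1 x - f2 x| <= e) ->
  `|\int[mu]_(x in O) f1 x - \int[mu]_(x in O) f2 x| <= e * fine (mu O).
Proof.
move=> i1 i2 fe; have mO := measurable_rV_open oO.
rewrite -RintegralB//; apply: Rintegral_bound => //.
exact: (integrableB mO i1 i2).
Qed.

Lemma jcont_integral_continuous G t : jcont setT G -> 0 < t ->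
  {for t, continuous (fun t => \int[mu]_(x in O) G x t)}.
Proof.
move=> cG t0; apply/cvgrPdist_lt => e e0.
have m0 : 0 <= fine (mu O) by exact: fine_ge0.
(* Dividing by the measure plus 1 keeps the divisor positive even for a null set; the same device
   recurs below. *)
have e1 : 0 < e / (fine (mu O) + 1) by rewrite divr_gt0// ltr_wpDl.
have [d d0 dP] := jcont_uniformO t cG t0 e1.
near=> s.
have s0 : 0 < s by near: s; exact: lt_nbhsr.
have ts : `|t - s| < d by near: s; exact: (iffLR (cvgrPdist_lt _ _) (@cvg_id _ (nbhs t)) d d0).
rewrite (le_lt_trans (integral_dist_le (e := e / (fine (mu O) + 1)) _ _ _))//.
- exact: jcont_integrable.
- exact: jcont_integrable.
- by move=> x Ox; rewrite ltW// dP// lexx.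
- by rewrite mulrAC ltr_pdivrMr ?ltr_wpDl// mulrDr mulr1 ltrDl.
Unshelve. all: by end_near. Qed.

End parametric.
Lemma dist_half_itv (R : realType) (s t : R) : 0 < t -> `|s - t| < t / 2 ->
  `|s - t| < 1 -> 0 < s /\ t / 2 <= s <= t + 1.
Proof.
rewrite (ltr_distl s t (t / 2)) (ltr_distl s t 1).
move=> t0 /andP[? ?] /andP[? ?]; split; [lra|apply/andP; split; lra].
Qed.

Lemma dist_squeeze (R : realType) (d x y p e : R) : y <= d -> d <= x ->
  `|x - p| <= e -> `|y - p| <= e -> `|d - p| <= e.
Proof.
rewrite !ler_norml => ? ? /andP[? ?] /andP[? ?]; apply/andP; split; lra.
Qed.

Section parametric2.
Context {R : realType} {n : nat}.
Variable O : set 'rV[R]_n.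
Hypotheses (oO : open O) (bO : bounded_set O).
Local Notation mu := (lebesgue_rV n).
Implicit Types (f : 'rV[R]_n -> R) (G g : 'rV[R]_n -> R -> R) (t a b C e : R).

Lemma continuous_integrable f : (forall x, {for x, continuous f}) ->
  mu.-integrable O (EFin \o f).
Proof.
move=> cf; have c : jcont setT (fun x (_ : R) => f x).
  by move=> x r _ _; apply: (@continuous_comp _ _ _ fst f); [exact: cvg_fst|exact: cf].
exact: (jcont_integrable oO bO c ltr01).
Qed.

Lemma is_derive_integral G g a t : 0 < a -> a < t -> jcont setT g ->
  (forall s, a < s -> mu.-integrable O (EFin \o (G ^~ s))) ->
  (forall x s, O x -> a < s -> is_derive s 1 (G x) (g x s)) ->
  is_derive t 1 (fun s => \int[mu]_(x in O) G x s) (\int[mu]_(x in O) g x t).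
Proof.
move=> a0 at_ cg iG dG; apply: is_derive_dist => e e0.
have mO := measurable_rV_open oO.
have m0 : 0 <= fine (mu O) by exact: fine_ge0.
have m1 : 0 < fine (mu O) + 1 by rewrite ltr_wpDl.
have e1 : 0 < e / (fine (mu O) + 1) by rewrite divr_gt0.
have [d d0 dP] := jcont_uniformO bO (t + 1) cg a0 e1.
(* The bounds [1] and [t - a] keep all intermediate times in []a, t + 1]], where the derivative is
   known and uniformly continuous. *)
pose d' := Num.min (Num.min d 1) (t - a).
have d'0 : 0 < d' by rewrite !lt_min d0 ltr01 subr_gt0 at_.
have d'P s : `|s - t| < d' -> [/\ `|s - t| < d, a < s & s <= t + 1].
  rewrite !lt_min => /andP[/andP[h1]].
  rewrite (ltr_distl s t 1) (ltr_distl s t (t - a)) => /andP[_ h2] /andP[h3 _].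
  by split => //; [move: h3; rewrite subKr|exact: ltW].
have t0 : 0 < t by exact: lt_trans at_.
exists d' => // s /[dup] sd' /d'P[sd as_ _].
have i1 := jcont_integrable oO bO cg t0.
have i2 : mu.-integrable O (EFin \o (fun x => (s - t) * g x t)).
  exact: (integrableZl mO (s - t) i1).
have i3 : mu.-integrable O (EFin \o (fun x => G x s - G x t)).
  exact: (integrableB mO (iG s as_) (iG t at_)).
rewrite -RintegralB//; [|exact: iG..].
rewrite -RintegralZl//.
apply: (@le_trans _ _ ((e / (fine (mu O) + 1) * `|s - t|) * fine (mu O))).
  apply: (integral_dist_le oO bO) => // x Ox.
  apply: (@derivative_estimate _ (G x) (g x) t d') => // r /d'P[rd ar rt].
    exact: dG.
  by rewrite ltW// dP// (ltW ar).
rewrite (_ : _ * _ * _ = e * `|s - t| * (fine (mu O) / (fine (mu O) + 1))).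
  by rewrite ler_piMr ?mulr_ge0// ?(ltW e0)// ler_pdivrMr// mul1r lerDl.
by field; rewrite gt_eqF.
Qed.

End parametric2.
(** As [d <= 1/2], the inequality first bounds [A] by [2 * (E + B) + M]; then [d * A + d * M] is at
    most [d * K], hence at most [e]. Since [d] does not depend on [N] and [A], it can be fixed
    before the averaging step [h]. *)
Lemma absorb_error (R : realType) (E B M e : R) : 0 <= E -> 0 <= B -> 0 <= M ->
  0 < e -> exists2 d, 0 < d & forall N A, 0 <= N -> 0 <= A ->
    N + (1 - d) * A <= E + B + d * M -> N + A <= E + B + e.
Proof.
move=> E0 B0 M0 e0; pose K := M + (2 * (E + B) + M) + 1.
have K0 : 0 < K by rewrite /K; lra.
pose d := Num.min 2^-1 (e / K).
have d0 : 0 < d by rewrite lt_min invr_gt0 ltr0n divr_gt0.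
have d2 : d <= 2^-1 by rewrite ge_min lexx.
have dK : d * K <= e by rewrite -ler_pdivlMr// ge_min lexx orbT.
exists d => // N A N0 A0 H.
have h1 : d * A <= 2^-1 * A by rewrite ler_wpM2r.
have h2 : d * M <= 2^-1 * M by rewrite ler_wpM2r.
have AK : A <= 2 * (E + B) + M by lra.
have h3 : d * A <= d * (2 * (E + B) + M) by rewrite ler_pM2l.
rewrite /K in dK; lra.
Qed.

(** * Energy estimates *)

Section energy.
Context {R : realType} {n : nat}.
Variable O : set 'rV[R]_n.
Hypotheses (oO : open O) (bO : bounded_set O).
Variables (lam chi : R).
Hypotheses (lam0 : 0 < lam) (chi0 : 0 < chi).
Variables (v vt : 'rV[R]_n -> R -> R) (vi vii : 'I_n -> 'rV[R]_n -> R -> R).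
Local Notation mu := (lebesgue_rV n).
Local Notation leb := (@lebesgue_measure R).
Local Notation m := (fine (mu O)).
Implicit Types (x : 'rV[R]_n) (s t h T e : R) (i : 'I_n).

(** In the notation of the overview [recip] is K(u) and [rsrc] below is r, so that the source term
    is [lam * rsrc x t ^+ 2]. *)
Definition recip x t := (1 - v x t)^-1.
Definition gsum t := 1 + chi * \int[mu]_(x in O) recip x t.
Definition rsrc x t := recip x t * (gsum t)^-1.

Hypothesis cv : jcont setT v.
Hypothesis v0 : forall x t, ~ O x -> v x t = 0.
Hypothesis v01 : forall x t, 0 < t -> 0 <= v x t < 1.
Hypothesis v_sup : forall T, 0 < T ->
  exists2 M, M < 1 & forall x t, 0 < t <= T -> v x t <= M.
Hypothesis cvi : forall i, jcont O (vi i).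
Hypothesis dvi : forall i x t, O x -> 0 < t ->
  is_derive x (delta_mx ord0 i) (v ^~ t) (vi i x t).
Hypothesis cvii : forall i, jcont O (vii i).
Hypothesis dvii : forall i x t, O x -> 0 < t ->
  is_derive x (delta_mx ord0 i) (vi i ^~ t) (vii i x t).
Hypothesis cvt : jcont O vt.
Hypothesis dvt : forall x t, O x -> 0 < t -> is_derive t 1 (v x) (vt x t).
Hypothesis eqn : forall x t, O x -> 0 < t ->
  vt x t = \sum_i vii i x t + lam * rsrc x t ^+ 2.

Let mO : measurable O. Proof. exact: measurable_rV_open. Qed.
Let fO : (mu O < +oo)%E. Proof. exact: lebesgue_rV_bounded. Qed.
Let m0 : 0 <= m. Proof. exact: fine_ge0. Qed.

Lemma omv_gt0 x t : 0 < t -> 0 < 1 - v x t.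
Proof. by move=> t0; rewrite subr_gt0; case/andP : (v01 x t0). Qed.

Lemma jcont_recip : jcont setT recip.
Proof.
apply: jcontV; first by move=> x t _ t0; rewrite gt_eqF// omv_gt0.
by apply: jcontB => //; exact: jcont_cst.
Qed.

Lemma recip_ge1 x t : 0 < t -> 1 <= recip x t.
Proof.
move=> t0; rewrite /recip -[leLHS]invr1 lef_pV2 ?posrE ?omv_gt0//.
by rewrite gerBl; case/andP : (v01 x t0).
Qed.

Lemma gsum_ge t : 0 < t -> 1 + chi * m <= gsum t.
Proof.
move=> t0; rewrite lerD2l ler_wpM2l ?(ltW chi0)//.
rewrite -[leLHS]mul1r -(Rintegral_cst mu mO); apply: le_Rintegral => //.
- exact: (jcont_integrable oO bO (@jcont_cst _ _ setT 1) t0).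
- exact: (jcont_integrable oO bO jcont_recip t0).
- by move=> x _; exact: recip_ge1.
Qed.

Lemma gsum_ge1 t : 0 < t -> 1 <= gsum t.
Proof.
by move=> t0; apply: le_trans (gsum_ge t0); rewrite lerDl mulr_ge0// ltW.
Qed.

Lemma gsum_gt0 t : 0 < t -> 0 < gsum t.
Proof. by move=> t0; exact: lt_le_trans (gsum_ge1 t0). Qed.

Lemma gsum_continuous t : 0 < t -> {for t, continuous gsum}.
Proof.
move=> t0; have c := jcont_integral_continuous oO bO jcont_recip t0.
exact: (cvgD (cvg_cst (1 : R)) (cvgM (cvg_cst chi) c)).
Qed.

Lemma gsumV_continuous t : 0 < t -> {for t, continuous (fun t => (gsum t)^-1)}.
Proof.
move=> t0; apply: cvgV; last exact: gsum_continuous.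
by rewrite gt_eqF// gsum_gt0.
Qed.

Lemma jcont_rsrc : jcont setT rsrc.
Proof. by apply: jcontM; [exact: jcont_recip|apply: jcont_time; exact: gsumV_continuous]. Qed.

Lemma rsrc_ge0 x t : 0 < t -> 0 <= rsrc x t.
Proof.
move=> t0; apply: mulr_ge0; first exact: le_trans (recip_ge1 _ t0).
by rewrite invr_ge0 ltW// gsum_gt0.
Qed.

Lemma rsrc_bounded T : 0 < T ->
  exists2 M, 0 < M & forall x t, 0 < t <= T -> rsrc x t <= M.
Proof.
move=> T0; have [M M1 MP] := v_sup T0; have M10 : 0 < 1 - M by rewrite subr_gt0.
exists (1 - M)^-1; first by rewrite invr_gt0.
move=> x t /andP[t0 tT]; rewrite /rsrc ler_pdivrMr ?gsum_gt0//.
rewrite (@le_trans _ _ (1 - M)^-1)//.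
  by rewrite lef_pV2 ?posrE ?omv_gt0// lerD2l lerN2 MP// t0.
by rewrite ler_peMr ?gsum_ge1// invr_ge0 ltW.
Qed.

(* [dstek] is the time derivative of the Steklov average [stek], [fstek] the
   average of the source, and [rhs] minus the Laplacian of [stek]. *)
Definition stek h x t := avg h (v x) t.
Definition dstek h x t := h^-1 * (v x (t + h) - v x t).
Definition fstek h x t := avg h (fun s => lam * rsrc x s ^+ 2) t.
Definition sqg h x t := \sum_i avg h (vi i x) t ^+ 2.
Definition nrg h t := 2^-1 * \int[mu]_(x in O) sqg h x t.
Definition dsq h t := \int[mu]_(x in O) (dstek h x t ^+ 2).

Lemma jcont_src : jcont setT (fun x t => lam * rsrc x t ^+ 2).
Proof.
apply: jcontM; [exact: jcont_cst|].
by apply: jcontM; exact: jcont_rsrc.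
Qed.

Lemma jcont_dstek h : 0 < h -> jcont setT (dstek h).
Proof.
move=> h0; apply: jcontM; first exact: jcont_cst.
by apply: jcontB => //; apply: jcont_shift => //; exact: ltW.
Qed.

Lemma jcont_stek h : 0 < h -> jcont setT (stek h).
Proof. by move=> h0; apply: jcont_avg => //; exact: openT. Qed.

Lemma jcont_fstek h : 0 < h -> jcont setT (fstek h).
Proof.
by move=> h0; apply: jcont_avg => //; [exact: openT|exact: jcont_src].
Qed.

Lemma cvx x t : 0 < t -> {for t, continuous (v x)}.
Proof. by move=> t0; exact: (jcont_t cv _ t0). Qed.

Lemma stek_itv h x t : 0 < h -> 0 < t -> 0 <= stek h x t <= 1.
Proof.
move=> h0 t0; apply: avg_itv => // [s s0|s /andP[ts _]]; first exact: cvx.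
by have /andP[-> /ltW ->] := v01 x (lt_le_trans t0 ts).
Qed.

Lemma stek_vanishing h t : 0 < h -> 0 < t -> vanishing O (stek h ^~ t).
Proof.
move=> h0 t0; split.
- by move=> x; exact: (jcont_x (jcont_stek h0) _ t0).
- by move=> x; case/andP : (stek_itv x h0 t0).
- move=> x nOx; rewrite /stek (_ : v x = cst 0); first exact: avg_cst.
  by apply/funext => s; exact: v0.
Qed.

Lemma stek_grad h t : 0 < h -> 0 < t ->
  grad_on O (stek h ^~ t) (fun i x => avg h (vi i x) t).
Proof.
move=> h0 t0 i x Ox; split; last exact: (jcont_x (jcont_avg oO h0 (@cvi i)) Ox t0).
apply: (is_derive_avg_space oO h0 t0 Ox) => //.
by apply: jcontW cv.
Qed.

Lemma stek_field h t : 0 < h -> 0 < t ->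
  field_on O (fun i x => avg h (vi i x) t) (fun i x => avg h (vii i x) t).
Proof.
move=> h0 t0 i x Ox; split.
- by apply: (is_derive_avg_space oO h0 t0 Ox).
- exact: (jcont_x (jcont_avg oO h0 (@cvi i)) Ox t0).
- exact: (jcont_x (jcont_avg oO h0 (@cvii i)) Ox t0).
Qed.

Lemma avg_sum (F : 'I_n -> R -> R) h t : 0 < h -> 0 < t ->
  (forall i t, 0 < t -> {for t, continuous (F i)}) ->
  avg h (fun s => \sum_i F i s) t = \sum_i avg h (F i) t.
Proof.
move=> h0 t0 cF; rewrite /avg -mulr_sumr; congr (_ * _).
have mI : measurable (`[t, t + h]%classic : set (measurableTypeR R)).
  exact: measurable_itv.
have iF i : leb.-integrable `[t, t + h] (EFin \o F i).
  apply: continuous_itv_integrable => s; apply: itv_cont_gt0 => //.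
  exact: cF.
exact: (Rintegral_bigsum (index_enum 'I_n) mI iF).2.
Qed.

(** Averaging turns [vt], which is controlled only inside [O], into a difference quotient of [v].
    The Laplacian of the average is thereby a combination of functions continuous across the
    boundary. *)
Lemma stek_lap h x t : 0 < h -> 0 < t -> O x ->
  \sum_i avg h (vii i x) t = dstek h x t - fstek h x t.
Proof.
move=> h0 t0 Ox.
have ct s : 0 < s -> {for s, continuous (vt x)} by move=> s0; exact: (jcont_t cvt Ox s0).
have cs s : 0 < s -> {for s, continuous (fun s => lam * rsrc x s ^+ 2)}.
  by move=> s0; exact: (jcont_t jcont_src _ s0).
have ci i s : 0 < s -> {for s, continuous (vii i x)}.
  by move=> s0; exact: (jcont_t (@cvii i) Ox s0).
rewrite -avg_sum//.
rewrite /dstek -(avg_derivative h0 t0 ct (fun s => @dvt x s Ox)).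
rewrite /fstek -avgB//; congr (h^-1 * _); apply: eq_Rintegral => s.
rewrite inE/= in_itv/= => /andP[ts _].
by rewrite eqn ?(lt_le_trans t0)// addrK.
Qed.

Definition rhs h x t := fstek h x t - dstek h x t.

Lemma jcont_rhs h : 0 < h -> jcont setT (rhs h).
Proof. by move=> h0; apply: jcontB; [exact: jcont_fstek|exact: jcont_dstek]. Qed.

Lemma sqg_continuous h t : 0 < h -> 0 < t -> forall x, O x ->
  {for x, continuous (sqg h ^~ t)}.
Proof.
move=> h0 t0 x Ox; apply: sum_continuous => i.
have c := jcont_x (jcont_avg oO h0 (@cvi i)) Ox t0.
exact: (cvgM c c).
Qed.

Lemma lap_bounded h t : 0 < h -> 0 < t -> exists2 C, 0 < C &
  forall x, O x -> `|\sum_i avg h (vii i x) t| <= C.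
Proof.
move=> h0 t0; have [M M0 MP] := jcont_boundedO bO t (jcont_rhs h0) t0.
exists M => // x Ox; rewrite stek_lap// -normrN opprB.
by apply: MP => //; rewrite lexx.
Qed.

Lemma sqg_integrable h t : 0 < h -> 0 < t ->
  mu.-integrable O (EFin \o (sqg h ^~ t)).
Proof.
move=> h0 t0; have [C C0 CP] := lap_bounded h0 t0.
apply: (vanishing_grad_integrable oO bO (stek_vanishing h0 t0)
  (stek_grad h0 t0) (stek_field h0 t0) _ CP (B := 1)).
by move=> x; case/andP : (stek_itv x h0 t0).
Qed.

(** The competitor [w] will be the average at another time, the solution at the initial time, or
    zero. *)
Lemma nrg_convex w wi h t : 0 < h -> 0 < t -> vanishing O w -> grad_on O w wi ->
  (forall x, w x <= 1) ->
  mu.-integrable O (EFin \o (fun x => \sum_i wi i x ^+ 2)) ->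
  nrg h t - 2^-1 * \int[mu]_(x in O) (\sum_i wi i x ^+ 2) <=
  \int[mu]_(x in O) ((stek h x t - w x) * rhs h x t).
Proof.
move=> h0 t0 vw gw w1 iw; have [C C0 CP] := lap_bounded h0 t0.
have := energy_convex oO bO (stek_vanishing h0 t0) (stek_grad h0 t0)
  (stek_field h0 t0) _ CP vw gw w1 iw.
move=> H; apply: le_trans (H _) _.
  by move=> x; case/andP : (stek_itv x h0 t0).
rewrite le_eqVlt; apply/orP; left; apply/eqP.
apply: eq_Rintegral => x; rewrite inE => Ox.
by rewrite stek_lap// /rhs; ring.
Qed.

Lemma nrg_le h s t : 0 < h -> 0 < s -> 0 < t ->
  nrg h t - nrg h s <= \int[mu]_(x in O) ((stek h x t - stek h x s) * rhs h x t).
Proof.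
move=> h0 s0 t0; apply: nrg_convex => //.
- exact: stek_vanishing.
- exact: stek_grad.
- by move=> x; case/andP : (stek_itv x h0 s0).
- exact: sqg_integrable.
Qed.

Lemma nrg_ge0 h t : 0 <= nrg h t.
Proof.
rewrite /nrg mulr_ge0// Rintegral_ge0// => x _.
by apply: sumr_ge0 => i _; exact: sqr_ge0.
Qed.

Lemma is_derive_stek h x t : 0 < h -> 0 < t ->
  is_derive t 1 (stek h x) (dstek h x t).
Proof. by move=> h0 t0; apply: is_derive_avg => // s; exact: cvx. Qed.

Lemma stek_rhs_integrable h s t t' : 0 < h -> 0 < s -> 0 < t -> 0 < t' ->
  mu.-integrable O (EFin \o (fun x => (stek h x t - stek h x s) * rhs h x t')).
Proof.
move=> h0 s0 t0 t'0.
have c : jcont setT (fun x (r : R) => (stek h x t - stek h x s) * rhs h x t').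
  move=> x r _ _; apply: (@continuous_comp _ _ _ fst
    (fun x => (stek h x t - stek h x s) * rhs h x t')); first exact: cvg_fst.
  have c1 := jcont_x (jcont_stek h0) (I : setT x) t0.
  have c2 := jcont_x (jcont_stek h0) (I : setT x) s0.
  have c3 := jcont_x (jcont_rhs h0) (I : setT x) t'0.
  exact: (cvgM (cvgB c1 c2) c3).
exact: (jcont_integrable oO bO c ltr01).
Qed.

Definition dnrg h t := \int[mu]_(x in O) (rhs h x t * dstek h x t).

Lemma jcont_dnrg h : 0 < h -> jcont setT (fun x t => rhs h x t * dstek h x t).
Proof. by move=> h0; apply: jcontM; [exact: jcont_rhs|exact: jcont_dstek]. Qed.

(** [nrg_le] with the two times in both orders traps the increment of [nrg h] between the integrals
    of [stek h x s - stek h x t] against [rhs] at time [t] and at time [s]. Both are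
    [(s - t) * dnrg h t] up to a small multiple of [|s - t|]; no mixed space-time derivative is
    involved. *)
Lemma is_derive_nrg h t : 0 < h -> 0 < t -> is_derive t 1 (nrg h) (dnrg h t).
Proof.
move=> h0 t0; apply: is_derive_dist => e e0.
have t20 : 0 < t / 2 by rewrite divr_gt0.
have t2t : t / 2 < t by rewrite gtr_pMr// invf_lt1// ltr1n.
have [C1 C10 C1P] := jcont_boundedO bO (t + 1) (jcont_rhs h0) t20.
have [C2 C20 C2P] := jcont_boundedO bO (t + 1) (jcont_dstek h0) t20.
(* Chosen because the integrands will differ by at most [(C1 + C2) * eta * |s - t|], where [C1]
   bounds [rhs] and [C2] bounds [dstek]. *)
pose eta := e / ((C1 + C2) * (m + 1)).
have m1 : 0 < m + 1 by rewrite ltr_wpDl.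
have D0 : 0 < (C1 + C2) * (m + 1) by rewrite mulr_gt0// addr_gt0.
have eta0 : 0 < eta by rewrite divr_gt0.
have [d1 d10 d1P] := jcont_uniformO bO (t + 1) (jcont_rhs h0) t20 eta0.
have [d2 d20 d2P] := jcont_uniformO bO (t + 1) (jcont_dstek h0) t20 eta0.
pose d := Num.min (Num.min d1 d2) (Num.min (t / 2) 1).
have d0 : 0 < d by rewrite /d !lt_min d10 d20 t20 ltr01.
have dP s : `|s - t| < d -> [/\ `|s - t| < d1, `|s - t| < d2, 0 < s &
    t / 2 <= s <= t + 1].
  rewrite /d !lt_min => /andP[/andP[A B] /andP[A1 B1]].
  by have [] := dist_half_itv t0 A1 B1.
have tt : t / 2 <= t <= t + 1 by rewrite (ltW t2t) lerDl ler01.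
exists d => // s sd; have [s1 s2 s0 st] := dP s sd.
have B1 x : O x -> `|rhs h x s - rhs h x t| <= eta.
  by move=> Ox; rewrite ltW// d1P.
have B2 x : O x -> `|stek h x s - stek h x t - (s - t) * dstek h x t| <= eta * `|s - t|.
  move=> Ox; apply: (@derivative_estimate _ _ (dstek h x) t d) => //.
    by move=> r rd; have [_ _ r0 _] := dP r rd; exact: is_derive_stek.
  by move=> r rd; have [_ r2 _ rt] := dP r rd; rewrite ltW// d2P.
have B3 x : O x -> `|stek h x s - stek h x t| <= C2 * `|s - t|.
  move=> Ox.
  have [st'|st'] := leP s t.
    have [|c /andP[sc ct] Fc] := itv_mvt st' (F := stek h x) (g := dstek h x).
      by move=> r /andP[sr _]; apply: is_derive_stek => //; exact: lt_le_trans sr.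
    rewrite distrC Fc normrM (distrC s) ler_wpM2r// C2P//.
    case/andP : st => ts _; case/andP : tt => _ tt1.
    by rewrite (le_trans ts sc) (le_trans ct tt1).
  have [|c /andP[sc ct] Fc] := itv_mvt (ltW st') (F := stek h x) (g := dstek h x).
    by move=> r /andP[sr _]; apply: is_derive_stek => //; exact: lt_le_trans sr.
  rewrite Fc normrM ler_wpM2r// C2P//.
  case/andP : st => _ st1; case/andP : tt => tt1 _.
  by rewrite (le_trans tt1 sc) (le_trans ct st1).
have ip : mu.-integrable O (EFin \o (fun x => (s - t) * (rhs h x t * dstek h x t))).
  exact: (integrableZl mO (s - t) (jcont_integrable oO bO (jcont_dnrg h0) t0)).
have ipE : \int[mu]_(x in O) ((s - t) * (rhs h x t * dstek h x t)) = (s - t) * dnrg h t.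
  by rewrite RintegralZl//; exact: (jcont_integrable oO bO (jcont_dnrg h0) t0).
(* Applied with [r = s] for the upper bound and with [r = t] for the lower one. *)
have K r : 0 < r -> (forall x, O x -> `|rhs h x r - rhs h x t| <= eta) ->
    `|\int[mu]_(x in O) ((stek h x s - stek h x t) * rhs h x r) - (s - t) * dnrg h t| <=
    e * `|s - t|.
  move=> r0 rP; rewrite -ipE.
  apply: (@le_trans _ _ (((C1 + C2) * eta * `|s - t|) * m)).
    apply: integral_dist_le => //; first exact: stek_rhs_integrable.
    move=> x Ox.
    rewrite (_ : _ - _ = (stek h x s - stek h x t) * (rhs h x r - rhs h x t) +
      rhs h x t * (stek h x s - stek h x t - (s - t) * dstek h x t)); last by ring.
    rewrite (le_trans (ler_normD _ _))// !normrM.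
    rewrite (_ : (C1 + C2) * _ * _ =
      C2 * `|s - t| * eta + C1 * (eta * `|s - t|)); last by ring.
    by apply: lerD; apply: ler_pM => //; [exact: B3|exact: rP|exact: C1P|exact: B2].
  rewrite /eta (_ : _ * m = e * `|s - t| * (m / (m + 1))); last first.
    by field; rewrite !gt_eqF// addr_gt0.
  by rewrite ler_piMr ?mulr_ge0// ?(ltW e0)// ler_pdivrMr// mul1r lerDl.
have U := nrg_le h0 t0 s0; have L := nrg_le h0 s0 t0.
have KU := K s s0 B1.
have KL : `|\int[mu]_(x in O) ((stek h x s - stek h x t) * rhs h x t) - (s - t) * dnrg h t| <=
    e * `|s - t|.
  by apply: K => // x Ox; rewrite subrr normr0 ltW.
have LE : \int[mu]_(x in O) ((stek h x t - stek h x s) * rhs h x t) =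
    - \int[mu]_(x in O) ((stek h x s - stek h x t) * rhs h x t).
  rewrite -[RHS]mulN1r -RintegralZl//; last exact: stek_rhs_integrable.
  by apply: eq_Rintegral => x _; ring.
apply: dist_squeeze U KU KL.
by rewrite -lerN2 opprB -LE.
Qed.

(** * The nonlocal source and the energy inequality *)

Definition fstar h x t := lam * (rsrc x t * rsrc x (t + h)).

Lemma jcont_fstar h : 0 < h -> jcont setT (fstar h).
Proof.
move=> h0; apply: jcontM; first exact: jcont_cst.
apply: jcontM; first exact: jcont_rsrc.
by apply: jcont_shift; [exact: ltW|exact: jcont_rsrc].
Qed.

Lemma integral_fstar_dstek h t : 0 < h -> 0 < t ->
  \int[mu]_(x in O) (fstar h x t * dstek h x t) =
  - (lam / chi) * (h^-1 * ((gsum (t + h))^-1 - (gsum t)^-1)).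
Proof.
move=> h0 t0; have th0 : 0 < t + h by rewrite addr_gt0.
have ir s : 0 < s -> mu.-integrable O (EFin \o (recip ^~ s)).
  by move=> s0; exact: (jcont_integrable oO bO jcont_recip s0).
pose c := lam * (gsum t)^-1 * (gsum (t + h))^-1 * h^-1.
transitivity (\int[mu]_(x in O) (c * (recip x (t + h) - recip x t))).
  apply: eq_Rintegral => x _; rewrite /fstar /dstek /rsrc /c /recip.
  have a := omv_gt0 x t0; have b := omv_gt0 x th0.
  have g1 := gsum_gt0 t0; have g2 := gsum_gt0 th0.
  move: (v x t) (v x (t + h)) (gsum t) (gsum (t + h)) a b g1 g2.
  by move=> p q r s a b g1 g2; field; rewrite !gt_eqF.
rewrite RintegralZl//; last exact: (integrableB mO (ir _ th0) (ir _ t0)).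
rewrite RintegralB//; [|exact: ir..].
(* The 1 in [gsum] cancels in the difference; division by both values of [gsum] then leaves the
   difference of their reciprocals with opposite sign. *)
have -> : \int[mu]_(x in O) recip x (t + h) - \int[mu]_(x in O) recip x t =
    chi^-1 * (gsum (t + h) - gsum t).
  by rewrite /gsum; field; rewrite gt_eqF.
have g1 := gsum_gt0 t0; have g2 := gsum_gt0 th0.
by rewrite /c; field; rewrite !gt_eqF.
Qed.

(** For [s] in the averaging window, r(s)^2 - r(t) r(t+h) = r(s) (r(s) - r(t)) + r(t) (r(s) -
    r(t+h)), and each difference is small by uniform continuity. The two terms account for the
    factor 2 in [w]. *)
Lemma fstek_fstar t0 T e : 0 < t0 -> 0 < e -> exists2 d, 0 < d &
  forall h x t, 0 < h < d -> O x -> t0 <= t <= T ->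
  `|fstek h x t - fstar h x t| <= e.
Proof.
move=> t00 e0.
have [M M0 MP] := jcont_boundedO bO (T + 1) jcont_rsrc t00.
pose w := e / (2 * M * lam).
have w0 : 0 < w by rewrite divr_gt0// !mulr_gt0.
have [d d0 dP] := jcont_uniformO bO (T + 1) jcont_rsrc t00 w0.
exists (Num.min d 1); first by rewrite lt_min d0 ltr01.
move=> h x t /andP[h0]; rewrite lt_min => /andP[hd h1] Ox /andP[tt tT].
have t0' : 0 < t by exact: lt_le_trans tt.
apply: avg_dist => // [s s0|s /andP[ts sth]]; first exact: (jcont_t jcont_src _ s0).
have I1 : t0 <= s <= T + 1.
  by rewrite (le_trans tt)//= (le_trans sth)// lerD// ltW.
have I2 : t0 <= t <= T + 1 by rewrite tt/= (le_trans tT)// lerDl.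
have A1 : `|rsrc x s - rsrc x t| <= w.
  rewrite ltW// dP//; apply: le_lt_trans hd.
  by rewrite ger0_norm ?subr_ge0// lerBlDl.
have A2 : `|rsrc x s - rsrc x (t + h)| <= w.
  rewrite ltW// dP//; apply: le_lt_trans hd.
  by rewrite ler0_norm ?subr_le0// opprB lerBlDl lerD2r.
rewrite /fstar -mulrBr normrM (gtr0_norm lam0).
rewrite (_ : _ - _ = rsrc x s * (rsrc x s - rsrc x t) +
  rsrc x t * (rsrc x s - rsrc x (t + h))); last by ring.
apply: (@le_trans _ _ (lam * (M * w + M * w))).
  rewrite ler_pM2l// (le_trans (ler_normD _ _))// !normrM.
  apply: lerD; apply: ler_pM => //; rewrite -normrM.
    exact: (MP _ _ Ox I1).
  exact: (MP _ _ Ox I2).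
by rewrite le_eqVlt; apply/orP; left; apply/eqP; rewrite /w; field; rewrite !gt_eqF.
Qed.

Lemma dsq_ge0 h t : 0 <= dsq h t.
Proof. by apply: Rintegral_ge0 => x _; exact: sqr_ge0. Qed.

Lemma jcont_dsq h : 0 < h -> jcont setT (fun x t => dstek h x t ^+ 2).
Proof. by move=> h0; apply: jcontM; exact: jcont_dstek. Qed.

Lemma dsq_continuous h t : 0 < h -> 0 < t -> {for t, continuous (dsq h)}.
Proof.
by move=> h0 t0; exact: (jcont_integral_continuous oO bO (jcont_dsq h0) t0).
Qed.

(** Write F, f, D for the values of [fstek], [fstar], [dstek]. Then (F - D) D = (F - f) D + f D -
    D^2, and (F - f) D <= e |D| <= e (D^2 + 1); the integral of f D is known exactly. *)
Lemma dnrg_le h t e : 0 < h -> 0 < t -> 0 < e ->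
  (forall x, O x -> `|fstek h x t - fstar h x t| <= e) ->
  dnrg h t <= - (1 - e) * dsq h t -
    (lam / chi) * (h^-1 * ((gsum (t + h))^-1 - (gsum t)^-1)) + e * m.
Proof.
move=> h0 t0 e0 fe.
have i1 := jcont_integrable oO bO (jcont_dsq h0) t0.
have i2 := jcont_integrable oO bO (jcontM (jcont_fstar h0) (jcont_dstek h0)) t0.
have i3 := jcont_integrable oO bO (@jcont_cst _ _ setT e) t0.
have i1' : mu.-integrable O (EFin \o (fun x => - (1 - e) * dstek h x t ^+ 2)).
  exact: (integrableZl mO (- (1 - e)) i1).
have i12 : mu.-integrable O (EFin \o (fun x =>
    - (1 - e) * dstek h x t ^+ 2 + fstar h x t * dstek h x t)).
  exact: (integrableD mO i1' i2).
rewrite -mulNr -(integral_fstar_dstek h0 t0) -(Rintegral_cst mu mO).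
rewrite -RintegralZl// -RintegralD// -RintegralD//.
apply: le_Rintegral => //.
- exact: (jcont_integrable oO bO (jcont_dnrg h0) t0).
- exact: (integrableD mO i12 i3).
move=> x Ox; have := fe x Ox; rewrite /rhs.
move: (fstek h x t) (fstar h x t) (dstek h x t) => F f D.
rewrite ler_norml => /andP[a b].
have Dm : `|D| <= D ^+ 2 + 1 by rewrite ler_norml; apply/andP; split; nra.
have : (F - f) * D <= e * `|D|.
  rewrite (le_trans (ler_norm _))// normrM ler_wpM2r// ler_norml a b//.
move=> FD; have : e * `|D| <= e * (D ^+ 2 + 1) by rewrite ler_pM2l.
move=> H; lra.
Qed.

(** [dnrg_le] says that [Z] has nonpositive derivative: the time average [A] of the reciprocal of
    [gsum] has exactly the required difference quotient as its derivative, and [Q] is a primitive of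
    [dsq h]. The claim compares [Z] at the two ends. *)
Lemma energy_ineq t0 T e : 0 < t0 -> t0 <= T -> 0 < e ->
  exists2 d, 0 < d & forall h, 0 < h < d ->
  nrg h T + (1 - e) * \int[leb]_(t in `[t0, T]) dsq h t <=
  nrg h t0 + lam / (chi * (1 + chi * m)) + e * m * (T - t0).
Proof.
move=> t00 t0T e0; have [d d0 dP] := fstek_fstar T t00 e0.
exists d => // h hd; have /andP[h0 _] := hd.
pose a := t0 / 2.
have a0 : 0 < a by rewrite divr_gt0.
have at0 : a < t0 by rewrite gtr_pMr// invf_lt1// ltr1n.
have cd s b : a <= s <= b -> {for s, continuous (dsq h)}.
  by move=> /andP[as_ _]; apply: dsq_continuous => //; exact: lt_le_trans as_.
pose Q (y : R) := \int[leb]_(s in `[a, y]) dsq h s.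
have dQ t : t0 <= t <= T -> is_derive t 1 Q (dsq h t).
  move=> /andP[tt tT]; apply: (@is_derive_primitive _ _ _ (T + 1)).
    by rewrite (lt_le_trans at0)//= (le_lt_trans tT)// ltrDl.
  by move=> s; exact: cd.
have gpos t : t0 <= t <= T -> 0 < t by move=> /andP[tt _]; exact: lt_le_trans tt.
pose A := avg h (fun t => (gsum t)^-1).
pose Z := (nrg h + (lam / chi) *: A + (1 - e) *: Q + (- (e * m)) *: id).
pose Z' t := dnrg h t + (lam / chi) *: (h^-1 * ((gsum (t + h))^-1 - (gsum t)^-1)) +
  (1 - e) *: dsq h t + (- (e * m)) *: 1.
have dZ t : t0 <= t <= T -> is_derive t 1 Z (Z' t).
  move=> tt; have t0' := gpos t tt.
  have e1 := is_derive_nrg h0 t0'.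
  have e2 : is_derive t 1 A (h^-1 * ((gsum (t + h))^-1 - (gsum t)^-1)).
    by apply: is_derive_avg => //; exact: gsumV_continuous.
  have e3 := dQ t tt.
  exact: (is_deriveD (is_deriveD (is_deriveD e1 (is_deriveZ (lam / chi) e2))
    (is_deriveZ (1 - e) e3)) (is_deriveZ (- (e * m)) (is_derive_id t (1 : R)))).
have Z'0 t : t0 <= t <= T -> Z' t <= 0.
  move=> tt; have t0' := gpos t tt.
  have := dnrg_le h0 t0' e0 (fun x Ox => dP h x t hd Ox tt).
  rewrite /Z' /GRing.scale/= mulr1.
  move: (dnrg h t) (dsq h t) (lam / chi * _) (e * m) => p q r s H.
  by move: H; rewrite mulNr; lra.
have := derive_le0_le t0T dZ Z'0.
have QE : Q T = Q t0 + \int[leb]_(t in `[t0, T]) dsq h t.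
  by apply: integral_itv_cat => //; [exact: ltW|move=> s; exact: cd].
have ZE y : Z y = nrg h y + lam / chi * A y + (1 - e) * Q y + - (e * m) * y.
  by [].
rewrite !ZE QE.
have T0 : 0 < T by exact: lt_le_trans t0T.
(* The value at [T] is dropped and the value at [t0] is at most [(1 + chi * m)^-1]; this is where
   the constant of the theorem arises. *)
have AT : 0 <= A T.
  have /andP[] // : 0 <= A T <= 1.
  apply: avg_itv => // [s s0|s /andP[Ts _]]; first exact: gsumV_continuous.
  have s0 : 0 < s by exact: lt_le_trans Ts.
  by rewrite invr_ge0 invf_le1 ?gsum_gt0// gsum_ge1// ltW ?gsum_gt0.
have A0 : A t0 <= (1 + chi * m)^-1.
  have /andP[] // : 0 <= A t0 <= (1 + chi * m)^-1.
  apply: avg_itv => // [s s0|s /andP[Ts _]]; first exact: gsumV_continuous.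
  have s0 : 0 < s by exact: lt_le_trans Ts.
  rewrite invr_ge0 ltW ?gsum_gt0//= lef_pV2 ?posrE ?gsum_gt0 ?gsum_ge//.
  by rewrite ltr_wpDr// mulr_ge0// ltW.
have lc : 0 < lam / chi by rewrite divr_gt0.
have K1 : 0 <= lam / chi * A T by rewrite mulr_ge0// ltW.
have K2 : lam / chi * A t0 <= lam / (chi * (1 + chi * m)).
  rewrite [leRHS](_ : _ = lam / chi * (1 + chi * m)^-1); last by rewrite invfM mulrA.
  by rewrite ler_pM2l.
move: K1 K2.
move: (lam / chi * A T) (lam / chi * A t0) (lam / (chi * (1 + chi * m)))
  (nrg h T) (nrg h t0) (Q t0) (\int[leb]_(t in `[t0, T]) dsq h t) (e * m).
by move=> *; nra.
Qed.

(** * Averages and energy near time zero *)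

Definition mass t := \int[mu]_(x in O) v x t.

(** The starting point [a] will be positive, because nothing is known about [v] at time 0. *)
Definition prim (a : R) x (y : R) := \int[leb]_(s in `[a, y]) v x s.

Lemma prim_stek (a : R) x (y : R) : a < y -> prim a x y = (y - a) * stek (y - a) x a.
Proof.
move=> ay; rewrite /stek /avg mulrA divff ?mul1r ?subrKC//.
by rewrite gt_eqF// subr_gt0.
Qed.

Lemma prim_continuous (a y : R) x : 0 < a -> a < y ->
  {for x, continuous (fun x => prim a x y)}.
Proof.
move=> a0 ay; have -> : (fun x => prim a x y) = (fun x => (y - a) * stek (y - a) x a).
  by apply/funext => z; exact: prim_stek.
have ya : 0 < y - a by rewrite subr_gt0.
exact: (cvgM (cvg_cst (y - a)) (jcont_x (jcont_stek ya) (I : setT x) a0)).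
Qed.

Lemma is_derive_prim (a : R) x (y : R) : 0 < a -> a < y -> is_derive y 1 (prim a x) (v x y).
Proof.
move=> a0 ay; apply: (@is_derive_primitive _ _ _ (y + 1)).
  by rewrite ay ltrDl ltr01.
by move=> s /andP[as_ _]; apply: cvx; exact: lt_le_trans as_.
Qed.

Lemma primB (a : R) x s h : 0 < a -> a < s -> 0 < h ->
  prim a x (s + h) - prim a x s = h * stek h x s.
Proof.
move=> a0 as_ h0; rewrite /prim (@integral_itv_cat _ _ _ (s + h) s) ?ltW//.
- rewrite addrC addKr /stek /avg mulrA divff ?mul1r//.
  by rewrite gt_eqF.
- by rewrite ltrDl.
- by move=> r /andP[ar _]; apply: cvx; exact: lt_le_trans ar.
Qed.

(** The spatial integral of [prim] has derivative [mass], so by the mean value theorem the integral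
    of the average equals [mass] at some time of the window; no exchange of integrals is
    required. *)
Lemma integral_stek_le h s e : 0 < h -> 0 < s ->
  (forall t, s <= t <= s + h -> mass t <= e) ->
  \int[mu]_(x in O) stek h x s <= e.
Proof.
move=> h0 s0 me; have s20 : 0 < s / 2 by rewrite divr_gt0.
have s2s : s / 2 < s by rewrite gtr_pMr// invf_lt1// ltr1n.
have ssh : s < s + h by rewrite ltrDl.
have ip y : s / 2 < y -> mu.-integrable O (EFin \o (fun x => prim (s / 2) x y)).
  by move=> sy; apply: (continuous_integrable oO bO) => x; exact: prim_continuous.
have dW y : s <= y <= s + h ->
    is_derive y 1 (fun y => \int[mu]_(x in O) prim (s / 2) x y) (mass y).
  move=> /andP[sy _]; apply: (is_derive_integral oO bO s20) => //.
    exact: lt_le_trans sy.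
  by move=> x r _; exact: is_derive_prim.
have [c csh Wc] := itv_mvt (ltW ssh) dW.
have iU : mu.-integrable O (EFin \o (stek h ^~ s)).
  exact: (jcont_integrable oO bO (jcont_stek h0) s0).
have E : \int[mu]_(x in O) prim (s / 2) x (s + h) -
    \int[mu]_(x in O) prim (s / 2) x s = h * \int[mu]_(x in O) stek h x s.
  rewrite -RintegralB//; [|apply: ip; exact: lt_trans ssh|exact: ip].
  by rewrite -RintegralZl//; apply: eq_Rintegral => x _; exact: primB.
move: Wc; rewrite E addrAC subrr add0r mulrC => /(mulIf (lt0r_neq0 h0)) ->.
exact: me.
Qed.

Lemma rsrc_sqr_le x t M : 0 < t -> rsrc x t <= M -> lam * rsrc x t ^+ 2 <= lam * M ^+ 2.
Proof.
by move=> t0 rM; rewrite ler_pM2l// ler_sqr ?nnegrE ?rsrc_ge0// (le_trans _ rM)// rsrc_ge0.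
Qed.

Lemma fstek_bounded T : 0 < T -> exists2 C, 0 < C & forall h x t,
  0 < h < 1 -> 0 < t <= T -> 0 <= fstek h x t <= C.
Proof.
move=> T0; have T10 : 0 < T + 1 by rewrite addr_gt0.
have [M M0 MP] := rsrc_bounded T10.
exists (lam * M ^+ 2); first by rewrite mulr_gt0// exprn_gt0.
move=> h x t /andP[h0 h1] /andP[t0 tT]; apply: avg_itv => // [s s0|s /andP[ts sth]].
  exact: (jcont_t jcont_src _ s0).
have s0 : 0 < s by exact: lt_le_trans ts.
rewrite mulr_ge0 ?(ltW lam0) ?sqr_ge0//= rsrc_sqr_le// MP// s0/=.
by rewrite (le_trans sth)// lerD// ltW.
Qed.

(** The integrand of [dnrg] is F D - D^2 with F = [fstek] and D = [dstek], hence at most F^2. The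
    constant is independent of [h], so energy bounds at very small times carry over to later
    ones. *)
Lemma nrg_growth T : 0 < T -> exists2 C, 0 < C & forall h s t,
  0 < h < 1 -> 0 < s -> s <= t <= T -> nrg h t <= nrg h s + C * (t - s).
Proof.
move=> T0; have [C C0 CP] := fstek_bounded T0.
have m1 : 0 < m + 1 by rewrite ltr_wpDl.
exists (C ^+ 2 * (m + 1)); first by rewrite mulr_gt0// exprn_gt0.
move=> h s t h01 s0 /andP[st tT]; have /andP[h0 h1] := h01.
have rpos r : s <= r -> 0 < r by move=> sr; exact: lt_le_trans sr.
pose k : R := C ^+ 2 * (m + 1).
pose Z := (nrg h + (- k) *: id).
have dZ r : s <= r <= t -> is_derive r 1 Z (dnrg h r + (- k) *: 1).
  move=> /andP[sr _].
  exact: (is_deriveD (is_derive_nrg h0 (rpos r sr))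
    (is_deriveZ (- k) (is_derive_id r (1 : R)))).
have : Z t <= Z s.
  apply: (derive_le0_le st dZ) => r /andP[sr rt]; have r0 := rpos r sr.
  rewrite /GRing.scale/= mulr1 subr_le0 /k.
  apply: (@le_trans _ _ (C ^+ 2 * m)); last first.
    by rewrite ler_pM2l ?exprn_gt0// lerDl.
  rewrite -(Rintegral_cst mu mO); apply: le_Rintegral => //.
  - exact: (jcont_integrable oO bO (jcont_dnrg h0) r0).
  - exact: (jcont_integrable oO bO (@jcont_cst _ _ setT _) r0).
  move=> x Ox; rewrite /rhs.
  have rT : 0 < r <= T by rewrite r0 (le_trans rt).
  have /andP[] := CP h x r h01 rT; move: (fstek h x r) (dstek h x r) => F D F0 FC.
  have : F ^+ 2 <= C ^+ 2 by rewrite ler_sqr ?nnegrE// ltW.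
  move=> H; apply: le_trans H; nra.
have ZE y : Z y = nrg h y + - k * y by [].
by rewrite !ZE -/k !mulNr lerBlDr mulrBr (addrC (k * t)) addrA.
Qed.

(** Convexity with the competitor 0. In the term with [dstek], the value of [v] at [s + h] has the
    favourable sign, and [stek] is at most 1, which leaves [h^-1 * mass s]. *)
Lemma nrg_start T : 0 < T -> exists2 C, 0 < C & forall h s e,
  0 < h < 1 -> 0 < s <= T -> (forall t, s <= t <= s + h -> mass t <= e) ->
  nrg h s <= C * e + h^-1 * mass s.
Proof.
move=> T0; have [C C0 CP] := fstek_bounded T0; exists C => // h s e h01 sT me.
have /andP[h0 h1] := h01; have /andP[s0 _] := sT.
have iU : mu.-integrable O (EFin \o (stek h ^~ s)).
  exact: (jcont_integrable oO bO (jcont_stek h0) s0).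
have iv : mu.-integrable O (EFin \o (v ^~ s)).
  exact: (jcont_integrable oO bO cv s0).
have iCU : mu.-integrable O (EFin \o (fun x => C * stek h x s)).
  exact: (integrableZl mO C iU).
have ihv : mu.-integrable O (EFin \o (fun x => h^-1 * v x s)).
  exact: (integrableZl mO h^-1 iv).
have : nrg h s <= \int[mu]_(x in O) ((stek h x s - 0) * rhs h x s).
  have := @nrg_convex (cst 0) (fun=> cst 0) h s h0 s0.
  have E : (fun x => \sum_(i < n) (cst 0 : 'rV[R]_n -> R) x ^+ 2) = cst 0.
    by apply/funext => x; apply: big1 => i _; rewrite expr0n.
  rewrite E Rintegral_cst// mul0r mulr0 subr0; apply.
  - by split => // x; exact: cst_continuous.
  - move=> i x Ox; split; last exact: cst_continuous.
    exact: is_derive_cst.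
  - by move=> x; exact: ler01.
  - exact: integrable0.
move=> /le_trans; apply.
apply: (@le_trans _ _ (C * \int[mu]_(x in O) stek h x s + h^-1 * mass s)); last first.
  by rewrite lerD2r ler_pM2l//; exact: integral_stek_le.
rewrite /mass -!RintegralZl// -RintegralD//.
apply: le_Rintegral => //.
- apply: (continuous_integrable oO bO) => x.
  have c1 := jcont_x (jcont_stek h0) (I : setT x) s0.
  have c2 := jcont_x (jcont_rhs h0) (I : setT x) s0.
  exact: (cvgM (cvgB c1 (cvg_cst (0 : R))) c2).
- exact: (integrableD mO iCU ihv).
move=> x Ox; rewrite subr0 /rhs /dstek.
have /andP[F0 FC] := CP h x s h01 sT; have /andP[U0 U1] := stek_itv x h0 s0.
have /andP[v0s _] := v01 x s0.
have /andP[v0h _] := v01 x (addr_gt0 s0 h0).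
have hi : 0 < h^-1 by rewrite invr_gt0.
rewrite mulrBr lerD//; first by rewrite mulrC ler_wpM2r.
rewrite -mulrN -mulrN opprB mulrCA ler_pM2l//.
apply: (@le_trans _ _ (stek h x s * v x s)); first by rewrite ler_wpM2l// gerBl.
by rewrite ler_piMl.
Qed.

(** * Removing the averages by Fatou's lemma *)

Definition sqv x t := \sum_i vi i x t ^+ 2.

Lemma sqg_cvg (h_ : R^nat) x t : O x -> 0 < t -> (forall k, 0 < h_ k) ->
  h_ @ \oo --> 0 -> sqg (h_ k) x t @[k --> \oo] --> sqv x t.
Proof.
move=> Ox t0 h0 h_0.
have c i : avg (h_ k) (vi i x) t @[k --> \oo] --> vi i x t.
  apply/cvgrPdist_le => e e0.
  have ci s : 0 < s -> {for s, continuous (vi i x)}.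
    by move=> s0; exact: (jcont_t (@cvi i) Ox s0).
  have [d d0 dP] := avg_cvg t0 ci e0.
  near=> k; rewrite distrC; apply: dP; rewrite h0/=.
  near: k; have := iffLR (cvgrPdist_lt _ _) h_0 d => /(_ _ d0).
  by apply: filterS => k; rewrite sub0r normrN gtr0_norm.
have c2 i : avg (h_ k) (vi i x) t ^+ 2 @[k --> \oo] --> vi i x t ^+ 2.
  exact: (cvgM (c i) (c i)).
rewrite /sqg /sqv; elim: (index_enum 'I_n) => [|i r IHr].
  rewrite big_nil (_ : (fun k => _) = cst 0); first exact: cvg_cst.
  by apply/funext => k; rewrite big_nil.
rewrite big_cons (_ : (fun k => _) = (fun k => avg (h_ k) (vi i x) t ^+ 2 +
  \sum_(j <- r) avg (h_ k) (vi j x) t ^+ 2)); first exact: (cvgD (c2 i) IHr).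
by apply/funext => k; rewrite big_cons.
Unshelve. all: by end_near. Qed.

Lemma dstek_cvg (h_ : R^nat) x t : O x -> 0 < t -> (forall k, 0 < h_ k) ->
  h_ @ \oo --> 0 -> dstek (h_ k) x t @[k --> \oo] --> vt x t.
Proof.
move=> Ox t0 h0 h_0; have [dv Dv] := dvt Ox t0.
have /cvgr_dnbhsP H : h^-1 *: ((v x \o shift t) (h *: (1 : R)) - v x t)
    @[h --> 0^'] --> vt x t.
  by rewrite -Dv; exact: dv.
have := H h_ (conj (fun k => lt0r_neq0 (h0 k)) h_0).
rewrite (_ : (fun k => _) = (fun k => dstek (h_ k) x t))//.
by apply/funext => k; rewrite /dstek /= /GRing.scale/= mulr1 (addrC t).
Qed.

Lemma sqg_measurable h t : 0 < h -> 0 < t -> measurable_fun O (sqg h ^~ t).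
Proof.
by move=> h0 t0; apply: open_continuous_measurable_rV => // x; exact: sqg_continuous.
Qed.

(** Stated in the extended reals, since the gradient of [v] at time [T] is not known in advance to
    be square integrable. *)
Lemma nrg_fatou (h_ : R^nat) T : 0 < T -> (forall k, 0 < h_ k) -> h_ @ \oo --> 0 ->
  ((2^-1)%:E * \int[mu]_(x in O) (sqv x T)%:E <=
   limn_einf (fun k => (nrg (h_ k) T)%:E))%E.
Proof.
move=> T0 h0 h_0.
have sq0 h x : 0 <= sqg h x T by apply: sumr_ge0 => i _; exact: sqr_ge0.
have sv0 x : 0 <= sqv x T by apply: sumr_ge0 => i _; exact: sqr_ge0.
have mv : measurable_fun O (fun x => (sqv x T)%:E).
  apply/measurable_EFinP; apply: open_continuous_measurable_rV => // x Ox.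
  apply: sum_continuous => i.
  have c := jcont_x (@cvi i) Ox T0; exact: (cvgM c c).
rewrite -ge0_integralZl//; last by move=> x _; rewrite lee_fin.
have -> : (fun k => (nrg (h_ k) T)%:E) =
    (fun k => \int[mu]_(x in O) (2^-1 * sqg (h_ k) x T)%:E)%E.
  apply/funext => k; have i2 := sqg_integrable (h0 k) T0.
  rewrite /nrg -RintegralZl// /Rintegral fineK//.
  by apply: integrable_fin_num => //; exact: (integrableZl mO 2^-1 i2).
apply: (@fatou_cvg _ _ _ mu O (fun k x => 2^-1 * sqg (h_ k) x T)) => //.
- by move=> k; apply: measurable_funM => //; exact: sqg_measurable.
- by move=> k x Ox; rewrite mulr_ge0.
- move=> x Ox; exact: (cvgM (cvg_cst (2^-1 : R)) (sqg_cvg Ox T0 h0 h_0)).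
Qed.

(** Fatou's lemma in space at each fixed time, then in time. The starting times may vary with [k];
    it is enough that each time of [J] eventually lies in [[s_ k, T]]. *)
Lemma vt_fatou (s_ h_ : R^nat) T (J : set (measurableTypeR R)) : measurable J ->
  J `<=` `]0, T] -> (forall t, J t -> \forall k \near \oo, s_ k <= t) ->
  (forall k, 0 < s_ k <= T) -> (forall k, 0 < h_ k) -> h_ @ \oo --> 0 ->
  (\int[leb]_(t in J) \int[mu]_(x in O) (vt x t ^+ 2)%:E <=
   limn_einf (fun k => (\int[leb]_(t in `[s_ k, T]) dsq (h_ k) t)%:E))%E.
Proof.
move=> mJ JT sJ s0 h0 h_0.
have J0 t : J t -> 0 < t by move=> /JT; rewrite /= in_itv/= => /andP[].
pose I k : set (measurableTypeR R) := `[s_ k, T]%classic.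
have mI k : measurable (I k) by exact: measurable_itv.
have iA k : leb.-integrable (I k) (EFin \o dsq (h_ k)).
  apply: continuous_itv_integrable => t /andP[st _]; apply: dsq_continuous => //.
  by apply: lt_le_trans st; case/andP : (s0 k).
(* Extension by zero outside [I k] puts all integrands on the fixed set [J]. *)
pose a k := dsq (h_ k) \_ (I k).
have a0 k t : 0 <= a k t.
  by rewrite /a patchE; case: ifPn => // _; exact: dsq_ge0.
have ma k : measurable_fun setT (a k).
  apply/(measurable_restrictT _ (mI k)).
  by case/integrableP : (iA k) => /measurable_EFinP.
apply: (@le_trans _ _ (\int[leb]_(t in J) limn_einf (fun k => (a k t)%:E))%E).
  apply: ge0_le_integralT => t Jt.
    by apply: integral_ge0 => x _; rewrite lee_fin sqr_ge0.
  have t0 := J0 t Jt.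
  apply: (le_trans (@fatou_cvg _ _ _ mu O (fun k x =>
    if t \in I k then dstek (h_ k) x t ^+ 2 else 0) _ mO _ _ _)).
  - move=> k; case: (t \in I k); last exact: measurable_cst.
    apply: open_continuous_measurable_rV => // x Ox.
    exact: (jcont_x (jcont_dsq (h0 k)) _ t0).
  - by move=> k x Ox; case: ifPn => // _; exact: sqr_ge0.
  - move=> x Ox.
    have c : dstek (h_ k) x t ^+ 2 @[k --> \oo] --> vt x t ^+ 2.
      have c1 := dstek_cvg Ox t0 h0 h_0; exact: (cvgM c1 c1).
    apply: cvg_trans c; apply: near_eq_cvg.
    have : \forall k \near \oo, s_ k <= t by exact: sJ.
    apply: filterS => k kt; rewrite ifT// inE /I/= in_itv/= kt/=.
    by have := JT t Jt; rewrite /= in_itv/= => /andP[].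
  rewrite le_eqVlt; apply/orP; left; apply/eqP; congr limn_einf; apply/funext => k.
  rewrite /a patchE; case: ifPn => _; last by rewrite integral0.
  rewrite /dsq /Rintegral fineK//; apply: integrable_fin_num => //.
  exact: (jcont_integrable oO bO (jcont_dsq (h0 k)) t0).
apply: (le_trans (fatou _ mJ _ _)).
- by move=> k; apply/measurable_EFinP; exact: measurable_funTS.
- by move=> k t _; rewrite lee_fin.
apply: le_limn_einf => k.
have -> : (\int[leb]_(t in J) (a k t)%:E = \int[leb]_(t in J `&` I k) (dsq (h_ k) t)%:E)%E.
  by rewrite integral_mkcondr restrict_EFin.
rewrite /Rintegral fineK; last by apply: integrable_fin_num => //; exact: iA.
apply: ge0_subset_integral => //.
- exact: measurableI.
- by case/integrableP : (iA k).
- by move=> t _; rewrite lee_fin dsq_ge0.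
Qed.
Definition ebound := lam / (chi * (1 + chi * m)).

Lemma ebound_ge0 : 0 <= ebound.
Proof.
by rewrite /ebound divr_ge0 ?(ltW lam0)// mulr_ge0 ?(ltW chi0)// addr_ge0// mulr_ge0// ltW.
Qed.

(** Covers both estimates: a constant sequence [s_] for the one from [t0], and one tending to 0 for
    the one from time 0. *)
Lemma energy_limit T (J : set (measurableTypeR R)) (s_ h_ e_ : R^nat) E :
  0 < T -> measurable J -> J `<=` `]0, T] ->
  (forall t, J t -> \forall k \near \oo, s_ k <= t) ->
  (forall k, 0 < s_ k <= T) -> (forall k, 0 < h_ k) -> h_ @ \oo --> 0 ->
  e_ @ \oo --> 0 ->
  (forall k, nrg (h_ k) T + \int[leb]_(t in `[s_ k, T]) dsq (h_ k) t <= E + e_ k) ->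
  (\int[leb]_(t in J) \int[mu]_(x in O) (vt x t ^+ 2)%:E +
   (2^-1)%:E * \int[mu]_(x in O) (sqv x T)%:E <= E%:E)%E.
Proof.
move=> T0 mJ JT sJ s0 h0 h_0 e_0 H.
have F1 := vt_fatou mJ JT sJ s0 h0 h_0.
have F2 := nrg_fatou T0 h0 h_0.
apply: (le_trans (leeD F1 F2)).
apply: (le_trans (limn_einf_leD _ _)).
- by move=> k; rewrite lee_fin Rintegral_ge0// => t _; exact: dsq_ge0.
- by move=> k; rewrite lee_fin nrg_ge0.
have c : (E + e_ k)%:E @[k --> \oo] --> E%:E.
  apply: cvg_EFin; first exact: nearW.
  by rewrite -[X in _ --> X]addr0; apply: cvgD; [exact: cvg_cst|exact: e_0].
rewrite -(cvg_limn_einf_sup c).1; apply: le_limn_einf => k.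
by rewrite -EFinD lee_fin addrC H.
Qed.

(** [E] is fixed before [h], so the threshold [d] does not depend on the energy of the average at
    [t0]. *)
Lemma energy_step t0 T E e : 0 < t0 -> t0 <= T -> 0 <= E -> 0 < e ->
  exists2 d, 0 < d & forall h, 0 < h < d -> nrg h t0 <= E ->
  nrg h T + \int[leb]_(t in `[t0, T]) dsq h t <= E + ebound + e.
Proof.
move=> t00 t0T E0 e0.
have M0 : 0 <= m * (T - t0) by rewrite mulr_ge0// subr_ge0.
have [c c0 cP] := absorb_error E0 ebound_ge0 M0 e0.
have [d d0 dP] := energy_ineq t00 t0T c0.
exists d => // h hd nE; apply: cP; first exact: nrg_ge0.
  by rewrite Rintegral_ge0// => t _; exact: dsq_ge0.
by rewrite (le_trans (dP h hd))// mulrA lerD2r lerD2r.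
Qed.

(** * The energy of the averages at a positive initial time *)

Lemma v_grad t : 0 < t -> grad_on O (v ^~ t) (fun i => vi i ^~ t).
Proof. by move=> t0 i x Ox; split; [exact: dvi|exact: (jcont_x (@cvi i) Ox t0)]. Qed.

Lemma v_vanishing t : 0 < t -> vanishing O (v ^~ t).
Proof.
move=> t0; split.
- by move=> x; exact: (jcont_x cv _ t0).
- by move=> x; case/andP : (v01 x t0).
- by move=> x; exact: v0.
Qed.

Lemma prim_lip (a : R) x (y z : R) : 0 < a -> a < y -> a < z ->
  `|prim a x y - prim a x z| <= `|y - z|.
Proof.
move=> a0; wlog zy : y z / z <= y.
  move=> H ay az; have [zy|/ltW yz] := leP z y; first exact: H.
  by rewrite distrC (distrC y); exact: H.
move=> ay az.
have [|c /andP[zc cy] ->] := itv_mvt zy (F := prim a x) (g := v x).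
  by move=> r /andP[zr _]; apply: is_derive_prim => //; exact: lt_le_trans zr.
rewrite normrM ler_piMl// ger0_norm.
  by case/andP : (v01 x (lt_trans a0 (lt_le_trans az zc))) => _ /ltW.
by case/andP : (v01 x (lt_trans a0 (lt_le_trans az zc))).
Qed.

(* With Q(s) the integral of v - v(t0) over [t0, t0 + s], the function
   Y = \int Q^2 is nonnegative and vanishes at 0, so Y' >= 0 somewhere by the
   mean value theorem; times are shifted by t0/2 since everything is only
   differentiable at positive times. *)
Lemma initial_sign t0 d : 0 < t0 -> 0 < d -> exists2 h, 0 < h < d &
  0 <= \int[mu]_(x in O) ((stek h x t0 - v x t0) * dstek h x t0).
Proof.
move=> t00 d0; pose a := t0 / 2.
have a0 : 0 < a by rewrite divr_gt0.
have at0 : a < t0 by rewrite gtr_pMr// invf_lt1// ltr1n.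
have aD s : 0 < s -> a < a + s by rewrite ltrDl.
pose b := t0 - a.
have b0 : 0 < b by rewrite subr_gt0.
have ab : a + b = t0 by rewrite /b subrKC.
pose P x (s : R) := prim a x (a + s).
have cP : jcont setT P.
  apply: jcont_lipschitz => [x t t0'|x s t s0 t0'].
    exact: (@prim_continuous a (a + t) x a0 (aD t t0')).
  apply: le_trans (prim_lip x a0 (aD s s0) (aD t t0')) _.
  by rewrite opprD addrACA subrr add0r.
have ctime (F : R -> R) : (forall t, 0 < t -> {for t, continuous F}) ->
  jcont setT (fun _ : 'rV[R]_n => F) by exact: jcont_time.
have cspace (F : 'rV[R]_n -> R) : (forall x, {for x, continuous F}) ->
  jcont setT (fun x (_ : R) => F x).
  move=> cF x r _ _; apply: (@continuous_comp _ _ _ fst F); [exact: cvg_fst|exact: cF].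
have cvt0 : jcont setT (fun x (_ : R) => v x t0).
  by apply: cspace => x; exact: (jcont_x cv _ t00).
pose q x (s : R) := v x (a + s) - v x t0.
have cq : jcont setT q.
  apply: jcontB => //; have := jcont_shift (ltW a0) cv.
  by under [fun x t => v x (t + a)]eq_fun2 do rewrite addrC.
pose Q x (s : R) := P x s - prim a x t0 - (s - b) * v x t0.
have cQ : jcont setT Q.
  apply: jcontB; first apply: jcontB => //.
    by apply: cspace => x; exact: prim_continuous.
  apply: jcontM => //; apply: ctime => t _.
  exact: (cvgB (@cvg_id _ (nbhs t)) (cvg_cst b)).
have dP x s : 0 < s -> is_derive s 1 (P x) (v x (a + s)).
  move=> s0; have d1 := is_derive_prim x a0 (aD s s0).
  have d2 := is_deriveD (is_derive_cst a s (1 : R)) (is_derive_id s (1 : R)).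
  by have := is_derive1_comp d1 d2; rewrite add0r mulr1.
have dQ x s : 0 < s -> is_derive s 1 (Q x) (q x s).
  move=> s0.
  have d1 := is_deriveB (dP x s s0) (is_derive_cst (prim a x t0) s (1 : R)).
  have d2 := is_deriveB (is_derive_id s (1 : R)) (is_derive_cst b s (1 : R)).
  have d3 := is_deriveM d2 (is_derive_cst (v x t0) s (1 : R)).
  apply: (is_derive_eq (is_deriveB d1 d3)).
  by rewrite /q /GRing.scale/= mulr0 add0r !subr0 mulr1.
pose Y (s : R) := \int[mu]_(x in O) (Q x s * Q x s).
pose Y' (s : R) := \int[mu]_(x in O) (Q x s * q x s + Q x s * q x s).
have dY s : 0 < s -> is_derive s 1 Y (Y' s).
  move=> s0; have s20 : 0 < s / 2 by rewrite divr_gt0.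
  apply: (@is_derive_integral _ _ _ oO bO (fun x s => Q x s * Q x s)
    (fun x s => Q x s * q x s + Q x s * q x s) (s / 2) s s20).
  - by rewrite gtr_pMr// invf_lt1// ltr1n.
  - by apply: jcontD; apply: jcontM.
  - move=> r sr; apply: (jcont_integrable oO bO (jcontM cQ cQ)).
    exact: lt_trans sr.
  - move=> x r _ sr; have r0 := lt_trans s20 sr.
    exact: (is_deriveM (dQ x r r0) (dQ x r r0)).
have bd : b < b + d by rewrite ltrDl.
(* The mean value point is interior, so [h = c - b] lies strictly between 0 and [d]. At [c] both [Q]
   and [q] carry a factor [h], hence the positive factor in [Y'E]. *)
have [||c] := @MVT R Y Y' b (b + d) bd.
- by move=> s; rewrite in_itv/= => /andP[bs _]; apply: dY; exact: lt_trans bs.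
- apply: continuous_in_subspaceT => s; rewrite inE/= in_itv/= => /andP[bs _].
  by apply: is_derive_continuous (dY s _); exact: lt_le_trans bs.
rewrite in_itv/= => /andP[bc cbd] EY.
have Qb x : Q x b = 0 by rewrite /Q /P ab !subrr mul0r subr0.
have Y0 : Y b = 0.
  rewrite /Y (_ : (fun x => _) = cst 0) ?Rintegral_cst ?mul0r//.
  by apply/funext => x; rewrite Qb mul0r.
have Yd : 0 <= Y (b + d) by apply: Rintegral_ge0 => x _; rewrite -expr2 sqr_ge0.
have h0 : 0 < c - b by rewrite subr_gt0.
exists (c - b); first by rewrite h0 ltrBlDl.
have tE : t0 + (c - b) = a + c by rewrite -ab; ring.
have Qc x : Q x c = (c - b) * (stek (c - b) x t0 - v x t0).
  by rewrite /Q /P mulrBr -(primB x a0 at0 h0) tE.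
have qc x : q x c = (c - b) * dstek (c - b) x t0.
  by rewrite /dstek tE mulrA divff ?mul1r// gt_eqF.
have Y'E : Y' c = 2 * (c - b) ^+ 2 *
    \int[mu]_(x in O) ((stek (c - b) x t0 - v x t0) * dstek (c - b) x t0).
  rewrite -RintegralZl//.
    by apply: eq_Rintegral => x _; rewrite Qc qc; ring.
  apply: (continuous_integrable oO bO) => x.
  have c1 := jcont_x (jcont_stek h0) (I : setT x) t00.
  have c2 := jcont_x (jcont_dstek h0) (I : setT x) t00.
  have c3 := jcont_x cv (I : setT x) t00.
  exact: (cvgM (cvgB c1 c3) c2).
have : 0 <= Y' c.
  by rewrite -(pmulr_lge0 _ d0) -[d in _ * d](addKr b) (addrC _ (b + d)) -EY Y0 subr0.
by rewrite Y'E pmulr_rge0// mulr_gt0// exprn_gt0.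
Qed.

(** Convexity with the competitor [v] at time [t0], whose energy is finite by hypothesis. The
    [fstek] part of the error is small by uniform continuity, and the [dstek] part has a favourable
    sign for the [h] given by [initial_sign]; so some [h] below [d] is obtained, not every one. *)
Lemma initial_energy t0 d e : 0 < t0 -> 0 < d -> 0 < e ->
  mu.-integrable O (EFin \o (sqv ^~ t0)) ->
  exists2 h, 0 < h < d & nrg h t0 <= 2^-1 * \int[mu]_(x in O) sqv x t0 + e.
Proof.
move=> t00 d0 e0 iS.
have [C C0 CP] := fstek_bounded t00.
have m1 : 0 < m + 1 by rewrite ltr_wpDl.
(* [w] will bound [stek - v] and [C] bounds [fstek], so the integral is at most [w * C * m]. *)
pose w := e / (C * (m + 1)).
have w0 : 0 < w by rewrite divr_gt0// mulr_gt0.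
have [r r0 rP] := jcont_uniformO bO t0 cv t00 w0.
pose d' := Num.min d (Num.min 1 r).
have d'0 : 0 < d' by rewrite !lt_min d0 ltr01 r0.
have [h /andP[h0 hd'] hs] := initial_sign t00 d'0.
move: hd'; rewrite !lt_min => /andP[hd /andP[h1 hr]].
exists h; first by rewrite h0.
rewrite -lerBlDl.
have H := nrg_convex h0 t00 (v_vanishing t00) (v_grad t00) _ iS.
apply: (le_trans (H _)); first by move=> x; case/andP : (v01 x t00) => _ /ltW.
have c1 x := jcont_x (jcont_stek h0) (I : setT x) t00.
have c2 x := jcont_x (jcont_dstek h0) (I : setT x) t00.
have c3 x := jcont_x cv (I : setT x) t00.
have c4 x := jcont_x (jcont_fstek h0) (I : setT x) t00.
have i1 : mu.-integrable O (EFin \o (fun x => (stek h x t0 - v x t0) * fstek h x t0)).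
  by apply: (continuous_integrable oO bO) => x; exact: (cvgM (cvgB (c1 x) (c3 x)) (c4 x)).
have i2 : mu.-integrable O (EFin \o (fun x => (stek h x t0 - v x t0) * dstek h x t0)).
  by apply: (continuous_integrable oO bO) => x; exact: (cvgM (cvgB (c1 x) (c3 x)) (c2 x)).
have -> : \int[mu]_(x in O) ((stek h x t0 - v x t0) * rhs h x t0) =
  \int[mu]_(x in O) ((stek h x t0 - v x t0) * fstek h x t0) -
  \int[mu]_(x in O) ((stek h x t0 - v x t0) * dstek h x t0).
  by rewrite -RintegralB//; apply: eq_Rintegral => x _; rewrite mulrBr.
rewrite lerBlDr (le_trans (ler_norm _))//.
apply: (@le_trans _ _ (w * C * m)).
  apply: (Rintegral_bound oO bO) => // x Ox; rewrite normrM.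
  have T0 : 0 < t0 <= t0 by rewrite t00 lexx.
  have h01 : 0 < h < 1 by rewrite h0.
  have /andP[F0 FC] := CP h x t0 h01 T0.
  apply: ler_pM => //; last by rewrite ger0_norm.
  apply: avg_dist => // [s s0|s /andP[ts sth]]; first exact: cvx.
  rewrite distrC ltW// rP ?lexx//.
  by rewrite ler0_norm ?subr_le0// opprB (le_lt_trans _ hr)// lerBlDl.
rewrite ler_wpDr//.
rewrite (_ : _ * m = e * (m / (m + 1))).
  by rewrite ler_piMr ?(ltW e0)// ler_pdivrMr// mul1r lerDl.
by rewrite /w; field; rewrite !gt_eqF.
Qed.

(** * The two energy estimates *)

Let sinv0 : (k.+1%:R^-1 : R) @[k --> \oo] --> 0.
Proof. exact: cvg_harmonic. Qed.

Lemma cvg_squeeze0 (h_ : R^nat) : (forall k, 0 < h_ k < k.+1%:R^-1) -> h_ @ \oo --> 0.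
Proof.
move=> hk; apply: (@squeeze_cvgr _ _ _ _ (cst 0) (fun k => k.+1%:R^-1)) => //.
  by apply: nearW => k; have /andP[/ltW -> /ltW ->] := hk k.
exact: cvg_cst.
Qed.

Lemma energy_from t0 T : 0 < t0 -> t0 <= T ->
  mu.-integrable O (EFin \o (sqv ^~ t0)) ->
  (\int[leb]_(t in `[t0, T]) \int[mu]_(x in O) (vt x t ^+ 2)%:E +
   (2^-1)%:E * \int[mu]_(x in O) (sqv x T)%:E <=
   (2^-1 * \int[mu]_(x in O) sqv x t0 + ebound)%:E)%E.
Proof.
move=> t00 t0T iS; set P := 2^-1 * _.
have P0 : 0 <= P.
  rewrite mulr_ge0// Rintegral_ge0// => x _.
  by apply: sumr_ge0 => i _; exact: sqr_ge0.
have K (k : nat) : exists h, 0 < h < k.+1%:R^-1 /\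
    nrg h T + \int[leb]_(t in `[t0, T]) dsq h t <= P + ebound + (k.+1%:R^-1 + k.+1%:R^-1).
  have k0 : (0 : R) < k.+1%:R^-1 by rewrite invr_gt0.
  have Pk0 : 0 <= P + k.+1%:R^-1 by rewrite addr_ge0// ltW.
  (* The threshold [d] comes before [h], because [initial_energy] only finds an [h] below a
     prescribed bound. One error term is due to each of the two lemmas. *)
  have [d d0 dP] := energy_step t00 t0T Pk0 k0.
  have d'0 : 0 < Num.min d k.+1%:R^-1 by rewrite lt_min d0 k0.
  have [h /andP[h0 hd] hE] := initial_energy t00 d'0 k0 iS.
  move: hd; rewrite lt_min => /andP[hd hk].
  exists h; split; first by rewrite h0.
  have hd0 : 0 < h < d by rewrite h0.
  by apply: le_trans (dP h hd0 hE) _; rewrite [leRHS]addrA lerD2r addrAC.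
have [h_ hP] := choice K.
have h0 k : 0 < h_ k by have [/andP[]] := hP k.
have h_0 : h_ @ \oo --> 0 by apply: cvg_squeeze0 => k; have [] := hP k.
apply: (@energy_limit T _ (cst t0) h_ (fun k => k.+1%:R^-1 + k.+1%:R^-1)) => //.
- exact: lt_le_trans t0T.
- by move=> t; rewrite /= !in_itv/= => /andP[tt ->]; rewrite (lt_le_trans t00).
- by move=> t; rewrite /= in_itv/= => /andP[tt _]; exact: nearW.
- by move=> k; rewrite t00.
- by rewrite -[X in _ --> X]addr0; exact: (cvgD sinv0 sinv0).
- by move=> k; have [] := hP k.
Qed.

(** Three scales: at a tiny time [r], chosen after [h], the energy of the average is small by
    [nrg_start]; [nrg_growth] carries this to a small time [s] fixed before [h]; from [s] the energy
    inequality applies. *)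
Lemma energy_from0 T : 0 < T ->
  (forall e, 0 < e -> exists2 d, 0 < d & forall t, 0 < t < d -> mass t <= e) ->
  (\int[leb]_(t in `]0%R, T]) \int[mu]_(x in O) (vt x t ^+ 2)%:E +
   (2^-1)%:E * \int[mu]_(x in O) (sqv x T)%:E <= ebound%:E)%E.
Proof.
move=> T0 mass0.
have [C1 C10 C1P] := nrg_growth T0; have [C2 C20 C2P] := nrg_start T0.
have mass_ge0 t : 0 < t -> 0 <= mass t.
  by move=> t0; apply: Rintegral_ge0 => x _; case/andP : (v01 x t0).
have small s e : 0 < s <= T -> 0 < e -> exists2 d, 0 < d & forall h, 0 < h < d ->
    nrg h s <= C1 * s + e.
  move=> /andP[s0 sT] e0.
  (* [nrg_start] will contribute [C2] times this quantity from the averages and once more from the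
     mass at the start, [e] in all. *)
  have e1 : 0 < e / (C2 + 1) by rewrite divr_gt0// addr_gt0.
  have [d1 d10 d1P] := mass0 _ e1.
  exists (Num.min 1 (d1 / 2)); first by rewrite lt_min ltr01 divr_gt0.
  move=> h /andP[h0]; rewrite lt_min => /andP[h1 hd1].
  have [d2 d20 d2P] := mass0 _ (mulr_gt0 h0 e1).
  (* [d1 / 2] keeps the window [[r, r + h]] where the mass is small; [d2], which depends on [h],
     makes [mass r] small compared with [h]. *)
  pose r := Num.min s (Num.min (d1 / 2) (d2 / 2)).
  have r0 : 0 < r by rewrite !lt_min s0 !divr_gt0.
  have rs : r <= s by rewrite ge_min lexx.
  have rd1 : r <= d1 / 2 by rewrite !ge_min lexx orbT.
  have rd2 : r < d2.
    apply: (@le_lt_trans _ _ (d2 / 2)); first by rewrite !ge_min lexx !orbT.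
    by rewrite gtr_pMr// invf_lt1// ltr1n.
  have h01 : 0 < h < 1 by rewrite h0.
  have rsT : r <= s <= T by rewrite rs.
  apply: (le_trans (C1P h r s h01 r0 rsT)).
  have rT : 0 < r <= T by rewrite r0 (le_trans rs).
  have A : nrg h r <= e.
    apply: (le_trans (C2P h r (e / (C2 + 1)) h01 rT _)).
      move=> t /andP[rt trh]; apply: d1P; rewrite (lt_le_trans r0 rt)/=.
      by rewrite (le_lt_trans trh)// [ltRHS]splitr ler_ltD.
    have B : h^-1 * mass r <= e / (C2 + 1).
      by rewrite ler_pdivrMl//; apply: d2P; rewrite r0.
    rewrite (le_trans (lerD (lexx _) B))//.
    rewrite -[X in _ + X]mul1r -mulrDl mulrC divfK// gt_eqF// addr_gt0//.
  rewrite addrC lerD// ler_pM2l// gerBl ltW//.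
have K (k : nat) : exists sh : R * R, [/\ 0 < sh.1 <= T, sh.1 < k.+1%:R^-1,
    0 < sh.2 < k.+1%:R^-1 & nrg sh.2 T + \int[leb]_(t in `[sh.1, T]) dsq sh.2 t <=
    ebound + (C1 * k.+1%:R^-1 + k.+1%:R^-1 + k.+1%:R^-1)].
  have k0 : (0 : R) < k.+1%:R^-1 by rewrite invr_gt0.
  pose s := Num.min T (k.+1%:R^-1 / 2).
  have s0 : 0 < s by rewrite lt_min T0 divr_gt0.
  have sT : s <= T by rewrite ge_min lexx.
  have sk : s < k.+1%:R^-1.
    apply: (@le_lt_trans _ _ (k.+1%:R^-1 / 2)); first by rewrite ge_min lexx orbT.
    by rewrite gtr_pMr// invf_lt1// ltr1n.
  have sT0 : 0 < s <= T by rewrite s0.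
  have [d1 d10 d1P] := small s _ sT0 k0.
  have E0 : 0 <= C1 * s + k.+1%:R^-1 by rewrite addr_ge0 ?mulr_ge0// ltW.
  have [d2 d20 d2P] := energy_step s0 sT E0 k0.
  pose h := Num.min (k.+1%:R^-1) (Num.min d1 d2) / 2.
  have q0 : 0 < Num.min (k.+1%:R^-1) (Num.min d1 d2) by rewrite !lt_min k0 d10.
  have h0 : 0 < h by rewrite divr_gt0.
  have : h < Num.min (k.+1%:R^-1) (Num.min d1 d2).
    by rewrite gtr_pMr// invf_lt1// ltr1n.
  rewrite !lt_min => /andP[hk /andP[h1 h2]].
  exists (s, h); split => //=; first by rewrite h0.
  have hd1 : 0 < h < d1 by rewrite h0.
  have hd2 : 0 < h < d2 by rewrite h0.
  apply: le_trans (d2P h hd2 (d1P h hd1)) _.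
  rewrite (addrC _ ebound) -addrA lerD2l// lerD2r lerD2r ler_pM2l//.
  exact: ltW.
have [sh shP] := choice K.
have h_0 : (fun k => (sh k).2) @ \oo --> 0.
  by apply: cvg_squeeze0 => k; have [] := shP k.
have s_0 : (fun k => (sh k).1) @ \oo --> 0.
  by apply: cvg_squeeze0 => k; have [/andP[-> _] ->] := shP k.
apply: (@energy_limit T _ (fun k => (sh k).1) (fun k => (sh k).2)
  (fun k => C1 * k.+1%:R^-1 + k.+1%:R^-1 + k.+1%:R^-1)) => //.
- move=> t; rewrite /= in_itv/= => /andP[t0 _].
  have := iffLR (cvgrPdist_lt _ _) s_0 t => /(_ _ t0).
  apply: filterS => k; rewrite sub0r normrN => /(le_lt_trans (ler_norm _)).
  exact: ltW.
- by move=> k; have [] := shP k.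
- by move=> k; have [_ _ /andP[]] := shP k.
- rewrite (_ : nbhs 0 = nbhs (C1 * 0 + 0 + 0)); last by rewrite mulr0 !addr0.
  exact: (cvgD (cvgD (cvgM (cvg_cst C1) sinv0) sinv0) sinv0).
- by move=> k; have [] := shP k.
Qed.

End energy.
(** * Global solutions *)

Section global_solution.
Context {R : realType} {n : nat}.
Variable Omega : set 'rV[R]_n.
Hypotheses (oO : open Omega) (bO : bounded_set Omega).
Variables (lam chi : R) (u0 : 'rV[R]_n -> R) (u : 'rV[R]_n -> R -> R).
Hypothesis uP : global_solution Omega lam chi u0 u.
Local Notation mu := (lebesgue_rV n).
Local Notation I := (@time_interval R +oo%E).
Implicit Types (x : 'rV[R]_n) (t : R) (i : 'I_n).

Lemma time_intervalE t : I t <-> 0 < t.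
Proof. by split=> [[]|t0]; [rewrite lte_fin|split; [rewrite lte_fin|exact: ltry]]. Qed.

Lemma nbhs_time (A : set 'rV[R]_n) x t : nbhs x A -> 0 < t -> nbhs (x, t) (A `*` I).
Proof.
move=> xA t0; exists (A, I); last by move=> [].
split => //=; near=> s; apply/time_intervalE; near: s; exact: lt_nbhsr.
Unshelve. all: by end_near. Qed.

Lemma continuous_on_jcont G : continuous_on Omega I G -> jcont Omega G.
Proof.
move=> /subspace_continuousP cG x t Ox t0.
have It : I t by exact/time_intervalE.
have := cG (x, t) (conj Ox It); rewrite within_interior//.
by apply: nbhs_time => //; exact: open_nbhs_nbhs.
Qed.

(** Away from the closure of [Omega] the values of [u] are arbitrary, whereas the energy estimates
    ask for a function continuous on the whole space and zero outside [Omega]. *)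
Definition ext_u x t := if x \in Omega then u x t else 0.

Lemma ext_uE x : Omega x -> ext_u x = u x.
Proof. by move=> Ox; apply/funext => t; rewrite /ext_u mem_set. Qed.

Lemma ext_u_out x t : ~ Omega x -> ext_u x t = 0.
Proof. by move=> nOx; rewrite /ext_u memNset. Qed.

Lemma ext_u_range x t : 0 < t -> 0 <= ext_u x t < 1.
Proof.
move=> t0; rewrite /ext_u; case: ifPn => [|_]; last by rewrite lexx ltr01.
rewrite inE => Ox; apply: (solution_range uP); last exact/time_intervalE.
exact: subset_closure.
Qed.

(** Inside [Omega] and off its closure the matter is local. At a boundary point [u] is 0 and
    continuous within the closure, and neighbouring points outside [Omega] contribute exact
    zeros. *)
Lemma jcont_ext_u : jcont setT ext_u.
Proof.
have cu := iffLR (subspace_continuousP _ _) (solution_continuous uP).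
move=> x t _ t0; have It : I t by exact/time_intervalE.
have [Ox|nOx] := pselect (Omega x).
  have [cO _ _ _] := solution_C21 uP.
  have c := continuous_on_jcont cO Ox t0.
  suff : ext_u p.1 p.2 @[p --> nbhs (x, t)] --> ext_u x t by [].
  rewrite ext_uE//.
  apply: cvg_trans c; apply: near_eq_cvg.
  have : nbhs (x, t) (Omega `*` I) by apply: nbhs_time => //; exact: open_nbhs_nbhs.
  by apply: filterS => -[y s] [/= Oy _]; rewrite ext_uE.
suff : ext_u p.1 p.2 @[p --> nbhs (x, t)] --> ext_u x t by [].
rewrite ext_u_out//.
have [cOx|ncOx] := pselect (closure Omega x); last first.
  apply: (@cvg_near_cst _ _ _ _ (nbhs (x, t))).
  have : nbhs (x, t) ((~` closure Omega) `*` I).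
    apply: nbhs_time => //; apply: open_nbhs_nbhs; split => //.
    exact/closed_openC/closed_closure.
  apply: filterS => -[y s] [/= nOy _]; apply: ext_u_out.
  by apply: contra_not nOy; exact: subset_closure.
have ux : u x t = 0.
  by apply: (solution_boundary uP) => //; split => // /interior_subset.
have c : u p.1 p.2 @[p --> within (closure Omega `*` I) (nbhs (x, t))] --> 0.
  by rewrite -ux; exact: (cu (x, t) (conj cOx It)).
apply/cvgrPdist_lt => e e0.
have := iffLR (cvgrPdist_lt _ _) c e => /(_ _ e0).
have : nbhs (x, t) (setT `*` I) by apply: nbhs_time => //; exact: filterT.
apply: filterS2 => -[y s] [/= _ Is] H.
have [Oy|nOy] := pselect (Omega y); last by rewrite ext_u_out// subrr normr0.
rewrite ext_uE//; apply: H; split => //=.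
exact: subset_closure.
Qed.

Lemma ext_u_sup T : 0 < T ->
  exists2 M, M < 1 & forall x t, 0 < t <= T -> ext_u x t <= M.
Proof.
move=> T0; have := solution_sup uP (iffRL (time_intervalE T) T0).
set S := [set _ | _ in _] => S1; exists (Num.max (sup S) 0).
  by rewrite gt_max S1 ltr01.
move=> x t /andP[t0 tT]; rewrite /ext_u; case: ifPn => [|_]; last by rewrite le_max lexx orbT.
(* [sup] is an upper bound only of a set bounded above; the bound 1 comes from the range condition.
   The maximum with 0 took care of points outside [Omega]. *)
rewrite inE => Ox; rewrite le_max; apply/orP; left; apply: ub_le_sup.
  exists 1 => r [[y s] [/= cy]]; rewrite in_itv/= => /andP[s0 _] <-.
  by have /andP[_ /ltW] := solution_range uP cy (iffRL (time_intervalE s) s0).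
exists (x, t) => //; split => /=; first exact: subset_closure.
by rewrite in_itv/= t0.
Qed.

Lemma ext_u_grad i x t : Omega x -> 0 < t ->
  is_derive x (delta_mx ord0 i) (ext_u ^~ t) (partial_x i u x t).
Proof.
move=> Ox t0; have [_ /(_ i)[d _] _ _] := solution_C21 uP.
have du : is_derive x (delta_mx ord0 i) (u ^~ t) (partial_x i u x t).
  by split => //; apply: d => //; exact/time_intervalE.
apply: near_eq_is_derive du.
have : nbhs x Omega by exact: open_nbhs_nbhs.
by apply: filterS => y Oy; rewrite ext_uE.
Qed.

Lemma partial_grad i x t : Omega x -> 0 < t ->
  is_derive x (delta_mx ord0 i) (partial_x i u ^~ t) (partial_x i (partial_x i u) x t).
Proof.
move=> Ox t0; have [_ _ /(_ i i)[d _] _] := solution_C21 uP.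
by split => //; apply: d => //; exact/time_intervalE.
Qed.

Lemma jcont_partial i : jcont Omega (partial_x i u).
Proof. by have [_ /(_ i)[_ /continuous_on_jcont]] := solution_C21 uP. Qed.

Lemma jcont_partial2 i : jcont Omega (partial_x i (partial_x i u)).
Proof. by have [_ _ /(_ i i)[_ /continuous_on_jcont]] := solution_C21 uP. Qed.

Lemma jcont_partial_t : jcont Omega (partial_t u).
Proof. by have [_ _ _ [_ /continuous_on_jcont]] := solution_C21 uP. Qed.

Lemma ext_u_time x t : Omega x -> 0 < t -> is_derive t 1 (ext_u x) (partial_t u x t).
Proof.
move=> Ox t0; rewrite ext_uE//; have [_ _ _ [d _]] := solution_C21 uP.
split; first by apply: d => //; exact/time_intervalE.
by rewrite /partial_t derive1E.
Qed.

Lemma ext_u_equation x t : Omega x -> 0 < t ->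
  partial_t u x t = \sum_i partial_x i (partial_x i u) x t +
    lam * rsrc Omega chi ext_u x t ^+ 2.
Proof.
move=> Ox t0; rewrite (solution_equation uP Ox (iffRL (time_intervalE t) t0)).
congr (_ + _); rewrite /source /rsrc /recip /gsum ext_uE//.
have -> : \int[mu]_(y in Omega) (1 - ext_u y t)^-1 = \int[mu]_(y in Omega) (1 - u y t)^-1.
  by apply: eq_Rintegral => y; rewrite inE => Oy; rewrite ext_uE.
by rewrite -exprMn -exprVn invfM.
Qed.

(** With zero initial data the L^1 distance of [u] to [u0] is the mass itself, so attaining the
    initial value in L^1 means that the mass tends to 0. *)
Lemma ext_u_mass : {ae mu, forall x, Omega x -> u0 x = 0} ->
  measurable_fun Omega u0 ->
  forall e, 0 < e -> exists2 d, 0 < d & forall t, 0 < t < d -> mass Omega ext_u t <= e.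
Proof.
move=> u00 mu0 e e0.
have mO : measurable Omega by exact: measurable_rV_open.
have massE t : 0 < t ->
    (\int[mu]_(x in Omega) `|u x t - u0 x|%:E)%E = (mass Omega ext_u t)%:E.
  move=> t0; have iu := jcont_integrable oO bO jcont_ext_u t0.
  rewrite /mass /Rintegral fineK; last exact: integrable_fin_num.
  apply: ae_eq_integral => //.
  - apply/measurable_EFinP; apply: measurableT_comp => //.
    apply: measurable_funB => //; apply: open_continuous_measurable_rV => // x Ox.
    have [cO _ _ _] := solution_C21 uP.
    exact: (jcont_x (continuous_on_jcont cO) Ox t0).
  - by case/integrableP : iu.
  - apply: filterS u00 => x Hx Ox /=; rewrite Hx// subr0 ext_uE// ger0_norm//.
    by have /andP[] := ext_u_range x t0; rewrite ext_uE.
have := solution_initial uP => /fine_cvgP[_ /cvgrPdist_le/(_ e)/(_ e0)].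
case=> d /= d0 dP; exists d => // t /andP[t0 td].
have := dP t; rewrite /= !sub0r !normrN massE//= gtr0_norm// => /(_ td t0).
by apply: le_trans; exact: ler_norm.
Qed.

End global_solution.
Theorem theorem2p3 (R : realType) (n : nat) (n_gt0 : (0 < n)%N)
    (Omega : set 'rV[R]_n) (OmegaP : bounded_C2_domain Omega)
    (lambda chi : R) (lambda_gt0 : 0 < lambda) (chi_gt0 : 0 < chi)
    (u0 : 'rV[R]_n -> R)
    (u0_L1 : (lebesgue_rV n).-integrable Omega (EFin \o u0))
    (a : R) (a01 : 0 < a < 1)
    (u0_bounds : {ae lebesgue_rV n, forall x, Omega x -> 0 <= u0 x <= a})
    (u : 'rV[R]_n -> R -> R) (uP : global_solution Omega lambda chi u0 u) :
  let energy_bound : R :=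
    lambda / (chi * (1 + chi * fine (lebesgue_rV n Omega))) in
  (forall t0 T : R, 0 < t0 -> t0 < T ->
    (\int[lebesgue_measure]_(t in `[t0, T])
        (\int[lebesgue_rV n]_(x in Omega) (partial_t u x t ^+ 2)%:E)
      + (2^-1)%:E * \int[lebesgue_rV n]_(x in Omega) (sqr_grad u x T)%:E
    <= (2^-1)%:E * \int[lebesgue_rV n]_(x in Omega) (sqr_grad u x t0)%:E
      + energy_bound%:E)%E) /\
  ({ae lebesgue_rV n, forall x, Omega x -> u0 x = 0} ->
   forall T : R, 0 < T ->
    (\int[lebesgue_measure]_(t in `]0%R, T])
        (\int[lebesgue_rV n]_(x in Omega) (partial_t u x t ^+ 2)%:E)
      + (2^-1)%:E * \int[lebesgue_rV n]_(x in Omega) (sqr_grad u x T)%:E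
    <= energy_bound%:E)%E).
Proof.
move=> energy_bound; have [oO _ _ bO _] := OmegaP.
have mO : measurable Omega by exact: measurable_rV_open.
have cvi i := @jcont_partial _ _ _ oO _ _ _ _ uP i.
have cvii i := @jcont_partial2 _ _ _ oO _ _ _ _ uP i.
have sq0 x t : 0 <= sqr_grad u x t by apply: sumr_ge0 => i _; exact: sqr_ge0.
split=> [t0 T t00 t0T|u00 T T0].
  set S := (\int[lebesgue_rV n]_(x in Omega) (sqr_grad u x t0)%:E)%E.
  (* If the energy at [t0] is infinite the right-hand side is [+oo]; otherwise the gradient at [t0]
     is square integrable, as the choice of competitor requires. *)
  have [Soo|] := eqVneq S +oo%E.
    by rewrite Soo mulry gtr0_sg ?invr_gt0// mul1e addye// leey.
  rewrite -ltey => Sfin.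
  have iS : (lebesgue_rV n).-integrable Omega
      (EFin \o (sqv (fun i => partial_x i u) ^~ t0)).
    apply/integrableP; split.
      apply/measurable_EFinP; apply: open_continuous_measurable_rV => // x Ox.
      apply: sum_continuous => i.
      have c := jcont_x (cvi i) Ox t00; exact: (cvgM c c).
    apply: le_lt_trans Sfin; rewrite le_eqVlt; apply/orP; left; apply/eqP.
    by apply: eq_integral => x _; rewrite /= ger0_norm//; exact: sq0.
  have := energy_from oO bO lambda_gt0 chi_gt0 (jcont_ext_u oO uP)
    (ext_u_out u) (ext_u_range uP) (ext_u_sup uP) cvi (ext_u_grad oO uP)
    cvii (partial_grad uP) (jcont_partial_t oO uP)
    (ext_u_time uP) (ext_u_equation uP) t00 (ltW t0T) iS.
  move=> H; apply: le_trans H _.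
  by rewrite EFinD EFinM /Rintegral fineK//; exact: integrable_fin_num.
have mu0 : measurable_fun Omega u0.
  by case/integrableP : u0_L1 => /measurable_EFinP.
exact: (energy_from0 oO bO lambda_gt0 chi_gt0 (jcont_ext_u oO uP)
  (ext_u_out u) (ext_u_range uP) (ext_u_sup uP) cvi (ext_u_grad oO uP)
  cvii (partial_grad uP) (jcont_partial_t oO uP)
  (ext_u_time uP) (ext_u_equation uP) T0 (ext_u_mass oO bO uP u00 mu0)).
Qed.
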